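(* There is an implementation of Algorithm A (described in the context) that uses $O(n\log(n))$ operations: there is an implementation which, for every $n$ and every input $z\in\mathcal{T}$, $w\in\mathcal{T}\setminus\{0\}$, $\varepsilon>0$ (with $z,w\in\mathbf{R}^n$), executes Algorithm A and produces its output in $O(n\log(n))$ operations, where the implied constant does not depend on $n$, $z$, $w$ or $\varepsilon$.
   Context: Notation. $\mathcal{T}:=\{x\in\mathbf{R}^n \mid x_1\ge x_2\ge\cdots\ge x_n\ge 0\}$, and $\langle\cdot,\cdot\rangle$, $\|\cdot\|$ are the Euclidean inner product and norm. An operation is an arithmetic operation, comparison, or elementary memory/data-structure step at unit cost, with real numbers as atomic data. $\mathcal{P}_n$ is the set of partitions of $\{1,\dots,n\}$ all of whose members are intervals of consecutive integers. For $y\in\mathbf{R}^n$, $\mathcal{G}(y)\in\mathcal{P}_n$ is the partition of $\{1,\dots,n\}$ into the maximal intervals on which $y$ is nondecreasing, i.e. $i$ and $i+1$ lie in the same group if and only if $y_i\le y_{i+1}$. For $y\in\mathbf{R}^n$ and $\mathcal{G}\in\mathcal{P}_n$, the averaged vector $y_{\mathcal{G}}\in\mathbf{R}^n$ is given by $(y_{\mathcal{G}})_i:=\frac{1}{|G|}\sum_{k\in G}y_k$ for $i\in G\in\mathcal{G}$. For $\kappa>0$, $\Delta(\kappa,n):=\{x\in\mathbf{R}^n\mid 0\le x_i\le\kappa \text{ for all } i,\ \sum_{i=1}^n x_i=\kappa\}$, and $P_C$ denotes Euclidean projection onto a closed convex set $C$. Algorithm A. Input: $z\in\mathcal{T}$,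 $w\in\mathcal{T}\setminus\{0\}$, $\varepsilon>0$. Its purpose is to compute $\operatorname{argmin}_x\frac12\|x-z\|^2$ subject to $\langle w,x\rangle=\varepsilon$, $x\in\mathcal{T}$, for $\langle z,w\rangle>\varepsilon$. Initialize: $w\leftarrow w_{\mathcal{G}(z)}$. Repeat (one pass is one outer loop): 1. Compute $r\leftarrow\min\{\frac{z_i-z_{i+1}}{w_i-w_{i+1}}\mid i=1,\dots,n-1\}$ (a ratio with zero denominator is $\infty$, including $0/0=\infty$; the minimum of the empty set is $\infty$); $\lambda_0\leftarrow\frac{\left(\sum_{\{i\mid z_i>z_n\}}z_iw_i\right)-\varepsilon}{\sum_{\{i\mid z_i>z_n\}}w_i^2}$; $\lambda_1\leftarrow\frac{\langle z,w\rangle-\varepsilon}{\|w\|^2}$; $n'\leftarrow\min(\{k\mid z_k-\lambda_0w_k<0\}\cup\{n+1\})$; $\mathcal{G}_0\leftarrow\{G\in\mathcal{G}(z)\mid\max(G)<n'\}\cup\{\{n',\dots,n\}\}$. (If $z$ is constant, $\lambda_0$, $n'$, $\mathcal{G}_0$ are not needed, because then $r=\infty$ and the algorithm exits in test (a) or (b).) 2. Tests, in order: (a) If $\langle z,w\rangle\le\varepsilon$: output $z$ and exit. (b) If $r=\infty$: output $P_{\Delta(\varepsilon/w_1,n)}(z)$ and exit. (c) If $\lambda_1>r$: with $\mathcal{G}:=\mathcal{G}(z-\lambda_1w)$, replace $(z,w)$ by $(z_{\mathcal{G}},w_{\mathcal{G}})$ and go to step 1. (d) If $\lambda_1\le r<\infty$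 and $z_n-\lambda_1w_n\ge0$: output $z-\lambda_1w$ and exit. (e) If $\lambda_1\le r<\infty$, $z_n-\lambda_1w_n<0$ and $\lambda_0>r$: with $\mathcal{G}:=\mathcal{G}(z-\lambda_0w)$, replace $(z,w)$ by $(z_{\mathcal{G}},w_{\mathcal{G}})$ and go to step 1. (f) If $\lambda_1\le r<\infty$, $z_n-\lambda_1w_n<0$, $\lambda_0\le r$, and $n'\le n$ with $z_{n'}=z_n$: output $\max\{z-\lambda_0w,0\}$ (componentwise) and exit. (g) If $\lambda_1\le r<\infty$, $z_n-\lambda_1w_n<0$, $\lambda_0\le r$, and $n'<n$ with $z_{n'}\ne z_n$: replace $(z,w)$ by $(z_{\mathcal{G}_0},w_{\mathcal{G}_0})$ and go to step 1. *)

(* Defs.v *)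
From HB Require Import structures.
From mathcomp Require Import all_boot all_order all_algebra.
From mathcomp Require Import constructive_ereal reals exp.
Set Implicit Arguments.
Unset Strict Implicit.
Unset Printing Implicit Defensive.
Import Order.TTheory GRing.Theory Num.Theory.
Local Open Scope ring_scope.

(** * Vectors

    R^n is ['rV[R]_n], with coordinates numbered from 0: the coordinate x_i of
    the usual 1-based notation is [x 0 j] with j = i - 1.  Algorithm A is
    written for dimension n.+1 because w <> 0 forces the dimension to be
    positive; the last coordinate is then [x 0 ord_max]. *)

Section Vectors.
Variable R : realType.

Definition dot n (x y : 'rV[R]_n) : R := \sum_i x 0 i * y 0 i.

(* [`|x|] on row vectors is the sup norm, so the Euclidean norm is defined
   here. *)
Definition enorm n (x : 'rV[R]_n) : R := Num.sqrt (dot x x).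

Definition in_T n (x : 'rV[R]_n) : Prop :=
  (forall i j : 'I_n, (i <= j)%N -> x 0 j <= x 0 i) /\
  (forall i : 'I_n, 0 <= x 0 i).

Definition simplex n (kappa : R) (x : 'rV[R]_n) : Prop :=
  (forall i : 'I_n, 0 <= x 0 i <= kappa) /\ \sum_i x 0 i = kappa.

Definition is_proj n (C : 'rV[R]_n -> Prop) (z p : 'rV[R]_n) : Prop :=
  C p /\ forall q, C q -> enorm (z - p) <= enorm (z - q).

Definition interval_set n (A : {set 'I_n}) : bool :=
  [forall i in A, forall j in A, forall k : 'I_n,
     (i <= k <= j)%N ==> (k \in A)].

Definition nondecreasing_on n (y : 'rV[R]_n) (A : {set 'I_n}) : bool :=
  [forall i in A, forall j in A, (i <= j)%N ==> (y 0 i <= y 0 j)].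

Definition groups n (y : 'rV[R]_n) : {set {set 'I_n}} :=
  [set G | maxset (fun A => interval_set A && nondecreasing_on y A) G].

Definition avg n (P : {set {set 'I_n}}) (y : 'rV[R]_n) : 'rV[R]_n :=
  \row_i ((\sum_(k in pblock P i) y 0 k) / #|pblock P i|%:R).

End Vectors.

(** * Algorithm A *)

Section AlgorithmA.
Variables (R : realType) (n : nat).
Implicit Types z w x : 'rV[R]_n.+1.

Definition ratio z w (i : 'I_n) : \bar R :=
  let j := widen_ord (leqnSn n) i in
  let j' := lift ord0 i in
  if w 0 j == w 0 j' then +oo%E
  else ((z 0 j - z 0 j') / (w 0 j - w 0 j'))%:E.

Definition rmin z w : \bar R := \big[Order.min/+oo%E]_(i < n) ratio z w i.

Definition lambda0 (eps : R) z w : R :=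
  ((\sum_(i | z 0 i > z 0 ord_max) z 0 i * w 0 i) - eps) /
  (\sum_(i | z 0 i > z 0 ord_max) w 0 i ^+ 2).

Definition lambda1 (eps : R) z w : R := (dot z w - eps) / enorm w ^+ 2.

(* 0-based: [nprime] is n' - 1, so that n' = (dimension) + 1 corresponds to
   the value n.+1. *)
Definition nprime (eps : R) z w : nat :=
  \big[minn/n.+1]_(k < n.+1 | z 0 k - lambda0 eps z w * w 0 k < 0) (k : nat).

Definition groups0 (eps : R) z w : {set {set 'I_n.+1}} :=
  [set G in groups z | [forall k in G, (k < nprime eps z w)%N]]
    :|: [set [set k : 'I_n.+1 | (nprime eps z w <= k)%N]].

(* The history of an execution is a list of tokens: natural numbers ([inl])
   and reals ([inr]). *)
Definition token : Type := (nat + R)%type.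

(* [runA eps z w h x]: the outer loop of Algorithm A, started in the state
   (z, w), terminates with output x and history h.  Each pass contributes to
   the history the number of the test that fired ((a) = 0, ..., (g) = 6),
   followed by those of the finite quantities r, lambda_1, lambda_0, n' that
   the sequence of tests had to consult up to that point.  (An implementation
   is thus free to evaluate step 1 lazily.)  Each rule carries the negations
   of the preceding tests that are not already excluded by its own
   conditions. *)
Inductive runA (eps : R) :
    'rV[R]_n.+1 -> 'rV[R]_n.+1 -> seq token -> 'rV[R]_n.+1 -> Prop :=
| runA_a z w :
    dot z w <= eps ->
    runA eps z w [:: inl 0%N] z
| runA_b z w x :
    eps < dot z w -> rmin z w = +oo%E ->
    is_proj (simplex (eps / w 0 ord0)) z x ->
    runA eps z w [:: inl 1%N] x
| runA_c z w r h x :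
    let l1 := lambda1 eps z w in
    let G := groups (z - l1 *: w) in
    eps < dot z w -> rmin z w = r%:E ->
    r < l1 ->
    runA eps (avg G z) (avg G w) h x ->
    runA eps z w ([:: inl 2%N; inr r; inr l1] ++ h) x
| runA_d z w r :
    let l1 := lambda1 eps z w in
    eps < dot z w -> rmin z w = r%:E ->
    l1 <= r -> 0 <= z 0 ord_max - l1 * w 0 ord_max ->
    runA eps z w [:: inl 3%N; inr r; inr l1] (z - l1 *: w)
| runA_e z w r h x :
    let l1 := lambda1 eps z w in
    let l0 := lambda0 eps z w in
    let G := groups (z - l0 *: w) in
    eps < dot z w -> rmin z w = r%:E ->
    l1 <= r -> z 0 ord_max - l1 * w 0 ord_max < 0 ->
    r < l0 ->
    runA eps (avg G z) (avg G w) h x ->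
    runA eps z w ([:: inl 4%N; inr r; inr l1; inr l0] ++ h) x
| runA_f z w r :
    let l1 := lambda1 eps z w in
    let l0 := lambda0 eps z w in
    let n' := nprime eps z w in
    eps < dot z w -> rmin z w = r%:E ->
    l1 <= r -> z 0 ord_max - l1 * w 0 ord_max < 0 ->
    l0 <= r -> (n' <= n)%N -> z 0 (inord n') = z 0 ord_max ->
    runA eps z w [:: inl 5%N; inr r; inr l1; inr l0; inl n']
      (\row_i Num.max (z 0 i - l0 * w 0 i) 0)
| runA_g z w r h x :
    let l1 := lambda1 eps z w in
    let l0 := lambda0 eps z w in
    let n' := nprime eps z w in
    let G := groups0 eps z w in
    eps < dot z w -> rmin z w = r%:E ->
    l1 <= r -> z 0 ord_max - l1 * w 0 ord_max < 0 ->
    l0 <= r -> (n' < n)%N -> z 0 (inord n') != z 0 ord_max ->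
    runA eps (avg G z) (avg G w) h x ->
    runA eps z w ([:: inl 6%N; inr r; inr l1; inr l0; inl n'] ++ h) x.

Definition algorithmA (eps : R) z w (h : seq token) x : Prop :=
  runA eps z (avg (groups z) w) h x.

End AlgorithmA.

(** * Real random access machine

    A structured language over variables and (infinite) arrays of natural
    numbers and of reals; variables and arrays are designated by numbers, so a
    program mentions only finitely many of them.  Natural numbers serve as
    indices and counters; their only operations are +, truncated -, halving
    and comparison.  Reals are atomic: the only constants are 0 and 1, and the
    only way to get information out of a real is a comparison (there is no
    rounding to an integer).  Real division is total, with x / 0 = 0; since a
    program can test for 0, this adds no power. *)

Inductive iexp : Type :=
| IConst of nat
| IVar of nat
| IGet of nat & iexp
| IAdd of iexp & iexp
| ISub of iexp & iexp
| IHalf of iexp.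

Inductive rexp : Type :=
| RZero
| ROne
| RVar of nat
| RGet of nat & iexp
| RAdd of rexp & rexp
| RSub of rexp & rexp
| RMul of rexp & rexp
| RDiv of rexp & rexp.

Inductive bexp : Type :=
| BILt of iexp & iexp
| BIEq of iexp & iexp
| BRLt of rexp & rexp
| BREq of rexp & rexp
| BNot of bexp
| BAnd of bexp & bexp.

(* [EmitI] and [EmitR] append a token to a write-only output. *)
Inductive cmd : Type :=
| Skip
| SetI of nat & iexp
| PutI of nat & iexp & iexp
| SetR of nat & rexp
| PutR of nat & iexp & rexp
| EmitI of iexp
| EmitR of rexp
| Seq of cmd & cmd
| If of bexp & cmd & cmd
| While of bexp & cmd.

Fixpoint icost (e : iexp) : nat :=
  match e with
  | IConst _ | IVar _ => 1
  | IGet _ e1 | IHalf e1 => (icost e1).+1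
  | IAdd e1 e2 | ISub e1 e2 => (icost e1 + icost e2).+1
  end.

Fixpoint rcost (e : rexp) : nat :=
  match e with
  | RZero | ROne | RVar _ => 1
  | RGet _ i => (icost i).+1
  | RAdd e1 e2 | RSub e1 e2 | RMul e1 e2 | RDiv e1 e2 =>
      (rcost e1 + rcost e2).+1
  end.

Fixpoint bcost (b : bexp) : nat :=
  match b with
  | BILt e1 e2 | BIEq e1 e2 => (icost e1 + icost e2).+1
  | BRLt e1 e2 | BREq e1 e2 => (rcost e1 + rcost e2).+1
  | BNot b1 => (bcost b1).+1
  | BAnd b1 b2 => (bcost b1 + bcost b2).+1
  end.

Section Semantics.
Variable R : realType.

Record state : Type := State {
  ivar : nat -> nat;
  iarr : nat -> nat -> nat;
  rvar : nat -> R;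
  rarr : nat -> nat -> R;
  output : seq (token R)
}.

Definition upd (A : Type) (f : nat -> A) (k : nat) (v : A) : nat -> A :=
  fun j => if j == k then v else f j.

Definition upd2 (A : Type) (f : nat -> nat -> A) (a k : nat) (v : A) :
    nat -> nat -> A :=
  upd f a (upd (f a) k v).

Definition set_ivar s v x :=
  State (upd (ivar s) v x) (iarr s) (rvar s) (rarr s) (output s).
Definition set_iarr s a k x :=
  State (ivar s) (upd2 (iarr s) a k x) (rvar s) (rarr s) (output s).
Definition set_rvar s v x :=
  State (ivar s) (iarr s) (upd (rvar s) v x) (rarr s) (output s).
Definition set_rarr s a k x :=
  State (ivar s) (iarr s) (rvar s) (upd2 (rarr s) a k x) (output s).
Definition emit s (t : token R) :=
  State (ivar s) (iarr s) (rvar s) (rarr s) (rcons (output s) t).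

Fixpoint ieval (s : state) (e : iexp) : nat :=
  match e with
  | IConst c => c
  | IVar v => ivar s v
  | IGet a e1 => iarr s a (ieval s e1)
  | IAdd e1 e2 => (ieval s e1 + ieval s e2)%N
  | ISub e1 e2 => (ieval s e1 - ieval s e2)%N
  | IHalf e1 => (ieval s e1)./2
  end.

Fixpoint reval (s : state) (e : rexp) : R :=
  match e with
  | RZero => 0
  | ROne => 1
  | RVar v => rvar s v
  | RGet a i => rarr s a (ieval s i)
  | RAdd e1 e2 => reval s e1 + reval s e2
  | RSub e1 e2 => reval s e1 - reval s e2
  | RMul e1 e2 => reval s e1 * reval s e2
  | RDiv e1 e2 => reval s e1 / reval s e2
  end.

Fixpoint beval (s : state) (b : bexp) : bool :=
  match b with
  | BILt e1 e2 => (ieval s e1 < ieval s e2)%N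
  | BIEq e1 e2 => ieval s e1 == ieval s e2
  | BRLt e1 e2 => reval s e1 < reval s e2
  | BREq e1 e2 => reval s e1 == reval s e2
  | BNot b1 => ~~ beval s b1
  | BAnd b1 b2 => beval s b1 && beval s b2
  end.

(* [exec c s t s']: started in s, the program c terminates in s' after exactly
   t operations. *)
Inductive exec : cmd -> state -> nat -> state -> Prop :=
| exec_Skip s : exec Skip s 1 s
| exec_SetI s v e :
    exec (SetI v e) s (icost e).+1 (set_ivar s v (ieval s e))
| exec_PutI s a i e :
    exec (PutI a i e) s (icost i + icost e).+1
      (set_iarr s a (ieval s i) (ieval s e))
| exec_SetR s v e :
    exec (SetR v e) s (rcost e).+1 (set_rvar s v (reval s e))
| exec_PutR s a i e :
    exec (PutR a i e) s (icost i + rcost e).+1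
      (set_rarr s a (ieval s i) (reval s e))
| exec_EmitI s e :
    exec (EmitI e) s (icost e).+1 (emit s (inl (ieval s e)))
| exec_EmitR s e :
    exec (EmitR e) s (rcost e).+1 (emit s (inr (reval s e)))
| exec_Seq c1 c2 s s1 s2 t1 t2 :
    exec c1 s t1 s1 -> exec c2 s1 t2 s2 ->
    exec (Seq c1 c2) s (t1 + t2) s2
| exec_IfT b c1 c2 s s' t :
    beval s b -> exec c1 s t s' ->
    exec (If b c1 c2) s (bcost b + t).+1 s'
| exec_IfF b c1 c2 s s' t :
    ~~ beval s b -> exec c2 s t s' ->
    exec (If b c1 c2) s (bcost b + t).+1 s'
| exec_WhileF b c s :
    ~~ beval s b -> exec (While b c) s (bcost b).+1 s
| exec_WhileT b c s s1 s2 t1 t2 :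
    beval s b -> exec c s t1 s1 -> exec (While b c) s1 t2 s2 ->
    exec (While b c) s (bcost b + t1 + t2).+1 s2.

Definition vec_arr n (x : 'rV[R]_n) : nat -> R :=
  fun k => if insub k is Some i then x 0 i else 0.

(* The dimension is in natural variable 0, eps in real variable 0, z in real
   array 0 and w in real array 1; everything else is 0 and the output is
   empty. *)
Definition init n (z w : 'rV[R]_n) (eps : R) : state :=
  State (upd (fun=> 0%N) 0 n)
        (fun _ _ => 0%N)
        (upd (fun=> 0) 0 eps)
        (upd (upd (fun _ _ => 0) 0%N (vec_arr z)) 1 (vec_arr w))
        [::].

(* The program c executes Algorithm A on the given input in exactly t operations:
   it emits the history of Algorithm A's passes and then the coordinates of
   Algorithm A's output vector. *)
Definition implementsA (c : cmd) n (z w : 'rV[R]_n.+1) (eps : R) (t : nat) :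
    Prop :=
  exists (h : seq (token R)) (x : 'rV[R]_n.+1) (s : state),
    [/\ algorithmA eps z w h x,
        exec c (init z w eps) t s
      & output s = h ++ [seq inr (x 0 i) | i <- enum 'I_n.+1]].

End Semantics.

(* Main.v *)
(* Averaging over a partition and then over a coarser one is averaging over the coarser one, so
   the state of Algorithm A is always the average of the input over a partition into intervals,
   which only gets coarser: every pass that does not exit merges at least two groups.  The
   mean of any group is read off the prefix sums of the input.  A boundary between two groups
   is removed in cases (c) and (e) iff its ratio is at most lambda_1, resp. lambda_0, and in
   case (g) iff it lies to the right of n'.  With the finite ratios kept in a segment tree, the
   minimum r is at the root, the boundaries to be removed are the successive minima, and
   removing one boundary changes the ratios of its two neighbours only; <z,w> and |w|^2 are
   updated at the same time.  Each of the at most n removals thus costs O(log n), and scanning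
   from the right for n' costs one step per boundary removed.

   In all exit cases the output is max(z - lambda w, 0) for a single real lambda: 0 in (a),
   lambda_1 in (d), lambda_0 in (f), and in (b), where w is constant, tau / w_1 with tau the
   threshold of the projection onto the simplex. *)
Require Import Defs.
From mathcomp Require Import all_boot all_order all_algebra.
From mathcomp Require Import constructive_ereal reals exp.
From mathcomp Require Import zify ring lra.
Set Implicit Arguments.
Unset Strict Implicit.
Unset Printing Implicit Defensive.
Import Order.TTheory GRing.Theory Num.Theory.
Local Open Scope ring_scope.

(* [lia] becomes slow when the context is full of facts about reals: they are dropped first. *)
Ltac nlia :=
  first
    [ solve [repeat match goal with
             | H : forall _, _ |- _ => clear H
             | R : realType |- _ => match goal with H : context [R] |- _ => clear H end
             end; lia]
    | lia ].

(** * Weakest preconditions with operation counts *)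

(** The cuts that a pass removes are determined by the ratios before any removal, while each removal
    changes ratios. During the tests the condemned cuts are therefore only stacked, and they are
    unlinked when the next pass begins; until then the lists and the two sums describe the partition
    that still contains them. The initial averaging of w fits the same scheme: the start is the
    partition into singletons, with the ties of z on the stack.

    The property that carries the passes is that the input z drops strictly at every remaining cut.
    The averaged z then drops strictly there too, so that any boundary of the groups of z - lambda w
    can be tested by comparing lambda with one ratio, and the last group is exactly the set where
    the averaged z is minimal.

    Algorithm A must also never get stuck. The delicate point is that z_n - lambda_0 w_n is negative
    as soon as z_n - lambda_1 w_n is; hence n' is at most n, and one of (f) and (g) applies whenever
    (a) to (e) do not. *)

Definition wp (R : realType) (c : cmd) (s : state R)
    (Q : nat -> state R -> Prop) : Prop :=
  exists t s', exec c s t s' /\ Q t s'.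

Lemma wp_conseq (R : realType) c (s : state R) (P Q : nat -> state R -> Prop) :
  wp c s P -> (forall t s', P t s' -> Q t s') -> wp c s Q.
Proof. by move=> [t [s' [e p]]] PQ; exists t, s'; split=> //; apply: PQ. Qed.

Lemma wp_Skip (R : realType) (s : state R) (Q : nat -> state R -> Prop) :
  Q 1%N s -> wp Skip s Q.
Proof. by move=> q; exists 1%N, s; split=> //; constructor. Qed.

Lemma wp_SetI (R : realType) (s : state R) v e (Q : nat -> state R -> Prop) :
  Q (icost e).+1 (set_ivar s v (ieval s e)) -> wp (SetI v e) s Q.
Proof. by move=> q; do 2 eexists; split; [constructor|]. Qed.

Lemma wp_PutI (R : realType) (s : state R) a i e (Q : nat -> state R -> Prop) :
  Q (icost i + icost e).+1 (set_iarr s a (ieval s i) (ieval s e)) ->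
  wp (PutI a i e) s Q.
Proof. by move=> q; do 2 eexists; split; [constructor|]. Qed.

Lemma wp_SetR (R : realType) (s : state R) v e (Q : nat -> state R -> Prop) :
  Q (rcost e).+1 (set_rvar s v (reval s e)) -> wp (SetR v e) s Q.
Proof. by move=> q; do 2 eexists; split; [constructor|]. Qed.

Lemma wp_PutR (R : realType) (s : state R) a i e (Q : nat -> state R -> Prop) :
  Q (icost i + rcost e).+1 (set_rarr s a (ieval s i) (reval s e)) ->
  wp (PutR a i e) s Q.
Proof. by move=> q; do 2 eexists; split; [constructor|]. Qed.

Lemma wp_EmitI (R : realType) (s : state R) e (Q : nat -> state R -> Prop) :
  Q (icost e).+1 (emit s (inl (ieval s e))) -> wp (EmitI e) s Q.
Proof. by move=> q; do 2 eexists; split; [constructor|]. Qed.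

Lemma wp_EmitR (R : realType) (s : state R) e (Q : nat -> state R -> Prop) :
  Q (rcost e).+1 (emit s (inr (reval s e))) -> wp (EmitR e) s Q.
Proof. by move=> q; do 2 eexists; split; [constructor|]. Qed.

Lemma wp_Seq (R : realType) c1 c2 (s : state R) (Q : nat -> state R -> Prop) :
  wp c1 s (fun t1 s1 => wp c2 s1 (fun t2 s2 => Q (t1 + t2)%N s2)) ->
  wp (Seq c1 c2) s Q.
Proof.
move=> [t1 [s1 [e1 [t2 [s2 [e2 q]]]]]]; exists (t1 + t2)%N, s2.
by split=> //; apply: exec_Seq e1 e2.
Qed.

Lemma wp_If (R : realType) b c1 c2 (s : state R) (Q : nat -> state R -> Prop) :
  (if beval s b then wp c1 s (fun t s' => Q (bcost b + t).+1 s')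
   else wp c2 s (fun t s' => Q (bcost b + t).+1 s')) ->
  wp (If b c1 c2) s Q.
Proof.
case: ifPn => hb [t [s' [e q]]]; exists (bcost b + t).+1, s'; split=> //.
  exact: exec_IfT.
exact: exec_IfF.
Qed.

(** No loop invariant is built in: the rule unrolls one iteration, and each loop of the program is
    treated by an induction of its own, which yields termination, correctness and operation count
    together. *)
Lemma wp_While (R : realType) b c (s : state R) (Q : nat -> state R -> Prop) :
  (if beval s b then
     wp c s (fun t1 s1 =>
       wp (While b c) s1 (fun t2 s2 => Q (bcost b + t1 + t2).+1 s2))
   else Q (bcost b).+1 s) ->
  wp (While b c) s Q.
Proof.
case: ifPn => hb; last first.
  by move=> q; exists (bcost b).+1, s; split=> //; exact: exec_WhileF.
move=> [t1 [s1 [e1 [t2 [s2 [e2 q]]]]]]; exists (bcost b + t1 + t2).+1, s2.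
by split=> //; apply: exec_WhileT e1 e2.
Qed.

(** The write sets are syntactic, so that for a concrete program the side conditions of [frame] are
    settled by computation. *)
Fixpoint wiv (c : cmd) : seq nat :=
  match c with
  | SetI v _ => [:: v]
  | Seq c1 c2 | If _ c1 c2 => wiv c1 ++ wiv c2
  | While _ c1 => wiv c1
  | _ => [::]
  end.

Fixpoint wia (c : cmd) : seq nat :=
  match c with
  | PutI v _ _ => [:: v]
  | Seq c1 c2 | If _ c1 c2 => wia c1 ++ wia c2
  | While _ c1 => wia c1
  | _ => [::]
  end.

Fixpoint wrv (c : cmd) : seq nat :=
  match c with
  | SetR v _ => [:: v]
  | Seq c1 c2 | If _ c1 c2 => wrv c1 ++ wrv c2
  | While _ c1 => wrv c1
  | _ => [::]
  end.

Fixpoint wra (c : cmd) : seq nat :=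
  match c with
  | PutR v _ _ => [:: v]
  | Seq c1 c2 | If _ c1 c2 => wra c1 ++ wra c2
  | While _ c1 => wra c1
  | _ => [::]
  end.

Fixpoint silent (c : cmd) : bool :=
  match c with
  | EmitI _ | EmitR _ => false
  | Seq c1 c2 | If _ c1 c2 => silent c1 && silent c2
  | While _ c1 => silent c1
  | _ => true
  end.

Definition frame (R : realType) (c : cmd) (s s' : state R) : Prop :=
  [/\ forall v, v \notin wiv c -> ivar s' v = ivar s v,
      forall v, v \notin wia c -> iarr s' v = iarr s v,
      forall v, v \notin wrv c -> rvar s' v = rvar s v,
      forall v, v \notin wra c -> rarr s' v = rarr s v
    & silent c -> output s' = output s].

Lemma frameP (R : realType) c (s : state R) t s' : exec c s t s' -> frame c s s'.
Proof.
elim=> {c s t s'}.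
- by [].
- by move=> s v e; split=> // u; rewrite inE /= /upd; case: eqP.
- by move=> s a i e; split=> // u; rewrite inE /= /upd2 /upd; case: eqP.
- by move=> s v e; split=> // u; rewrite inE /= /upd; case: eqP.
- by move=> s a i e; split=> // u; rewrite inE /= /upd2 /upd; case: eqP.
- by [].
- by [].
- move=> c1 c2 s s1 s2 t1 t2 _ [a1 b1 d1 e1 o1] _ [a2 b2 d2 e2 o2].
  split=> /= [v|v|v|v|]; rewrite ?mem_cat ?negb_or => /andP[h1 h2].
  + by rewrite a2 // a1.
  + by rewrite b2 // b1.
  + by rewrite d2 // d1.
  + by rewrite e2 // e1.
  + by rewrite o2 // o1.
- move=> b c1 c2 s s1 t1 _ _ [a1 b1 d1 e1 o1].
  split=> /= [v|v|v|v|]; rewrite ?mem_cat ?negb_or => /andP[h1 h2];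
    [exact: a1|exact: b1|exact: d1|exact: e1|exact: o1].
- move=> b c1 c2 s s1 t1 _ _ [a1 b1 d1 e1 o1].
  split=> /= [v|v|v|v|]; rewrite ?mem_cat ?negb_or => /andP[h1 h2];
    [exact: a1|exact: b1|exact: d1|exact: e1|exact: o1].
- by [].
- move=> b c s s1 s2 t1 t2 _ _ [a1 b1 d1 e1 o1] _ [a2 b2 d2 e2 o2].
  split=> /= [v|v|v|v|] h.
  + by rewrite a2 // a1.
  + by rewrite b2 // b1.
  + by rewrite d2 // d1.
  + by rewrite e2 // e1.
  + by rewrite o2 // o1.
Qed.

Lemma wp_frame (R : realType) c (s : state R) (Q : nat -> state R -> Prop) :
  wp c s (fun t s' => frame c s s' -> Q t s') -> wp c s Q.
Proof. by move=> [t [s' [e q]]]; exists t, s'; split=> //; apply: q; exact: frameP e. Qed.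

(** * Cuts and block averages *)

Section Cuts.
Variable N : nat.
Implicit Types C D : pred nat.

Fixpoint blk_start C (i : nat) : nat :=
  if C i then i else if i is j.+1 then blk_start C j else 0%N.

(** One past the last position of the block. Looking at the [N] positions after [i] is enough to
    meet the sentinel [N] whenever i < N. *)
Definition blk_end C (i : nat) : nat := (i.+1 + find C (iota i.+1 N))%N.

Definition cutset C : bool := C 0%N && C N.

(** The half-open interval from [a] to [b] is then one group. *)
Definition consec C (a b : nat) : Prop :=
  [/\ C a, C b, (a < b)%N, (b <= N)%N & forall i, (a < i < b)%N -> ~~ C i].

Lemma blk_start_le C i : (blk_start C i <= i)%N.
Proof. by elim: i => [|i IH] /=; case: ifP => // _; apply: leqW. Qed.

Lemma blk_start_cut C i : C 0%N -> C (blk_start C i).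
Proof. by move=> C0; elim: i => [|i IH] /=; case: ifP. Qed.

Lemma blk_start_max C i j : (blk_start C i < j <= i)%N -> ~~ C j.
Proof.
elim: i => [|i IH] /=; case: ifPn => Ci; try nlia.
case/andP=> h; rewrite leq_eqVlt => /orP[/eqP->//|hj].
by apply: IH; rewrite h.
Qed.

Lemma blk_end_gt C i : (i < blk_end C i)%N.
Proof. by rewrite /blk_end; nlia. Qed.

Lemma blk_endP C i : C N -> (i < N)%N ->
  [/\ C (blk_end C i), (blk_end C i <= N)%N
    & forall j, (i < j < blk_end C i)%N -> ~~ C j].
Proof.
move=> CN iN.
have hs : has C (iota i.+1 N).
  by apply/hasP; exists N => //; rewrite mem_iota; nlia.
have fN : (find C (iota i.+1 N) < N)%N.
  by rewrite -[X in (_ < X)%N](size_iota i.+1 N) -has_find.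
have := nth_find 0%N hs; rewrite nth_iota // => Ce.
have notC j : (i < j < blk_end C i)%N -> ~~ C j.
  rewrite /blk_end => hj.
  have hf : (j - i.+1 < find C (iota i.+1 N))%N by nlia.
  have := before_find 0%N hf; rewrite nth_iota; last by nlia.
  by rewrite subnKC; [move=> -> | nlia].
split=> //.
rewrite leqNgt; apply/negP => h.
by have := notC N; rewrite iN h CN => /(_ isT).
Qed.

Lemma consec_blk C i : cutset C -> (i < N)%N ->
  consec C (blk_start C i) (blk_end C i).
Proof.
case/andP=> C0 CN iN; have [h1 h2 h3] := blk_endP CN iN.
split=> //; first exact: blk_start_cut.
  by apply: leq_ltn_trans (blk_end_gt C i); apply: blk_start_le.
move=> j hj; case: (leqP j i) => ji; last by apply: h3; nlia.
by apply: (@blk_start_max _ i); nlia.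
Qed.

Lemma consec_uniq C a b c d i : consec C a b -> consec C c d ->
  (a <= i < b)%N -> (c <= i < d)%N -> a = c /\ b = d.
Proof.
move=> [Ca Cb ab _ h] [Cc Cd cd _ h'] iab icd.
have eac : a = c.
  have := h c; have := h' a; rewrite Ca Cc => h1 h2.
  case: (ltngtP a c) => // ac; first by have := h1 ltac:(nlia).
  by have := h2 ltac:(nlia).
split=> //; have := h d; have := h' b; rewrite Cd Cb => h1 h2.
case: (ltngtP b d) => // bd; first by have := h1 ltac:(nlia).
by have := h2 ltac:(nlia).
Qed.

Lemma blk_eq C a b i : cutset C -> consec C a b -> (a <= i < b)%N ->
  blk_start C i = a /\ blk_end C i = b.
Proof.
move=> hC h hi; have iN : (i < N)%N by case: h => *; nlia.
apply: (consec_uniq (consec_blk hC iN) h (i := i)) => //.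
by rewrite blk_start_le blk_end_gt.
Qed.

Lemma consec_start C a : cutset C -> C a -> (a < N)%N ->
  consec C a (blk_end C a).
Proof.
move=> hC Ca aN; have := consec_blk hC aN.
by suff -> : blk_start C a = a by []; case: (a) Ca => [|k] /= ->.
Qed.

Lemma consec_end C c : cutset C -> C c -> (0 < c <= N)%N ->
  consec C (blk_start C c.-1) c.
Proof.
move=> hC Cc cN; have h := @consec_blk C c.-1 hC ltac:(nlia).
suff e : c = blk_end C c.-1 by rewrite -e in h.
case/andP: hC => _ CN; have [h1 h2 h3] := @blk_endP C c.-1 CN ltac:(nlia).
case: h => _ _ _ _ _; have := blk_end_gt C c.-1.
rewrite prednK; last by nlia.
rewrite leq_eqVlt => /orP[/eqP//|h4].
by have := h3 c; rewrite Cc => /(_ ltac:(nlia)).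
Qed.

Lemma blk_ext C D : C =1 D -> blk_start C =1 blk_start D /\ blk_end C =1 blk_end D.
Proof.
move=> CD; split=> i; last by rewrite /blk_end (eq_find CD).
by elim: i => [|i IH] /=; rewrite CD // IH.
Qed.

Lemma consec_ext C D a b : C =1 D -> consec C a b -> consec D a b.
Proof.
move=> CD [h1 h2 h3 h4 h5]; split=> //; rewrite -?CD // => i hi.
by rewrite -CD; apply: h5.
Qed.

Definition remove C (d : nat) : pred nat := fun x => C x && (x != d).

(** The merged block is the only new one, so whatever is recorded for pairs of consecutive cuts has
    to be revised at [a] and [b] alone. *)
Lemma consec_remove C a b d x y : consec C a d -> consec C d b ->
  consec (remove C d) x y -> (x = a /\ y = b) \/ [/\ consec C x y, x != d & y != d].
Proof.
move=> [Ca Cd ad _ had] [_ Cb db bN hdb] [/andP[Cx xd] /andP[Cy yd] xy yN h].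
have hC i : (x < i < y)%N -> i != d -> ~~ C i.
  by move=> hi id; have := h i hi; rewrite /remove id andbT.
have [hd|hd] := boolP (x < d < y)%N; last first.
  right; split=> //; split=> // i hi; apply: hC => //.
  by apply: contra hd => /eqP <-.
left; split.
  case: (ltngtP x a) => // hxa.
    by have := hC a ltac:(nlia) ltac:(nlia); rewrite Ca.
  by have := had x ltac:(nlia); rewrite Cx.
case: (ltngtP y b) => // hyb; first by have := hdb y ltac:(nlia); rewrite Cy.
by have := hC b ltac:(nlia) ltac:(nlia); rewrite Cb.
Qed.

Lemma consec_remove_new C a b d : consec C a d -> consec C d b ->
  consec (remove C d) a b.
Proof.
move=> [Ca Cd ad _ had] [_ Cb db bN hdb]; split=> //; rewrite /remove ?Ca ?Cb /=.
- by nlia.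
- by nlia.
- by nlia.
move=> i hi; case: (ltngtP i d) => [h|h|->]; rewrite ?andbF ?andbT //=.
  by apply: had; nlia.
by apply: hdb; nlia.
Qed.

Lemma consec_remove_old C d x y : consec C x y -> x != d -> y != d ->
  consec (remove C d) x y.
Proof.
move=> [h1 h2 h3 h4 h5] xd yd; split; rewrite /remove ?h1 ?h2 ?xd ?yd //.
by move=> i hi; rewrite negb_and h5.
Qed.

End Cuts.

(** * Prefix sums and means over blocks *)

Section Means.
Variables (R : realType) (N : nat).
Implicit Types (C D : pred nat) (f g : nat -> R).

Definition psum f (k : nat) : R := \sum_(0 <= i < k) f i.

(** Written with prefix sums and a difference of casts because this is the expression that the
    program evaluates. *)
Definition mean f (a b : nat) : R := (psum f b - psum f a) / (b%:R - a%:R).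

Definition blk_mean C f (i : nat) : R := mean f (blk_start C i) (blk_end N C i).

Lemma psumS f k : psum f k.+1 = psum f k + f k.
Proof. by rewrite /psum big_nat_recr. Qed.

Lemma psumB f a b : (a <= b)%N -> psum f b - psum f a = \sum_(a <= i < b) f i.
Proof. by move=> ab; rewrite /psum (big_cat_nat (n := a)) //= addrAC subrr add0r. Qed.

Lemma natrB_gt0 a b : (a < b)%N -> 0 < b%:R - a%:R :> R.
Proof. by move=> ab; rewrite subr_gt0 ltr_nat. Qed.

Lemma sum_const_nat_interval (a b : nat) (x : R) : (a <= b)%N ->
  \sum_(a <= i < b) x = (b%:R - a%:R) * x.
Proof. by move=> ab; rewrite big_const_nat iter_addr_0 -natrB // mulr_natl. Qed.

Lemma mean_mul f a b : (a < b)%N ->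
  (b%:R - a%:R) * mean f a b = psum f b - psum f a.
Proof. by move=> ab; rewrite mulrC divfK // gt_eqF // natrB_gt0. Qed.

Lemma mean_const f a b x : (a < b)%N -> (forall i, (a <= i < b)%N -> f i = x) ->
  mean f a b = x.
Proof.
move=> ab h; apply: (mulfI (x := b%:R - a%:R)); first by rewrite gt_eqF // natrB_gt0.
rewrite mean_mul // psumB; last exact: ltnW.
by rewrite (eq_big_nat _ _ h) sum_const_nat_interval // ltnW.
Qed.

Lemma le_mean f a b x : (a < b)%N -> (forall i, (a <= i < b)%N -> x <= f i) ->
  x <= mean f a b.
Proof.
move=> ab h; rewrite -(ler_pM2l (natrB_gt0 ab)) mean_mul // psumB; last exact: ltnW.
by rewrite -(sum_const_nat_interval _ (ltnW ab)); apply: ler_sum_nat => i /h.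
Qed.

Lemma mean_le f a b x : (a < b)%N -> (forall i, (a <= i < b)%N -> f i <= x) ->
  mean f a b <= x.
Proof.
move=> ab h; rewrite -(ler_pM2l (natrB_gt0 ab)) mean_mul // psumB; last exact: ltnW.
by rewrite -(sum_const_nat_interval _ (ltnW ab)); apply: ler_sum_nat => i /h.
Qed.

Lemma blk_mean_consec C f a b i : cutset N C -> consec N C a b ->
  (a <= i < b)%N -> blk_mean C f i = mean f a b.
Proof. by move=> hC h hi; rewrite /blk_mean; have [-> ->] := blk_eq hC h hi. Qed.

Lemma blk_mean_ext C D f : C =1 D -> blk_mean C f =1 blk_mean D f.
Proof.
by move=> CD i; rewrite /blk_mean; have [-> ->] := blk_ext N CD.
Qed.

(** A block and its average have the same sum; the induction goes from each cut to the preceding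
    one. *)
Lemma psum_blk_mean C f a : cutset N C -> C a -> (a <= N)%N ->
  psum (blk_mean C f) a = psum f a.
Proof.
move=> hC; elim/ltn_ind: a => a IH Ca aN.
case: (posnP a) => [->|a0]; first by rewrite /psum !big_geq.
have h := @consec_end N C a hC Ca ltac:(nlia).
set c := blk_start C a.-1 in h; have [Cc _ ca _ _] := h.
have : psum (blk_mean C f) a - psum (blk_mean C f) c = psum f a - psum f c.
  rewrite psumB; last exact: ltnW.
  rewrite -mean_mul // -sum_const_nat_interval; last exact: ltnW.
  by apply: eq_big_nat => i hi; rewrite (blk_mean_consec _ hC h hi).
by rewrite (IH c ca Cc) ?(leq_trans (ltnW ca)) // => /addIr.
Qed.

(** The two ends of a block of [D] are cuts of [C], where averaging over [C] has not moved the
    prefix sums. *)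
Lemma blk_mean_coarser C D f : cutset N C -> cutset N D ->
  (forall x, (x <= N)%N -> D x -> C x) ->
  forall i, (i < N)%N -> blk_mean D (blk_mean C f) i = blk_mean D f i.
Proof.
move=> hC hD DC i iN; have [Da Db ab bN _] := consec_blk hD iN.
have Ca : C (blk_start D i) by apply: DC => //; nlia.
have Cb : C (blk_end N D i) by apply: DC.
by rewrite /blk_mean /mean -!/(blk_mean C f) !psum_blk_mean //; nlia.
Qed.

Definition noninc f := forall i j, (i <= j < N)%N -> f j <= f i.

Lemma noninc_step f : (forall i, (i.+1 < N)%N -> f i.+1 <= f i) -> noninc f.
Proof.
move=> h i j /andP[]; elim: j => [|j IH]; first by rewrite leqn0 => /eqP->.
rewrite leq_eqVlt => /orP[/eqP->//|ij] jN.
exact: le_trans (h _ jN) (IH ij (ltnW jN)).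
Qed.

Lemma noninc_mean_le f a b : noninc f -> (a < b <= N)%N -> mean f a b <= f a.
Proof. by move=> h ab; apply: mean_le => [|i hi]; [nlia|apply: h; nlia]. Qed.

Lemma noninc_le_mean f a b : noninc f -> (a < b <= N)%N -> f b.-1 <= mean f a b.
Proof. by move=> h ab; apply: le_mean => [|i hi]; [nlia|apply: h; nlia]. Qed.

Lemma noninc_mean_consec C f a c b : noninc f -> consec N C a c -> consec N C c b ->
  mean f c b <= mean f a c.
Proof.
move=> h [_ _ ac cN _] [_ _ cb bN _].
apply: le_trans (noninc_mean_le h (a := c) (b := b) ltac:(nlia)) _.
apply: le_trans (noninc_le_mean h (a := a) (b := c) ltac:(nlia)).
by apply: h; nlia.
Qed.

(** The mean on the right is at most [f c] and the mean on the left at least [f c.-1], so a strict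
    drop of the input at a cut is inherited by the averages however large the two blocks are. *)
Lemma lt_mean_consec C f a c b : noninc f -> consec N C a c -> consec N C c b ->
  f c < f c.-1 -> mean f c b < mean f a c.
Proof.
move=> h [_ _ ac cN _] [_ _ cb bN _] fc.
apply: le_lt_trans (noninc_mean_le h (a := c) (b := b) ltac:(nlia)) _.
by apply: lt_le_trans fc (noninc_le_mean h (a := a) (b := c) ltac:(nlia)).
Qed.

Lemma blk_meanS C f i : cutset N C -> (i.+1 < N)%N -> ~~ C i.+1 ->
  blk_mean C f i.+1 = blk_mean C f i.
Proof.
move=> hC iN nC; have h := @consec_blk N C i hC ltac:(nlia).
have hi : (blk_start C i <= i < blk_end N C i)%N by rewrite blk_start_le blk_end_gt.
rewrite !(blk_mean_consec _ hC h) //.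
have := blk_end_gt N C i; rewrite leq_eqVlt => /orP[/eqP e|]; last by nlia.
by case: h => _; rewrite -e (negPf nC).
Qed.

Lemma cut_neighbours C c : cutset N C -> C c -> (0 < c < N)%N ->
  exists a b, [/\ consec N C a c, consec N C c b
    & forall f, blk_mean C f c.-1 = mean f a c /\ blk_mean C f c = mean f c b].
Proof.
move=> hC Cc cN; have h1 := @consec_end N C c hC Cc ltac:(nlia).
have h2 := @consec_start N C c hC Cc ltac:(nlia).
exists (blk_start C c.-1), (blk_end N C c); split=> // f; split.
  by apply: blk_mean_consec h1 _ => //; rewrite blk_start_le; nlia.
by apply: blk_mean_consec h2 _ => //; rewrite blk_end_gt leqnn.
Qed.

Lemma blk_mean_noninc C f : cutset N C -> noninc f -> noninc (blk_mean C f).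
Proof.
move=> hC hf; apply: noninc_step => i iN; case: (boolP (C i.+1)) => [Ci|nC].
  have [a [b [h1 h2 /(_ f) [/= -> ->]]]] := cut_neighbours hC Ci ltac:(nlia).
  exact: noninc_mean_consec h1 h2.
by rewrite blk_meanS.
Qed.

(** The constant-time update of <z,w> and |w|^2: each block contributes the product of its two means
    times its width, and only the blocks between [a] and [b] change. *)
Lemma sum_blk_mean_remove C f g a d b : cutset N C -> consec N C a d -> consec N C d b ->
  \sum_(0 <= i < N) blk_mean (remove C d) f i * blk_mean (remove C d) g i =
  \sum_(0 <= i < N) blk_mean C f i * blk_mean C g i
  - mean f a d * mean g a d * (d%:R - a%:R)
  - mean f d b * mean g d b * (b%:R - d%:R)
  + mean f a b * mean g a b * (b%:R - a%:R).
Proof.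
move=> hC had hdb; have hab := consec_remove_new had hdb.
have [_ _ ad dN _] := had; have [_ _ db bN _] := hdb.
have hC' : cutset N (remove C d).
  by move: hC => /andP[C0 CN]; rewrite /cutset /remove C0 CN /=; nlia.
have split_sum (F : nat -> R) : \sum_(0 <= i < N) F i = \sum_(0 <= i < a) F i +
    (\sum_(a <= i < d) F i + \sum_(d <= i < b) F i) + \sum_(b <= i < N) F i.
  rewrite (big_cat_nat (n := a)) //=; last by nlia.
  rewrite (big_cat_nat (m := a) (n := b)) //=; last by nlia.
  by rewrite (big_cat_nat (m := a) (n := d) (p := b)) ?addrA //; nlia.
(* A position outside the interval from [a] to [b] lies in a block that stays entirely on its side,
   and such a block survives the removal. *)
have same i : (i < a)%N || (b <= i < N)%N -> forall h,
    blk_mean (remove C d) h i = blk_mean C h i.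
  move=> hi h; have iN : (i < N)%N by nlia.
  have hc := consec_blk hC iN; have := blk_start_le C i; have := blk_end_gt N C i.
  case: (hc) => h1 h2 _ _ h3 h4 h5.
  have [Ca Cd _ _ _] := had; have [_ Cb _ _ _] := hdb.
  have hca := h3 a; have hcb := h3 b; have hcd := h3 d; rewrite Ca Cb Cd in hca hcb hcd.
  have bs : (blk_start C i < a)%N \/ (b <= blk_start C i)%N.
    case: (orP hi) => hi'; first by left; nlia.
    by right; rewrite leqNgt; apply/negP => hh; have := hcb ltac:(nlia).
  have be : (blk_end N C i <= a)%N \/ (b < blk_end N C i)%N.
    case: (orP hi) => hi'; last by right; nlia.
    by left; rewrite leqNgt; apply/negP => hh; have := hca ltac:(nlia).
  apply: blk_mean_consec; [exact: hC'|apply: (consec_remove_old (d := d) hc)|]; try by nlia.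
have blk D u v : cutset N D -> consec N D u v ->
    \sum_(u <= i < v) blk_mean D f i * blk_mean D g i =
    mean f u v * mean g u v * (v%:R - u%:R).
  move=> hD huv; rewrite [RHS]mulrC -sum_const_nat_interval; last by case: huv => *; nlia.
  by apply: eq_big_nat => i hi; rewrite !(blk_mean_consec _ hD huv).
have -> : \sum_(0 <= i < N) blk_mean (remove C d) f i * blk_mean (remove C d) g i =
    \sum_(0 <= i < a) blk_mean C f i * blk_mean C g i
    + mean f a b * mean g a b * (b%:R - a%:R)
    + \sum_(b <= i < N) blk_mean C f i * blk_mean C g i.
  rewrite (big_cat_nat (n := a)) //=; last by nlia.
  rewrite (big_cat_nat (m := a) (n := b)) ?(blk _ _ _ hC' hab) ?addrA //=; last by nlia.
  congr (_ + _ + _); apply: eq_big_nat => i hi; rewrite !same //; nlia.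
by rewrite split_sum (blk C a d) // (blk C d b) //; ring.
Qed.

End Means.

(** * Groups, averages, r, lambda_0 and n' expressed through cuts and functions on natural
    numbers *)

Section Rows.
Variables (R : realType) (n : nat).
Local Notation N := n.+1.
Implicit Types (z w y : 'rV[R]_N) (C D : pred nat).

Lemma vec_arrE y (i : 'I_N) : vec_arr y i = y 0 i.
Proof. by rewrite /vec_arr valK. Qed.

Definition avgrow C y : 'rV[R]_N := \row_(i < N) blk_mean N C (vec_arr y) i.

Lemma vec_arr_avgrow C y k : (k < N)%N ->
  vec_arr (avgrow C y) k = blk_mean N C (vec_arr y) k.
Proof. by move=> kN; rewrite -[k]/(val (Ordinal kN)) vec_arrE mxE. Qed.

Lemma avgrow_ext C D y : C =1 D -> avgrow C y = avgrow D y.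
Proof. by move=> CD; apply/rowP => i; rewrite !mxE (blk_mean_ext _ _ CD). Qed.

Lemma psum_eq (f g : nat -> R) k : (forall i, (i < k)%N -> f i = g i) ->
  psum f k = psum g k.
Proof. by move=> h; apply: eq_big_nat => i hi; apply: h. Qed.

Lemma avgrow_avgrow C D y : cutset N C -> cutset N D ->
  (forall x, (x <= N)%N -> D x -> C x) ->
  avgrow D (avgrow C y) = avgrow D y.
Proof.
move=> hC hD DC; apply/rowP => i; rewrite !mxE.
rewrite -[RHS](blk_mean_coarser _ hC hD DC) //.
have [_ _ ab bN _] := consec_blk hD (ltn_ord i).
by rewrite /blk_mean /mean !(@psum_eq (vec_arr (avgrow C y)) (blk_mean N C (vec_arr y))) //
  => j hj; rewrite vec_arr_avgrow //; nlia.
Qed.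

Lemma sum_interval_set (F : nat -> R) a b : (b <= N)%N ->
  \sum_(k in [set k : 'I_N | (a <= k < b)%N]) F k = \sum_(a <= k < b) F k.
Proof.
move=> bN; rewrite (big_nat_widenl _ 0%N) // (big_nat_widen _ _ N) // big_mkord.
by apply: eq_bigl => k; rewrite inE.
Qed.

(** [avg] looks at [P] only through [pblock], so it suffices to know the block of each index. *)
Lemma avg_blocks (P : {set {set 'I_N}}) D y : cutset N D ->
  (forall i : 'I_N,
     pblock P i = [set k : 'I_N | (blk_start D i <= k < blk_end N D i)%N]) ->
  avg P y = avgrow D y.
Proof.
move=> hD hP; apply/rowP => i; rewrite !mxE hP.
have [_ _ ab bN _] := consec_blk hD (ltn_ord i).
rewrite /blk_mean /mean psumB; last exact: ltnW.
congr (_ / _).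
  rewrite -sum_interval_set //; apply: eq_bigr => k _; exact/esym/vec_arrE.
rewrite -sumr_const (sum_interval_set (fun=> 1)) // sum_const_nat_interval ?mulr1 //.
exact: ltnW.
Qed.

Lemma pblock_eq (P : {set {set 'I_N}}) (B : {set 'I_N}) (i : 'I_N) :
  B \in P -> i \in B -> (forall A, A \in P -> i \in A -> A = B) -> pblock P i = B.
Proof.
move=> BP iB h; rewrite /pblock; case: pickP => [A /andP[] /=|/(_ B)]; first exact: h.
by rewrite /= BP iB.
Qed.

(** The block of [i] is itself an interval on which [y] is nondecreasing, because there is no drop
    inside it; and every such interval through [i] is contained in it, because [y] drops strictly at
    its two ends. It is thus the only maximal one that contains [i]. *)
Lemma in_groups y C (i : 'I_N) (G : {set 'I_N}) : cutset N C ->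
  (forall c, (0 < c < N)%N -> C c = (vec_arr y c < vec_arr y c.-1)) -> i \in G ->
  (G \in groups y) =
    (G == [set k : 'I_N | (blk_start C i <= k < blk_end N C i)%N]).
Proof.
move=> hC hy iG; set B := [set k : 'I_N | _].
have [Ca Cb ab bN nC] := consec_blk hC (ltn_ord i).
have iB : i \in B by rewrite inE blk_start_le blk_end_gt.
have goodB : interval_set B && nondecreasing_on y B.
  apply/andP; split.
    apply/forall_inP => j; rewrite inE => hj; apply/forall_inP => l; rewrite inE => hl.
    by apply/forallP => k; apply/implyP => hk; rewrite inE; nlia.
  apply/forall_inP => j; rewrite inE => hj; apply/forall_inP => l; rewrite inE => hl.
  apply/implyP; rewrite -!vec_arrE.
  have : (blk_start C i <= j)%N by nlia.
  have : (l < blk_end N C i)%N by nlia.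
  elim: (val l) => [|k IH] kb aj jk; first by have -> : nat_of_ord j = 0%N by nlia.
  move: jk; rewrite leq_eqVlt => /orP[/eqP -> //|jk].
  apply: le_trans (IH _ aj jk) _; first by nlia.
  have := hy k.+1 ltac:(nlia); rewrite (negPf (nC k.+1 ltac:(nlia))) /= => /esym.
  by rewrite ltNge => /negbFE.
have maxB A : interval_set A && nondecreasing_on y A -> i \in A -> A \subset B.
  case/andP=> /forall_inP iA /forall_inP dA Ai; apply/subsetP => k kA.
  (* An interval with points on both sides of a cut [c] contains c - 1 and c, between which [y]
     drops. *)
  have noc c (cN : (c < N)%N) : (0 < c)%N -> C c -> (i < c <= k)%N || (k < c <= i)%N -> False.
    move=> c0 Cc hc.
    have bet x (xN : (x < N)%N) : (i <= x <= k)%N || (k <= x <= i)%N ->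
        Ordinal xN \in A.
      case/orP => hx.
        by have /forall_inP /(_ _ kA) /forallP /(_ (Ordinal xN)) /implyP := iA _ Ai; apply.
      by have /forall_inP /(_ _ Ai) /forallP /(_ (Ordinal xN)) /implyP := iA _ kA; apply.
    have c1N : (c.-1 < N)%N by nlia.
    have h1 : Ordinal cN \in A by apply: bet; move: hc; clear; nlia.
    have h2 : Ordinal c1N \in A by apply: bet; move: hc c0; clear; nlia.
    have := dA _ h2 => /forall_inP /(_ _ h1) /implyP /=.
    rewrite leq_pred => /(_ isT); rewrite -!vec_arrE /= leNgt -hy ?Cc // ?c0 ?cN //.
  rewrite inE; apply/andP; split; rewrite leqNgt; apply/negP => hk.
    have := @noc (blk_start C i) ltac:(have := ltn_ord i; have := blk_start_le C i; nlia).
    by apply => //; have := blk_start_le C i; nlia.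
  have := @noc (blk_end N C i) ltac:(have := ltn_ord k; nlia).
  by apply => //; have := blk_end_gt N C i; nlia.
apply/idP/eqP => [|->]; rewrite inE.
  by move/maxsetP=> [hA hmax]; rewrite (hmax B) //; apply: maxB.
apply/maxsetP; split=> // D hD BD.
by apply/eqP; rewrite eqEsubset BD andbT; apply: maxB => //; apply: (subsetP BD).
Qed.

Lemma pblock_groups y C (i : 'I_N) : cutset N C ->
  (forall c, (0 < c < N)%N -> C c = (vec_arr y c < vec_arr y c.-1)) ->
  pblock (groups y) i = [set k : 'I_N | (blk_start C i <= k < blk_end N C i)%N].
Proof.
move=> hC hy; set B := [set k : 'I_N | _].
have iB : i \in B by rewrite inE blk_start_le blk_end_gt.
apply: pblock_eq => // [|A]; first by rewrite (in_groups hC hy iB).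
by move=> hA iA; apply/eqP; rewrite -(in_groups hC hy iA).
Qed.

Lemma noninc_vec_arr y : in_T y -> noninc N (vec_arr y).
Proof.
move=> [h _] i j /andP[ij jN].
by rewrite -[i]/(val (Ordinal (leq_ltn_trans ij jN))) -[j]/(val (Ordinal jN)) !vec_arrE h.
Qed.

Lemma vec_arr_ge0 y k : in_T y -> 0 <= vec_arr y k.
Proof. by move=> [_ h]; rewrite /vec_arr; case: insub. Qed.

Lemma ratioE z w (i : 'I_n) : Defs.ratio z w i =
  if vec_arr w i == vec_arr w i.+1 then +oo%E
  else ((vec_arr z i - vec_arr z i.+1) / (vec_arr w i - vec_arr w i.+1))%:E.
Proof.
rewrite /Defs.ratio -!vec_arrE /= /bump /=.
by [].
Qed.

Lemma rmin_infty z w :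
  (forall c, (0 < c < N)%N -> vec_arr w c.-1 = vec_arr w c) -> rmin z w = +oo%E.
Proof.
move=> h; rewrite /rmin; apply: (big_ind (fun x => x = +oo%E)) => //.
  by move=> x y -> ->; rewrite minxx.
by move=> i _; rewrite ratioE (h i.+1) ?eqxx //=; have := ltn_ord i; nlia.
Qed.

Lemma rmin_fin z w c (rt := fun c =>
    (vec_arr z c.-1 - vec_arr z c) / (vec_arr w c.-1 - vec_arr w c)) :
  (0 < c < N)%N -> vec_arr w c.-1 != vec_arr w c ->
  (forall d, (0 < d < N)%N -> vec_arr w d.-1 != vec_arr w d -> rt c <= rt d) ->
  rmin z w = (rt c)%:E.
Proof.
move=> cN wc h; apply/le_anti/andP; split.
  have cn : (c.-1 < n)%N by nlia.
  have := @ratioE z w (Ordinal cn); rewrite /= prednK; last by nlia.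
  rewrite (negPf wc) -/(rt c) => <-.
  by apply: bigmin_le.
apply/bigmin_geP; split=> [|i _]; first by rewrite leey.
rewrite ratioE; case: ifPn => [_|wi]; first by rewrite leey.
rewrite lee_fin; apply: (h i.+1) => //; have := ltn_ord i; nlia.
Qed.

Lemma dotE z w : dot z w = \sum_(0 <= i < N) vec_arr z i * vec_arr w i.
Proof. by rewrite big_mkord; apply: eq_bigr => i _; rewrite !vec_arrE. Qed.

Lemma enorm2 w : enorm w ^+ 2 = dot w w.
Proof.
rewrite /enorm sqr_sqrtr // /dot; apply: sumr_ge0 => i _.
by rewrite -expr2 sqr_ge0.
Qed.

Lemma lambda0E (eps : R) z w a : (a < N)%N ->
  (forall i, (i < N)%N -> (vec_arr z n < vec_arr z i) = (i < a)%N) ->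
  lambda0 eps z w =
    (\sum_(0 <= i < a) vec_arr z i * vec_arr w i - eps) /
    (\sum_(0 <= i < a) vec_arr w i * vec_arr w i).
Proof.
move=> aN h; rewrite /lambda0.
have sub (F : nat -> R) : \sum_(0 <= i < a) F i =
    \sum_(i < N | z 0 i > z 0 ord_max) F i.
  rewrite (big_nat_widen _ _ N) ?(ltnW aN) // big_mkord; apply: eq_bigl => i /=.
  by rewrite -!vec_arrE /= h.
by rewrite !sub; congr ((_ - _) / _); apply: eq_bigr => i _; rewrite !vec_arrE ?expr2.
Qed.

Lemma nprimeE (eps : R) z w a : (a <= n)%N ->
  (forall k, (k < N)%N ->
     (vec_arr z k - lambda0 eps z w * vec_arr w k < 0) = (a <= k)%N) ->
  nprime eps z w = a.
Proof.
move=> an h; rewrite /nprime.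
under eq_bigl => k do rewrite -!vec_arrE h //.
apply/eqP; rewrite eqn_leq; apply/andP; split.
  have : inord a \in index_enum 'I_N by exact: mem_index_enum.
  elim: (index_enum _) => // k r IH; rewrite inE big_cons => /orP[/eqP<-|/IH hr].
    by rewrite inordK // leqnn geq_minl.
  by case: ifP => // _; apply: leq_trans hr; exact: geq_minr.
elim/big_ind: _ => [|x y hx hy|i ai] //; first exact: leqW.
by rewrite leq_min hx.
Qed.

End Rows.

(** * The passes of Algorithm A in terms of cuts *)

Section Passes.
Variables (R : realType) (n : nat) (z w : 'rV[R]_n.+1) (eps : R).
Hypotheses (hz : in_T z) (hw : in_T w).
Local Notation N := n.+1.
Variable C : pred nat.
Hypotheses (hC : cutset N C)
  (hstrict : forall c, (0 < c < N)%N -> C c -> vec_arr z c < vec_arr z c.-1).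
Local Notation za := (blk_mean N C (vec_arr z)).
Local Notation wa := (blk_mean N C (vec_arr w)).
Local Notation zA := (avgrow C z).
Local Notation wA := (avgrow C w).
Local Notation ratio c := ((za c.-1 - za c) / (wa c.-1 - wa c)).
Local Notation total f g := (\sum_(0 <= i < N) f i * g i).

Definition final (lam : R) : 'rV[R]_N := \row_(i < N) Num.max (za i - lam * wa i) 0.

Lemma za_lt c : (0 < c < N)%N -> C c -> za c < za c.-1.
Proof.
move=> cN Cc; have [a [b [h1 h2 /(_ (vec_arr z)) [-> ->]]]] := cut_neighbours R hC Cc cN.
by apply: lt_mean_consec h1 h2 _; [exact: noninc_vec_arr|exact: hstrict].
Qed.

Lemma blk_mean_notcut f c : (0 < c < N)%N -> ~~ C c ->
  blk_mean N C f c = blk_mean N C f c.-1 :> R.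
Proof. by case: c => // c cN nC; rewrite blk_meanS. Qed.

Lemma za_noninc : noninc N za.
Proof. by apply: blk_mean_noninc => //; exact: noninc_vec_arr. Qed.

Lemma wa_noninc : noninc N wa.
Proof. by apply: blk_mean_noninc => //; exact: noninc_vec_arr. Qed.

Lemma blk_mean_ge0 f i : (forall k, 0 <= f k) -> (i < N)%N -> 0 <= blk_mean N C f i :> R.
Proof.
move=> hf iN; have [_ _ ab _ _] := consec_blk hC iN.
by apply: le_mean.
Qed.

Lemma za_ge0 i : (i < N)%N -> 0 <= za i.
Proof. by apply: blk_mean_ge0 => k; exact: vec_arr_ge0. Qed.

Lemma wa_ge0 i : (i < N)%N -> 0 <= wa i.
Proof. by apply: blk_mean_ge0 => k; exact: vec_arr_ge0. Qed.

Lemma wa_step c : (0 < c < N)%N -> wa c <= wa c.-1.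
Proof. by move=> cN; apply: wa_noninc; nlia. Qed.

Lemma dot_total (f g : 'rV[R]_N) : dot (avgrow C f) (avgrow C g) =
  total (blk_mean N C (vec_arr f)) (blk_mean N C (vec_arr g)).
Proof. by rewrite dotE; apply: eq_big_nat => i hi; rewrite !vec_arr_avgrow. Qed.

Lemma vec_arr_sub (x y : 'rV[R]_N) (lam : R) k : (k < N)%N ->
  vec_arr (x - lam *: y) k = vec_arr x k - lam * vec_arr y k.
Proof. by move=> kN; rewrite -[k]/(val (Ordinal kN)) !vec_arrE !mxE. Qed.

(** Inside a group nothing changes. At a cut the drop of z - lam w is the drop of w times the
    difference of the ratio and lam, or just the drop of z if w does not change there. *)
Lemma slope_noninc lam :
  (forall c, (0 < c < N)%N -> C c -> wa c.-1 != wa c -> lam <= ratio c) ->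
  noninc N (fun k => za k - lam * wa k).
Proof.
move=> h; apply: noninc_step => i iN; case: (boolP (C i.+1)) => [Ci|nC]; last first.
  by rewrite !(@blk_mean_notcut _ i.+1) ?iN.
have cN : (0 < i.+1 < N)%N by [].
have hzlt := za_lt cN Ci; have := wa_step cN; rewrite le_eqVlt => /orP[/eqP ->|hlt].
  by rewrite /= lerD2r ltW.
have := h _ cN Ci; rewrite (gt_eqF hlt) => /(_ isT) /=.
rewrite ler_pdivlMr; last by rewrite subr_gt0.
move=> hl; move: hzlt hlt hl => /=; lra.
Qed.

(** z - lam w is constant on each current group. At a cut where w does not change the strict drop of
    z persists; where w drops, z - lam w still drops exactly when lam is less than the ratio. The
    cuts [D] of the new groups are thus among those of [C], and two successive averagings collapse
    into one. *)
Lemma avg_groups_shift lam D (v : 'rV[R]_N) : cutset N D ->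
  (forall c, (0 < c < N)%N ->
     D c = C c && ~~ ((wa c.-1 != wa c) && (ratio c <= lam))) ->
  avg (groups (zA - lam *: wA)) (avgrow C v) = avgrow D v.
Proof.
move=> hD hDC; rewrite (avg_blocks (D := D)) //; last first.
  move=> i; apply: pblock_groups => // c cN; rewrite hDC //.
  rewrite !vec_arr_sub ?vec_arr_avgrow; try by nlia.
  case: (boolP (C c)) => [Cc|nC] /=; last by rewrite !(blk_mean_notcut _ cN nC) ltxx.
  have hzlt := za_lt cN Cc; have := wa_step cN; rewrite le_eqVlt => /orP[/eqP ->|hlt].
    by rewrite eqxx /= ltrD2r hzlt.
  rewrite (gt_eqF hlt) /= -ltNge ltr_pdivlMr; last by rewrite subr_gt0.
  by apply/idP/idP; lra.
apply: avgrow_avgrow => // x; rewrite leq_eqVlt => /orP[/eqP->|xN]; first by case/andP: hC.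
case: (posnP x) => [->|x0]; first by case/andP: hC.
by rewrite hDC ?x0 // => /andP[].
Qed.

(** Since [a] is a cut, no current group straddles n': the groups on its left are kept as they are,
    and all positions from [a] on form the last block of [D]. *)
Lemma avg_groups0 a D (v : 'rV[R]_N) : cutset N D -> C a -> (a <= n)%N ->
  nprime eps zA wA = a ->
  (forall c, (0 < c < N)%N -> D c = C c && (c <= a)%N) ->
  avg (groups0 eps zA wA) (avgrow C v) = avgrow D v.
Proof.
move=> hD Ca an np hDC.
have hcut c : (0 < c < N)%N -> C c = (vec_arr zA c < vec_arr zA c.-1).
  move=> cN; rewrite !vec_arr_avgrow; try by nlia.
  case: (boolP (C c)) => [Cc|nC]; first by rewrite za_lt.
  by rewrite (blk_mean_notcut _ cN nC) ltxx.
have Da : D a.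
  case: (posnP a) => [->|a0]; first by case/andP: hD.
  by rewrite hDC ?Ca ?leqnn // a0.
have haN : consec N D a N.
  split=> //; first by case/andP: hD.
  by move=> i hi; rewrite hDC ?negb_and; nlia.
rewrite (avg_blocks (D := D)) //; last first.
  move=> i; case: (leqP a i) => ai.
    have [-> ->] := blk_eq hD haN (i := i) ltac:(have := ltn_ord i; nlia).
    have -> : [set k : 'I_N | (a <= k < N)%N] = [set k : 'I_N | (a <= k)%N].
      by apply/setP => k; rewrite !inE ltn_ord andbT.
    apply: pblock_eq => [||A]; first by rewrite /groups0 np !inE eqxx orbT.
      by rewrite inE.
    rewrite /groups0 np !inE => /orP[/andP[_ /forall_inP h] /h|/eqP//].
    by rewrite ltnNge ai.
  have iN := ltn_ord i; have hc := consec_blk hC iN.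
  have ea : (blk_end N C i <= a)%N.
    rewrite leqNgt; apply/negP => h; case: hc => _ _ _ _ /(_ a).
    by rewrite Ca; have := blk_start_le C i => h1 h2; have := h2 ltac:(nlia).
  have hd : consec N D (blk_start C i) (blk_end N C i).
    have DC c : (c <= a)%N -> D c = C c.
      move=> ca; case: (posnP c) => [->|c0]; last by rewrite hDC ?ca ?andbT // c0; nlia.
      by case/andP: hC => ->; case/andP: hD => ->.
    case: hc => h1 h2 h3 h4 h5; split=> // [||j hj].
    + by rewrite DC //; nlia.
    + by rewrite DC.
    + by rewrite DC ?h5 //; nlia.
  have iB : (blk_start C i <= i < blk_end N C i)%N by rewrite blk_start_le blk_end_gt.
  have [-> ->] := blk_eq hD hd iB.
  have iB' : i \in [set k : 'I_N | (blk_start C i <= k < blk_end N C i)%N] by rewrite inE.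
  apply: pblock_eq => // [|A]; rewrite /groups0 np in_setU in_set1 inE.
    apply/orP; left; apply/andP; split; first by rewrite (in_groups hC hcut iB').
    by apply/forall_inP => k; rewrite inE; nlia.
  case/orP=> [/andP[hA _] iA|/eqP->]; last by rewrite inE leqNgt ai.
  by apply/eqP; rewrite -(in_groups hC hcut iA).
apply: avgrow_avgrow => // x; rewrite leq_eqVlt => /orP[/eqP->|xN]; first by case/andP: hC.
case: (posnP x) => [->|x0]; first by case/andP: hC.
by rewrite hDC ?x0 // => /andP[].
Qed.

(** A cut that witnesses that r is finite and attains it. *)
Definition best (c0 : nat) : Prop :=
  [/\ (0 < c0 < N)%N, C c0, wa c0.-1 != wa c0
    & forall c, (0 < c < N)%N -> C c -> wa c.-1 != wa c -> ratio c0 <= ratio c].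

Lemma best_rmin c0 : best c0 -> rmin zA wA = (ratio c0)%:E.
Proof.
move=> [cN Cc wc h].
have e k : (k < N)%N -> vec_arr zA k = za k /\ vec_arr wA k = wa k.
  by move=> kN; rewrite !vec_arr_avgrow.
rewrite (@rmin_fin _ _ _ _ c0) //.
- by have [-> ->] := e c0 ltac:(nlia); have [-> ->] := e c0.-1 ltac:(nlia).
- by have [_ ->] := e c0 ltac:(nlia); have [_ ->] := e c0.-1 ltac:(nlia).
move=> d dN; have [-> ->] := e c0 ltac:(nlia); have [-> ->] := e c0.-1 ltac:(nlia).
have [-> ->] := e d ltac:(nlia); have [-> ->] := e d.-1 ltac:(nlia) => wd.
(* Positions that are not cuts have equal averaged w on both sides, hence an infinite ratio. *)
by apply: h => //; apply: contraNT wd => nC; rewrite (blk_mean_notcut _ dN nC).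
Qed.

Definition l1 : R := (total za wa - eps) / total wa wa.

Lemma lambda1E : lambda1 eps zA wA = l1.
Proof. by rewrite /lambda1 enorm2 !dot_total. Qed.

Lemma run_a : total za wa <= eps -> runA eps zA wA [:: inl 0%N] (final 0).
Proof.
move=> h; have -> : final 0 = zA.
  by apply/rowP => i; rewrite !mxE mul0r subr0 max_l // za_ge0.
by apply: runA_a; rewrite dot_total.
Qed.

Lemma run_c c0 D h x : eps < total za wa -> best c0 -> ratio c0 < l1 ->
  cutset N D ->
  (forall c, (0 < c < N)%N ->
     D c = C c && ~~ ((wa c.-1 != wa c) && (ratio c <= l1))) ->
  runA eps (avgrow D z) (avgrow D w) h x ->
  runA eps zA wA ([:: inl 2%N; inr (ratio c0); inr l1] ++ h) x.
Proof.
move=> he hb hr hD hDC hrun; rewrite -lambda1E.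
apply: runA_c; rewrite ?dot_total ?lambda1E ?(best_rmin hb) //.
by rewrite !(avg_groups_shift _ hD).
Qed.

Lemma le_all_ratios c0 lam : best c0 -> lam <= ratio c0 ->
  forall c, (0 < c < N)%N -> C c -> wa c.-1 != wa c -> lam <= ratio c.
Proof. by move=> [_ _ _ h] hl c cN Cc hc; apply: le_trans hl (h c cN Cc hc). Qed.

(** As lambda_1 is at most every finite ratio, z - lambda_1 w is nonincreasing; its last coordinate
    being nonnegative, truncation at 0 has no effect. *)
Lemma run_d c0 : eps < total za wa -> best c0 -> l1 <= ratio c0 ->
  0 <= za n - l1 * wa n ->
  runA eps zA wA [:: inl 3%N; inr (ratio c0); inr l1] (final l1).
Proof.
move=> he hb hr hn.
have -> : final l1 = zA - l1 *: wA.
  apply/rowP => i; rewrite !mxE max_l //; apply: le_trans hn _.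
  apply: (slope_noninc (le_all_ratios hb hr)).
  by have := ltn_ord i; nlia.
rewrite -lambda1E; apply: runA_d;
  rewrite ?dot_total ?lambda1E ?(best_rmin hb) // -!vec_arrE !vec_arr_avgrow //.
Qed.

Variable a : nat.
Hypotheses (aC : consec N C a N).

(** The averaged z is constant from [a] on and drops strictly at [a], so the index set in the
    definition of lambda_0 is the set of positions before the last group. *)
Lemma lt_last i : (i < N)%N -> (za n < za i) = (i < a)%N.
Proof.
move=> iN; have [Ca _ aN _ _] := aC.
case: (leqP a i) => ai.
  by rewrite !(blk_mean_consec _ hC aC) ?ltxx; nlia.
have := za_lt (c := a) ltac:(nlia) Ca.
rewrite !(blk_mean_consec _ hC aC (i := a)) ?leqnn //.
rewrite !(blk_mean_consec _ hC aC (i := n)); last by nlia.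
by move=> /lt_le_trans; apply; apply: za_noninc; nlia.
Qed.

(** This is lambda_0, with each sum over the positions before the last group written as the full sum
    minus the share of that group; it is thus available in constant time from the maintained
    sums. *)
Definition l0 : R :=
  (total za wa - za n * wa n * (N%:R - a%:R) - eps) /
  (total wa wa - wa n * wa n * (N%:R - a%:R)).

Lemma total_last f g : \sum_(0 <= i < a) blk_mean N C f i * blk_mean N C g i =
  total (blk_mean N C f) (blk_mean N C g)
  - blk_mean N C f n * blk_mean N C g n * (N%:R - a%:R) :> R.
Proof.
have [_ _ aN _ _] := aC.
rewrite [X in X - _](big_cat_nat (n := a)) ?(ltnW aN) //=.
have -> : \sum_(a <= i < N) blk_mean N C f i * blk_mean N C g i =
    \sum_(a <= i < N) blk_mean N C f n * blk_mean N C g n; last first.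
  by rewrite sum_const_nat_interval ?(ltnW aN) //; ring.
by apply: eq_big_nat => i hi; rewrite !(blk_mean_consec _ hC aC (i := i)) //
  !(blk_mean_consec _ hC aC (i := n)) //; nlia.
Qed.

Lemma lambda0_avg : lambda0 eps zA wA = l0.
Proof.
have [_ _ aN _ _] := aC.
rewrite (@lambda0E _ _ _ _ _ a) // => [|i iN]; last by rewrite !vec_arr_avgrow // lt_last.
rewrite /l0 -!total_last; congr ((_ - _) / _); apply: eq_big_nat => i hi;
  by rewrite !vec_arr_avgrow //; nlia.
Qed.

(** Guarantees that n' is at most n once test (d) has failed, and lets the search for n' start at
    the last group. *)
Lemma neg_last c0 : best c0 -> za n - l1 * wa n < 0 -> za n - l0 * wa n < 0.
Proof.
move=> [cN Cc wc _] hl; have [_ _ aN _ nC] := aC.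
have a0 : (0 < a)%N.
  by rewrite lt0n; apply/eqP => a0; have := nC c0; rewrite Cc a0 => /(_ ltac:(nlia)).
have w0 : 0 < wa 0%N.
  apply: lt_le_trans (wa_noninc (i := 0%N) (j := c0.-1) ltac:(nlia)).
  by apply: le_lt_trans (wa_ge0 (i := c0) ltac:(nlia)) _; rewrite lt_neqAle eq_sym wc wa_step.
(* The denominator of lambda_0 is positive: the cut [c0] shows that the last group does not begin at
   0, and w drops at [c0], so its first value is positive. *)
have Q0 : 0 < \sum_(0 <= i < a) wa i * wa i.
  rewrite big_ltn //; apply: ltr_wpDr; last by rewrite mulr_gt0.
  by apply: sumr_ge0 => i _; rewrite -expr2 sqr_ge0.
move: hl; rewrite /l1 /l0 -!total_last.
have -> : total za wa = \sum_(0 <= i < a) za i * wa i + za n * wa n * (N%:R - a%:R).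
  by rewrite total_last subrK.
have -> : total wa wa = \sum_(0 <= i < a) wa i * wa i + wa n * wa n * (N%:R - a%:R).
  by rewrite total_last subrK.
have m0 : 0 < N%:R - a%:R :> R by exact: natrB_gt0.
move: (\sum_(0 <= i < a) za i * wa i) (\sum_(0 <= i < a) wa i * wa i) (N%:R - a%:R : R) Q0 m0.
move=> S Q m Q0 m0.
have wn : 0 <= wa n by exact: wa_ge0.
have W0 : 0 < Q + wa n * wa n * m 
  by apply: ltr_wpDr => //; apply: mulr_ge0; [exact: mulr_ge0|exact: ltW].
move: (za n) (wa n) wn W0 => u v wn W0.
(* Cleared of the positive denominators, both inequalities say u * Q < (S - eps) * v: in the
   hypothesis, the term u * v * v * m stands on both sides. *)
by rewrite !subr_lt0 ![_ / _ * _]mulrAC !ltr_pdivlMr //; lra.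
Qed.

Lemma run_e c0 D h x : eps < total za wa -> best c0 -> l1 <= ratio c0 ->
  za n - l1 * wa n < 0 -> ratio c0 < l0 -> cutset N D ->
  (forall c, (0 < c < N)%N ->
     D c = C c && ~~ ((wa c.-1 != wa c) && (ratio c <= l0))) ->
  runA eps (avgrow D z) (avgrow D w) h x ->
  runA eps zA wA ([:: inl 4%N; inr (ratio c0); inr l1; inr l0] ++ h) x.
Proof.
move=> he hb hr hn hr0 hD hDC hrun; rewrite -lambda1E -lambda0_avg.
apply: runA_e; rewrite ?dot_total ?lambda1E ?lambda0_avg ?(best_rmin hb) //.
  by rewrite -!vec_arrE !vec_arr_avgrow.
by rewrite !(avg_groups_shift _ hD).
Qed.

Lemma nprime_avg b : (b <= n)%N ->
  (forall k, (k < N)%N -> (za k - l0 * wa k < 0) = (b <= k)%N) ->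
  nprime eps zA wA = b.
Proof.
by move=> bn h; apply: nprimeE => // k kN; rewrite lambda0_avg !vec_arr_avgrow // h.
Qed.

Lemma run_f c0 : eps < total za wa -> best c0 -> l1 <= ratio c0 ->
  za n - l1 * wa n < 0 -> l0 <= ratio c0 ->
  (forall k, (k < N)%N -> (za k - l0 * wa k < 0) = (a <= k)%N) ->
  runA eps zA wA [:: inl 5%N; inr (ratio c0); inr l1; inr l0; inl a] (final l0).
Proof.
move=> he hb hr hn hr0 hneg; have [_ _ aN _ _] := aC.
have np : nprime eps zA wA = a by apply: nprime_avg => //; nlia.
have -> : final l0 = \row_i Num.max (zA 0 i - lambda0 eps zA wA * wA 0 i) 0.
  by apply/rowP => i; rewrite lambda0_avg !mxE.
rewrite -lambda1E -lambda0_avg -np.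
apply: runA_f; rewrite ?dot_total ?lambda1E ?lambda0_avg ?(best_rmin hb) //.
- by rewrite -!vec_arrE !vec_arr_avgrow.
- by rewrite np; nlia.
- rewrite -!vec_arrE np inordK; last exact: aN.
  rewrite !vec_arr_avgrow //; rewrite (blk_mean_consec _ hC aC); last by nlia.
  by rewrite (blk_mean_consec _ hC aC) //=; nlia.
Qed.

Lemma run_g c0 b D h x : eps < total za wa -> best c0 -> l1 <= ratio c0 ->
  za n - l1 * wa n < 0 -> l0 <= ratio c0 -> C b -> (b < a)%N ->
  (forall k, (k < N)%N -> (za k - l0 * wa k < 0) = (b <= k)%N) ->
  cutset N D -> (forall c, (0 < c < N)%N -> D c = C c && (c <= b)%N) ->
  runA eps (avgrow D z) (avgrow D w) h x ->
  runA eps zA wA ([:: inl 6%N; inr (ratio c0); inr l1; inr l0; inl b] ++ h) x.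
Proof.
move=> he hb hr hn hr0 Cb ba hneg hD hDC hrun; have [_ _ aN _ _] := aC.
have np : nprime eps zA wA = b by apply: nprime_avg => //; nlia.
rewrite -lambda1E -lambda0_avg -[in inl b]np.
apply: runA_g; rewrite ?dot_total ?lambda1E ?lambda0_avg ?(best_rmin hb) //.
- by rewrite -!vec_arrE !vec_arr_avgrow.
- by rewrite np; nlia.
- by rewrite -!vec_arrE np inordK ?gt_eqF ?vec_arr_avgrow ?lt_last //; nlia.
- by rewrite !(avg_groups0 _ hD Cb _ np hDC) //; nlia.
Qed.

End Passes.

(** * Projection onto the simplex for exit (b), and the initial averaging *)

Section Simplex.
Variables (R : realType).

(** The number tau is the Lagrange multiplier of the constraint on the sum of the coordinates. *)
Lemma is_proj_threshold m (kappa tau : R) (y p : 'rV[R]_m) :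
  (forall i, p 0 i = Num.max (y 0 i - tau) 0) -> \sum_i p 0 i = kappa ->
  is_proj (simplex kappa) y p.
Proof.
move=> hp sp; have p0 i : 0 <= p 0 i by rewrite hp le_max lexx orbT.
split.
  split=> // i; rewrite p0 -sp (bigD1 i) //=.
  by rewrite lerDl sumr_ge0.
move=> q [hq sq]; rewrite /enorm ler_wsqrtr // /dot -subr_ge0 -sumrB.
(* The added multiplier terms sum to zero, since [p] and [q] have the same sum. With them every
   summand is nonnegative by itself: it is a square where y - tau is positive, and q^2 + 2 q (tau -
   y) elsewhere. *)
have -> : \sum_i ((y - q) 0 i * (y - q) 0 i - (y - p) 0 i * (y - p) 0 i) =
    \sum_i ((y - q) 0 i * (y - q) 0 i - (y - p) 0 i * (y - p) 0 i
      - 2 * tau * (p 0 i - q 0 i)).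
  rewrite [RHS]sumrB -mulr_sumr [X in _ - 2 * tau * X]sumrB.
  by rewrite sp sq subrr mulr0 subr0.
apply: sumr_ge0 => i _; rewrite !mxE hp; have /andP[q0 _] := hq i.
case: (leP (y 0 i - tau) 0) => h.
  have -> : (y 0 i + - q 0 i) * (y 0 i + - q 0 i) - (y 0 i + - 0) * (y 0 i + - 0)
    - 2 * tau * (0 - q 0 i) = q 0 i * q 0 i + 2 * (q 0 i * (tau - y 0 i)) by ring.
  by rewrite addr_ge0 ?mulr_ge0 //; lra.
set u := y 0 i; have -> : (u + - q 0 i) * (u + - q 0 i) - (u + - (u - tau)) * (u + - (u - tau))
    - 2 * tau * (u - tau - q 0 i) = (u - q 0 i - tau) ^+ 2 by ring.
exact: sqr_ge0.
Qed.

(** The averaged w is constant and positive, so subtracting (tau / w_1) w subtracts tau everywhere.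
    The positive part lives on the first [b] positions, and there the prefix sum at the cut [b]
    gives it the required total eps / w_1. *)
Lemma run_b n (z w : 'rV[R]_n.+1) (eps : R) C (tau : R) b :
  in_T z -> in_T w -> 0 < eps -> cutset n.+1 C ->
  eps < \sum_(0 <= i < n.+1) blk_mean n.+1 C (vec_arr z) i * blk_mean n.+1 C (vec_arr w) i ->
  (forall c, (0 < c < n.+1)%N -> C c ->
     blk_mean n.+1 C (vec_arr w) c.-1 = blk_mean n.+1 C (vec_arr w) c) ->
  C b -> (0 < b <= n.+1)%N ->
  tau = (psum (vec_arr z) b - eps / blk_mean n.+1 C (vec_arr w) 0) / b%:R ->
  (forall i, (i < b)%N -> tau <= blk_mean n.+1 C (vec_arr z) i) ->
  (forall i, (b <= i < n.+1)%N -> blk_mean n.+1 C (vec_arr z) i <= tau) ->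
  runA eps (avgrow C z) (avgrow C w) [:: inl 1%N]
    (final z w C (tau / blk_mean n.+1 C (vec_arr w) 0)).
Proof.
move=> hz hw e0 hC he hcut Cb bN htau hlo hhi.
set za := blk_mean n.+1 C (vec_arr z) in he hlo hhi *.
set wa := blk_mean n.+1 C (vec_arr w) in he hcut htau *.
have step c : (0 < c < n.+1)%N -> wa c.-1 = wa c.
  move=> cN; case: (boolP (C c)) => [/(hcut c cN)//|nC].
  by rewrite /wa -(blk_mean_notcut hC _ cN).
have wE i : (i < n.+1)%N -> wa i = wa 0%N.
  elim: i => // i IH iN; rewrite -(step i.+1) //=; apply: IH; nlia.
(* If the constant value of w were 0, then <z,w> = 0, against 0 < eps < <z,w>. *)
have w0 : 0 < wa 0%N.
  rewrite lt_neqAle (wa_ge0 hw hC) // andbT eq_sym; apply/eqP => w0.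
  move: he; rewrite big1_seq ?ltNge ?(ltW e0) // => i; rewrite mem_index_iota => /andP[_ iN].
  by rewrite wE ?w0 ?mulr0 //; nlia.
have b0 : 0 < b%:R :> R by rewrite ltr0n; nlia.
apply: runA_b.
- by rewrite dot_total.
- by apply: rmin_infty => c cN; rewrite !vec_arr_avgrow; [exact: step|nlia|nlia].
have -> : avgrow C w 0 ord0 = wa 0%N by rewrite mxE.
apply: (@is_proj_threshold _ _ tau).
  by move=> i; rewrite !mxE -/za -/wa wE // divfK // gt_eqF.
transitivity (\sum_(0 <= i < n.+1) Num.max (za i - tau) 0).
  by rewrite big_mkord; apply: eq_bigr => i _; rewrite !mxE -/za -/wa wE // divfK // gt_eqF.
rewrite (big_cat_nat (n := b)) //=; last by nlia.
rewrite [X in _ + X]big1_seq ?addr0; last first.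
  by move=> i; rewrite mem_index_iota => /andP[_ /hhi h]; rewrite max_r // subr_le0.
have -> : \sum_(0 <= i < b) Num.max (za i - tau) 0 = \sum_(0 <= i < b) (za i - tau).
  by apply: eq_big_nat => i /andP[_ /hlo h]; rewrite max_l // subr_ge0.
rewrite sumrB sum_const_nat_interval // subr0 -/(psum za b) psum_blk_mean //; last by nlia.
by rewrite htau mulrC divfK ?gt_eqF // subKr.
Qed.

(** On a group of G(z) the vector z is both nonincreasing and nondecreasing, hence constant:
    Algorithm A averages only w at the start, yet its state is an average of both inputs. *)
Lemma initial_cutset n (z : 'rV[R]_n.+1) D : in_T z -> cutset n.+1 D ->
  (forall c, (0 < c < n.+1)%N -> D c = (vec_arr z c < vec_arr z c.-1)) ->
  avgrow D z = z /\ forall w : 'rV[R]_n.+1, avg (groups z) w = avgrow D w.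
Proof.
move=> hz hD hcut; split; last first.
  by move=> w; apply: avg_blocks => // i; apply: pblock_groups.
apply/rowP => i; rewrite mxE; have [_ _ ab bN nD] := consec_blk hD (ltn_ord i).
have cst k : (blk_start D i <= k < blk_end n.+1 D i)%N ->
    vec_arr z k = vec_arr z (blk_start D i).
  case/andP; elim: k => [|k IH]; first by rewrite leqn0 => /eqP->.
  rewrite leq_eqVlt => /orP[/eqP->//|hk] kb; rewrite -IH //; last exact: ltnW.
  apply/le_anti/andP; split; first by apply: (noninc_vec_arr hz); nlia.
  have := hcut k.+1 ltac:(nlia); rewrite (negPf (nD k.+1 ltac:(nlia))) /= => /esym.
  by rewrite ltNge => /negbFE.
rewrite /blk_mean (mean_const ab cst) -vec_arrE; apply/esym/cst.
by rewrite blk_start_le blk_end_gt.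
Qed.

End Simplex.

(** * Segment trees *)

Section Tree.
Variables (R : realType) (N : nat).
Implicit Types (T : nat -> nat) (K : nat -> R).

(** The value 0 can serve as the empty mark because position 0 is never a removable boundary; ties
    are resolved in favour of the left child. *)
Definition better K (x y : nat) : nat :=
  if (x != 0%N) && ~~ ((y != 0%N) && (K y < K x)) then x else y.

Definition node_ok T K (i : nat) : Prop := T i = better K (T (i + i)%N) (T (i + i).+1).

(** Halving leads from a node to its parent. With the leaves numbered from N to 2N - 1 this works
    for every positive N; the leaves may then have different depths. *)
Definition ancestor (i j : nat) : Prop := exists k, i = iter k half j.

Definition leaves_ok T : Prop := forall c, (c < N)%N -> T (N + c)%N = 0%N \/ T (N + c)%N = c.

Definition heap T K : Prop := forall i, (0 < i < N)%N -> node_ok T K i.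

(* The state in the middle of a bottom-up repair: only proper ancestors of [j] may be wrong. *)
Definition heap_but T K (j : nat) : Prop :=
  forall i, (0 < i < N)%N -> node_ok T K i \/ ancestor i j./2.

Lemma ancestor_half i j : ancestor i j -> i = j \/ ancestor i j./2.
Proof. by move=> [[|k] ->]; [left|right; exists k; rewrite iterSr]. Qed.

Lemma ancestor_refl i : ancestor i i.
Proof. by exists 0%N. Qed.

Lemma half_double i : ((i + i)./2 = i) * ((i + i).+1./2 = i).
Proof. by split; nlia. Qed.

Lemma better_cases K x y : better K x y = x \/ better K x y = y.
Proof. by rewrite /better; case: ifP; [left|right]. Qed.

Lemma better_l K x y : x != 0%N -> better K x y != 0%N /\ K (better K x y) <= K x.
Proof.
rewrite /better => x0; rewrite x0 /=; case: ifPn => [//|].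
by rewrite negbK => /andP[-> /ltW].
Qed.

Lemma better_r K x y : y != 0%N -> better K x y != 0%N /\ K (better K x y) <= K y.
Proof.
rewrite /better => y0; rewrite y0 /=; case: ifPn => [/andP[-> ]|//].
by rewrite -leNgt.
Qed.

Lemma better_ext K K' x y :
  (x != 0%N -> K x = K' x) -> (y != 0%N -> K y = K' y) -> better K x y = better K' x y.
Proof.
rewrite /better => hx hy; case: eqP => // /eqP x0; case: eqP => // /eqP y0 /=.
by rewrite hx // hy.
Qed.

(** A nonzero value at a node was copied from a child, and descending along the copies ends at the
    leaf that owns it. The induction is on the distance of [j] from 2N, since children have larger
    numbers. *)
Lemma tree_leaf T K : leaves_ok T -> heap T K ->
  forall j, (0 < j < N + N)%N -> T j != 0%N ->
    [/\ (T j < N)%N, T (N + T j)%N = T j & ancestor j (N + T j)].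
Proof.
move=> hl hh j; move: {2}(N + N - j)%N (leqnn (N + N - j)) => m.
elim: m j => [|m IH] j hm hj Tj; first by nlia.
case: (leqP N j) => jN.
  have := hl (j - N)%N ltac:(nlia); rewrite subnKC // => -[e|e].
    by rewrite e in Tj.
  by rewrite e subnKC //; split=> //; [nlia|exact: ancestor_refl].
have /hh : (0 < j < N)%N by nlia.
rewrite /node_ok => e.
case: (better_cases K (T (j + j)%N) (T (j + j).+1)) => e2; rewrite e2 in e.
  have [] := IH (j + j)%N; rewrite -?e //; try nlia.
  by move=> h1 h2 [k hk]; split=> //; exists k.+1; rewrite iterS -hk half_double.
have [] := IH (j + j).+1; rewrite -?e //; try nlia.
by move=> h1 h2 [k hk]; split=> //; exists k.+1; rewrite iterS -hk half_double.
Qed.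

(** Passing from a node to its parent never increases the key and never loses a nonzero entry. *)
Lemma tree_root T K : heap T K ->
  forall j, (0 < j < N + N)%N -> T j != 0%N -> T 1%N != 0%N /\ K (T 1%N) <= K (T j).
Proof.
move=> hh; elim/ltn_ind => j IH hj Tj.
case: (eqVneq j 1%N) => [e|j1]; first by rewrite -e.
have hp : (0 < j./2 < N)%N.
  by have := odd_double_half j; case: (odd j) => /= e; nlia.
have [hT hK] : T j./2 != 0%N /\ K (T j./2) <= K (T j).
  rewrite (hh _ hp); have := odd_double_half j; case: (odd j) => /= e.
    have e2 : (j./2 + j./2).+1 = j by nlia.
    by rewrite e2; apply: better_r.
  have e2 : (j./2 + j./2)%N = j by nlia.
  by rewrite e2; apply: better_l.
have [h1 h2] := IH j./2 ltac:(nlia) ltac:(nlia) hT.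
by split=> //; apply: le_trans hK.
Qed.

Lemma tree_empty T K : leaves_ok T -> heap T K -> (0 < N)%N -> T 1%N = 0%N ->
  forall c, (c < N)%N -> T (N + c)%N = 0%N.
Proof.
move=> hl hh N0 T1 c cN; apply/eqP/negPn/negP => h.
have [] := tree_root hh (j := (N + c)%N) _ h; first by nlia.
by rewrite T1.
Qed.

Lemma tree_min T K : leaves_ok T -> heap T K -> (0 < N)%N -> T 1%N != 0%N ->
  [/\ (0 < T 1%N < N)%N, T (N + T 1%N)%N = T 1%N &
      forall c, (0 < c < N)%N -> T (N + c)%N = c -> K (T 1%N) <= K c].
Proof.
move=> hl hh N0 T1; have [h1 h2 _] := tree_leaf hl hh (j := 1%N) ltac:(nlia) T1.
split=> //; first by rewrite h1 lt0n T1.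
move=> c cN hc; have Tc : T (N + c)%N != 0%N by rewrite hc; nlia.
by have [_] := tree_root hh (j := (N + c)%N) ltac:(nlia) Tc; rewrite hc.
Qed.

Lemma heap_set_leaf T K c v : heap T K -> (c < N)%N ->
  heap_but (upd T (N + c)%N v) K (N + c).
Proof.
move=> hh cN i hi; have := hh i hi; rewrite /node_ok /upd.
have -> : (i == N + c)%N = false by nlia.
case: (eqVneq (i + i)%N (N + c)%N) => [e|ne1] h.
  by right; rewrite -e half_double; apply: ancestor_refl.
case: (eqVneq (i + i).+1 (N + c)%N) => [e|ne2].
  by right; rewrite -e half_double; apply: ancestor_refl.
by left.
Qed.

(** A changed key matters only where it is compared, that is, at parents of nodes that store [c]; by
    [tree_leaf] those nodes are ancestors of the leaf of [c]. So altering the key spoils no node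
    that altering the leaf could not spoil. *)
Lemma heap_set_key T K c x v : leaves_ok T -> heap T K -> (c < N)%N ->
  heap_but (upd T (N + c)%N x) (upd K c v) (N + c).
Proof.
move=> hl hh cN i hi; have [h|h] := heap_set_leaf x hh cN hi; last by right.
have keep j : (j < N + N)%N -> (0 < j)%N -> upd T (N + c)%N x j != 0%N ->
    K (upd T (N + c)%N x j) = upd K c v (upd T (N + c)%N x j) \/ ancestor j (N + c).
  case: (eqVneq j (N + c)%N) => [-> _ _ _|ne]; first by right; exact: ancestor_refl.
  have -> : upd T (N + c)%N x j = T j by rewrite /upd (negPf ne).
  move=> jN j0 Tj.
  have [h1 h2 h3] := tree_leaf hl hh (j := j) ltac:(nlia) Tj.
  by rewrite /upd; case: (eqVneq (T j) c) => [<-|_]; [right|left].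
have keep2 j : (j < N + N)%N -> (0 < j)%N -> j./2 = i ->
    (upd T (N + c)%N x j != 0%N ->
       K (upd T (N + c)%N x j) = upd K c v (upd T (N + c)%N x j)) \/
    ancestor i (N + c)./2.
  move=> jN j0 ji; case: (boolP (upd T (N + c)%N x j == 0%N)) => [_|hne]; first by left.
  case: (keep j jN j0 hne) => [e|[k hk]]; first by left.
  by right; exists k; rewrite -iterSr iterS -hk ji.
have [e1|] := keep2 (i + i)%N ltac:(nlia) ltac:(nlia) ltac:(by rewrite half_double); last by right.
have [e2|] := keep2 (i + i).+1 ltac:(nlia) ltac:(nlia) ltac:(by rewrite half_double); last by right.
by left; rewrite /node_ok h; apply: better_ext.
Qed.

(** Recomputing the parent of [j] mends it, and its new value can affect only its own ancestors. *)
Lemma heap_but_step T K j : (1 < j < N + N)%N -> heap_but T K j ->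
  heap_but (upd T j./2 (better K (T (j./2 + j./2)%N) (T (j./2 + j./2).+1))) K j./2.
Proof.
move=> hj hb i hi; set p := j./2.
have p0 : (0 < p)%N by rewrite /p; have := odd_double_half j; case: (odd j) => /=; nlia.
rewrite /node_ok /upd; case: (eqVneq i p) => [->|ip].
  by left; rewrite !ifF //; nlia.
case: (eqVneq (i + i)%N p) => [e|ne1].
  by right; rewrite -e half_double; apply: ancestor_refl.
case: (eqVneq (i + i).+1 p) => [e|ne2].
  by right; rewrite -e half_double; apply: ancestor_refl.
have [h|h] := hb i hi; first by left.
by case: (ancestor_half h) => [e|]; [rewrite e eqxx in ip|right].
Qed.

(** Half of 0 or 1 is 0, and the number 0 belongs to no node. *)
Lemma heap_but_root T K j : (j <= 1)%N -> heap_but T K j -> heap T K.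
Proof.
move=> j1 hb i hi; have [//|[k e]] := hb i hi; move: e hi.
have -> : j./2 = 0%N by case: j j1 {hb} => [|[|j]].
by rewrite (_ : iter k half 0%N = 0%N) => [->|]; last by elim: k => //= k ->.
Qed.

End Tree.

(** * The program and its specification *)

(* A cut is the first position of a group; 0 and the dimension N are sentinels.  [aNX] and
   [aPV] link the cuts into a doubly linked list, [aS] (of height [vSP]) is the stack of the
   cuts to be removed, [aSZ], [aSW], [aRN] hold the prefix sums of the input z and w and the
   reals 0, ..., N.  [aT] is a segment tree with root 1: the leaf N + c holds c if the ratio at
   the cut c is finite (its value is then in [aK]) and 0 otherwise, and an inner node holds the
   better of its two children, 0 standing for an infinite ratio. *)
Notation vN := 0%N (only parsing).
Notation vI := 1%N (only parsing).
Notation vC := 2%N (only parsing).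
Notation vJ := 3%N (only parsing).
Notation vSP := 4%N (only parsing).
Notation vRUN := 5%N (only parsing).
Notation vA := 6%N (only parsing).
Notation vB := 7%N (only parsing).
Notation vX := 8%N (only parsing).
Notation vY := 9%N (only parsing).
Notation vD := 10%N (only parsing).
Notation aNX := 0%N (only parsing).
Notation aPV := 1%N (only parsing).
Notation aT := 2%N (only parsing).
Notation aS := 3%N (only parsing).
Notation rEPS := 0%N (only parsing).
Notation rDOT := 1%N (only parsing).
Notation rWW := 2%N (only parsing).
Notation rR := 3%N (only parsing).
Notation rL1 := 4%N (only parsing).
Notation rL0 := 5%N (only parsing).
Notation rLAM := 6%N (only parsing).
Notation rZ := 7%N (only parsing).
Notation rW := 8%N (only parsing).
Notation aSZ := 2%N (only parsing).
Notation aSW := 3%N (only parsing).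
Notation aRN := 4%N (only parsing).
Notation aK := 5%N (only parsing).
Notation "c1 ;; c2" := (Seq c1 c2) (at level 95, right associativity).

Definition ewidth (a b : iexp) : rexp := RSub (RGet aRN b) (RGet aRN a).
Definition emean (f : nat) (a b : iexp) : rexp :=
  RDiv (RSub (RGet f b) (RGet f a)) (ewidth a b).
Definition econtrib (f g : nat) (a b : iexp) : rexp :=
  RMul (RMul (emean f a b) (emean g a b)) (ewidth a b).
Definition inz (e : iexp) : bexp := BNot (BIEq e (IConst 0)).
Definition eleaf (v : nat) : iexp := IAdd (IVar vN) (IVar v).

Definition repair_step : cmd :=
  SetI vJ (IHalf (IVar vJ)) ;;
  SetI vX (IGet aT (IAdd (IVar vJ) (IVar vJ))) ;;
  SetI vY (IGet aT (IAdd (IConst 1) (IAdd (IVar vJ) (IVar vJ)))) ;;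
  If (BAnd (inz (IVar vX))
        (BNot (BAnd (inz (IVar vY)) (BRLt (RGet aK (IVar vY)) (RGet aK (IVar vX))))))
     (PutI aT (IVar vJ) (IVar vX))
     (PutI aT (IVar vJ) (IVar vY)).

Definition repair : cmd := While (BILt (IConst 1) (IVar vJ)) repair_step.

Definition clear_leaf (v : nat) : cmd :=
  PutI aT (eleaf v) (IConst 0) ;; SetI vJ (eleaf v) ;; repair.

(** The guard is for the sentinels 0 and N, which can be neighbours of a removed cut but have no
    ratio. *)
Definition refresh : cmd :=
  If (BAnd (BILt (IConst 0) (IVar vC)) (BILt (IVar vC) (IVar vN)))
    (SetI vX (IGet aPV (IVar vC)) ;;
     SetI vY (IGet aNX (IVar vC)) ;;
     If (BREq (emean aSW (IVar vX) (IVar vC)) (emean aSW (IVar vC) (IVar vY)))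
       (PutI aT (eleaf vC) (IConst 0))
       (PutI aT (eleaf vC) (IVar vC) ;;
        PutR aK (IVar vC)
          (RDiv (RSub (emean aSZ (IVar vX) (IVar vC)) (emean aSZ (IVar vC) (IVar vY)))
                (RSub (emean aSW (IVar vX) (IVar vC)) (emean aSW (IVar vC) (IVar vY))))) ;;
     SetI vJ (eleaf vC) ;;
     repair)
    Skip.

Section TreeOps.
Variables (R : realType) (N : nat).
Implicit Type s : state R.

(** Each iteration halves [vJ], so the exponent [m] bounds the number of levels still to be
    repaired. *)
Lemma wp_repair m s : (ivar s vJ < 2 ^ m)%N -> (ivar s vJ < N + N)%N ->
  heap_but N (iarr s aT) (rarr s aK) (ivar s vJ) ->
  wp repair s (fun t s' => [/\ (t <= 40 * m + 5)%N, heap N (iarr s' aT) (rarr s aK)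
    & forall i, (N <= i)%N -> iarr s' aT i = iarr s aT i]).
Proof.
elim: m s => [|m IH] s hm hj hb; apply: wp_While => /=; case: ifPn => j1.
- by move: hm; rewrite expn0; nlia.
- split; [by []| |by []]; apply: heap_but_root hb; nlia.
- do 3 (apply: wp_Seq; apply: wp_SetI => /=).
  set s1 := set_ivar _ vY _.
  have hj2 : (1 < ivar s vJ < N + N)%N by rewrite j1.
  have hj' : (0 < (ivar s vJ)./2 < N)%N.
    by have := odd_double_half (ivar s vJ); case: (odd _) => /= e; nlia.
  pose s2 := set_iarr s1 aT (ivar s vJ)./2
    (better (rarr s aK) (iarr s aT ((ivar s vJ)./2 + (ivar s vJ)./2)%N)
       (iarr s aT ((ivar s vJ)./2 + (ivar s vJ)./2).+1)).
  suff W2 : wp repair s2 (fun t s' => [/\ (t <= 40 * m + 5)%N, heap N (iarr s' aT) (rarr s aK)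
      & forall i, (N <= i)%N -> iarr s' aT i = iarr s aT i]).
    apply: wp_If; rewrite /=.
    case: ifP => hc; apply: wp_PutI => /=.
    + have -> : set_iarr s1 aT (ivar s1 vJ) (ivar s1 vX) = s2.
        by rewrite /s2 /better hc.
      by apply: wp_conseq W2 _ => t s' [h1 h2 h3]; split=> //; nlia.
    + have -> : set_iarr s1 aT (ivar s1 vJ) (ivar s1 vY) = s2.
        by rewrite /s2 /better hc.
      by apply: wp_conseq W2 _ => t s' [h1 h2 h3]; split=> //; nlia.
  apply: wp_conseq (IH s2 _ _ _) _ => /=.
  + rewrite /upd /=; move: hm; rewrite expnS; nlia.
  + by rewrite /upd /=; nlia.
  + by rewrite /upd2 /upd /=; apply: heap_but_step.
  move=> t s' [h1 h2 h3]; split=> // i hi; rewrite h3 // /upd2 /upd /=.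
  by case: eqP => // e; nlia.
- split; [nlia| |by []]; apply: heap_but_root hb; nlia.
Qed.

Lemma wp_clear_leaf m v s c : (N + N <= 2 ^ m)%N -> ivar s vN = N -> ivar s v = c ->
  (c < N)%N -> v != vJ -> heap N (iarr s aT) (rarr s aK) ->
  wp (clear_leaf v) s (fun t s' => [/\ (t <= 40 * m + 30)%N,
      heap N (iarr s' aT) (rarr s aK), iarr s' aT (N + c)%N = 0%N
    & forall i, i != c -> iarr s' aT (N + i)%N = iarr s aT (N + i)%N]).
Proof.
move=> hm hN hv cN vj hh; rewrite /clear_leaf.
apply: wp_Seq; apply: wp_PutI => /=; apply: wp_Seq; apply: wp_SetI => /=.
rewrite hN hv; set s1 := set_ivar _ _ _.
have e1 : ivar s1 vJ = (N + c)%N by [].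
have e2 : iarr s1 aT = upd (iarr s aT) (N + c)%N 0%N by [].
apply: wp_conseq (wp_repair (m := m) (s := s1) _ _ _) _; rewrite ?e1 ?e2; try nlia.
  exact: heap_set_leaf.
move=> t s' [h1 h2 h3]; split=> //; first by nlia.
  by rewrite h3 /upd ?eqxx //; nlia.
by move=> i ic; rewrite h3 ?leq_addr // /upd eqn_add2l (negPf ic).
Qed.

End TreeOps.

(** * The invariant relating the machine state to a set of cuts *)

Section Invariant.
Variables (R : realType) (N : nat) (zf wf : nat -> R) (eps : R).
Implicit Types (s : state R) (C E : pred nat) (T : nat -> nat) (K : nat -> R).
Local Notation za C := (blk_mean N C zf).
Local Notation wa C := (blk_mean N C wf).
Local Notation ratio C c := ((za C c.-1 - za C c) / (wa C c.-1 - wa C c)).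
Local Notation total f g := (\sum_(0 <= i < N) f i * g i).

Definition base s : Prop :=
  [/\ ivar s vN = N, rvar s rEPS = eps
    & forall k, (k <= N)%N ->
      [/\ rarr s aSZ k = psum zf k, rarr s aSW k = psum wf k & rarr s aRN k = k%:R]].

Definition linked C s : Prop :=
  forall a b, consec N C a b -> iarr s aNX a = b /\ iarr s aPV b = a.

Definition sums C s : Prop :=
  rvar s rDOT = total (za C) (wa C) /\ rvar s rWW = total (wa C) (wa C).

Definition stack (S : seq nat) s : Prop :=
  ivar s vSP = size S /\ forall k, (k < size S)%N -> iarr s aS k = nth 0%N S k.

Definition leaf_ok C T K (c : nat) : Prop :=
  T (N + c)%N = (if wa C c.-1 == wa C c then 0%N else c) /\
  (wa C c.-1 != wa C c -> K c = ratio C c).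

(* The cuts in [E] are exempt: their leaves may be stale. *)
Definition tree C E T K : Prop :=
  [/\ leaves_ok N T, heap N T K
    & forall c, (0 < c < N)%N ->
        (~~ C c -> T (N + c)%N = 0%N) /\ (C c -> ~~ E c -> leaf_ok C T K c)].

Definition subcuts C (S : seq nat) : Prop :=
  uniq S /\ forall c, c \in S -> (0 < c < N)%N /\ C c.

(** The stacked cuts [S] are still in [C], and the links and sums are those before their removal.
    The state of Algorithm A that is reached by unlinking them all has the cuts of [C] outside
    [S]. *)
Definition inv C (S : seq nat) s : Prop :=
  [/\ [/\ cutset N C, base s & linked C s], sums C s, stack S s,
      tree C (fun c => c \in S) (iarr s aT) (rarr s aK) & subcuts C S].

Lemma base_frame s s' : ivar s' vN = ivar s vN -> rvar s' rEPS = rvar s rEPS ->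
  rarr s' aSZ = rarr s aSZ -> rarr s' aSW = rarr s aSW -> rarr s' aRN = rarr s aRN ->
  base s -> base s'.
Proof. by rewrite /base => -> -> -> -> ->. Qed.

Lemma reval_mean_z s a b x y : base s -> ieval s a = x -> ieval s b = y ->
  (x <= N)%N -> (y <= N)%N -> reval s (emean aSZ a b) = mean zf x y.
Proof.
move=> [_ _ h] ea eb hx hy; have [h1 _ h2] := h _ hx; have [h3 _ h4] := h _ hy.
by rewrite /= ea eb h1 h2 h3 h4.
Qed.

Lemma reval_mean_w s a b x y : base s -> ieval s a = x -> ieval s b = y ->
  (x <= N)%N -> (y <= N)%N -> reval s (emean aSW a b) = mean wf x y.
Proof.
move=> [_ _ h] ea eb hx hy; have [_ h1 h2] := h _ hx; have [_ h3 h4] := h _ hy.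
by rewrite /= ea eb h1 h2 h3 h4.
Qed.

Lemma reval_width s a b x y : base s -> ieval s a = x -> ieval s b = y ->
  (x <= N)%N -> (y <= N)%N -> reval s (ewidth a b) = y%:R - x%:R.
Proof.
move=> [_ _ h] ea eb hx hy; have [_ _ h1] := h _ hx; have [_ _ h2] := h _ hy.
by rewrite /= ea eb h1 h2.
Qed.

Lemma consec_le C a b : consec N C a b -> (a < b <= N)%N.
Proof. by case=> _ _ -> ->. Qed.

Lemma leaf_ok_means C T K a b c : cutset N C -> consec N C a c -> consec N C c b ->
  T (N + c)%N = (if mean wf a c == mean wf c b then 0%N else c) ->
  (mean wf a c != mean wf c b ->
     K c = (mean zf a c - mean zf c b) / (mean wf a c - mean wf c b)) ->
  leaf_ok C T K c.
Proof.
move=> hC h1 h2; have := consec_le h1; have := consec_le h2 => l1 l2.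
by rewrite /leaf_ok !(blk_mean_consec _ hC h1 (i := c.-1)) ?(blk_mean_consec _ hC h2 (i := c)) //; nlia.
Qed.

(** Serves both to enter a first key and to renew a stale one; the leaves and keys of all other cuts
    are untouched. *)
Lemma wp_refresh m C s c : (N + N <= 2 ^ m)%N -> base s -> cutset N C -> linked C s ->
  ivar s vC = c -> C c -> (c <= N)%N ->
  leaves_ok N (iarr s aT) -> heap N (iarr s aT) (rarr s aK) ->
  wp refresh s (fun t s' =>
    [/\ (t <= 40 * m + 120)%N, leaves_ok N (iarr s' aT), heap N (iarr s' aT) (rarr s' aK),
        (0 < c < N)%N -> leaf_ok C (iarr s' aT) (rarr s' aK) c
      & forall i, i != c -> iarr s' aT (N + i)%N = iarr s aT (N + i)%N /\
                            rarr s' aK i = rarr s aK i]).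
Proof.
move=> hm hb hC hl hc Cc cN0 hlv hh; rewrite /refresh.
have [hN _ _] := hb; apply: wp_If; rewrite [beval _ _]/= hc hN; case: ifPn => cN; last first.
  by apply: wp_Skip => /=; split=> //; [nlia|move=> h; rewrite h in cN].
have [a [b [h1 h2 _]]] := cut_neighbours R hC Cc cN.
have [_ e1] := hl _ _ h1; have [e2 _] := hl _ _ h2.
have l1 := consec_le h1; have l2 := consec_le h2.
apply: wp_Seq; apply: wp_SetI => /=; apply: wp_Seq; apply: wp_SetI => /=.
rewrite /upd /= hc e1 e2; set s2 := set_ivar _ _ _.
have hb2 : base s2 by apply: base_frame hb.
have [v1 v2 v3] : [/\ ivar s2 vX = a, ivar s2 vY = b & ivar s2 vC = c] by [].
have ew1 : reval s2 (emean aSW (IVar vX) (IVar vC)) = mean wf a c.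
  by apply: reval_mean_w => //; nlia.
have ew2 : reval s2 (emean aSW (IVar vC) (IVar vY)) = mean wf c b.
  by apply: reval_mean_w => //; nlia.
have ez1 : reval s2 (emean aSZ (IVar vX) (IVar vC)) = mean zf a c.
  by apply: reval_mean_z => //; nlia.
have ez2 : reval s2 (emean aSZ (IVar vC) (IVar vY)) = mean zf c b.
  by apply: reval_mean_z => //; nlia.
apply: wp_Seq; apply: wp_If.
rewrite (_ : beval s2 _ = (mean wf a c == mean wf c b)); last by rewrite -ew1 -ew2.
have cn : (c < N)%N by nlia.
case: ifPn => hw.
  apply: wp_PutI; apply: wp_Seq; apply: wp_SetI.
  set s4 := set_ivar _ _ _.
  have f1 : ivar s4 vJ = (N + c)%N by rewrite /= /upd /= hN hc.
  have f2 : iarr s4 aT = upd (iarr s aT) (N + c)%N 0%N by rewrite /= /upd2 /upd /= hN hc.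
  have f3 : rarr s4 aK = rarr s aK by [].
  apply: wp_frame; apply: wp_conseq (wp_repair (N := N) (m := m) (s := s4) _ _ _) _; rewrite ?f1 ?f2 ?f3; try nlia.
    exact: heap_set_leaf.
  move=> t s' [g1 g2 g3] [_ _ _ fr _]; rewrite fr // f3.
  have oth i : i != c -> iarr s' aT (N + i)%N = iarr s aT (N + i)%N.
    by move=> ic; rewrite g3 ?leq_addr // /upd eqn_add2l (negPf ic).
  have own : iarr s' aT (N + c)%N = 0%N by rewrite g3 ?leq_addr // /upd eqxx.
  split=> //.
  - by move: g1; rewrite /=; nlia.
  - move=> i iN; case: (eqVneq i c) => [->|ic]; first by left.
    by rewrite oth //; apply: hlv.
  - by move=> _; apply: leaf_ok_means h1 h2 _ _; rewrite ?hw // own.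
  - by move=> i ic; rewrite oth.
apply: wp_Seq; apply: wp_PutI; apply: wp_PutR; apply: wp_Seq; apply: wp_SetI.
set s4 := set_ivar _ _ _.
have f1 : ivar s4 vJ = (N + c)%N by rewrite /= /upd /= hN hc.
have f2 : iarr s4 aT = upd (iarr s aT) (N + c)%N c by rewrite /= /upd2 /upd /= hN hc.
have f3 : rarr s4 aK = upd (rarr s aK) c ((mean zf a c - mean zf c b) / (mean wf a c - mean wf c b)).
  by rewrite -ew1 -ew2 -ez1 -ez2 /= /upd2 /upd /= hc.
apply: wp_frame; apply: wp_conseq (wp_repair (N := N) (m := m) (s := s4) _ _ _) _; rewrite ?f1 ?f2 ?f3; try nlia.
  exact: heap_set_key.
move=> t s' [g1 g2 g3] [_ _ _ fr _]; rewrite fr // f3.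
have oth i : i != c -> iarr s' aT (N + i)%N = iarr s aT (N + i)%N.
  by move=> ic; rewrite g3 ?leq_addr // /upd eqn_add2l (negPf ic).
have own : iarr s' aT (N + c)%N = c by rewrite g3 ?leq_addr // /upd eqxx.
split=> //.
- by move: g1; rewrite /=; nlia.
- move=> i iN; case: (eqVneq i c) => [->|ic]; first by right.
  by rewrite oth //; apply: hlv.
- by move=> _; apply: leaf_ok_means h1 h2 _ _ => //; rewrite ?own ?(negPf hw) // /upd eqxx.
- by move=> i ic; rewrite oth // /upd (negPf ic).
Qed.

End Invariant.

(** * Removal of the stacked cuts *)

Definition unlink : cmd :=
  SetI vSP (ISub (IVar vSP) (IConst 1)) ;;
  SetI vD (IGet aS (IVar vSP)) ;;
  SetI vA (IGet aPV (IVar vD)) ;;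
  SetI vB (IGet aNX (IVar vD)) ;;
  SetR rDOT (RAdd (RSub (RSub (RVar rDOT) (econtrib aSZ aSW (IVar vA) (IVar vD)))
                        (econtrib aSZ aSW (IVar vD) (IVar vB)))
                  (econtrib aSZ aSW (IVar vA) (IVar vB))) ;;
  SetR rWW (RAdd (RSub (RSub (RVar rWW) (econtrib aSW aSW (IVar vA) (IVar vD)))
                       (econtrib aSW aSW (IVar vD) (IVar vB)))
                 (econtrib aSW aSW (IVar vA) (IVar vB))) ;;
  PutI aNX (IVar vA) (IVar vB) ;;
  PutI aPV (IVar vB) (IVar vA) ;;
  clear_leaf vD ;;
  SetI vC (IVar vA) ;; refresh ;;
  SetI vC (IVar vB) ;; refresh.

Definition unlink_all : cmd := While (BILt (IConst 0) (IVar vSP)) unlink.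

Definition push (v : nat) : cmd :=
  PutI aS (IVar vSP) (IVar v) ;; SetI vSP (IAdd (IVar vSP) (IConst 1)).

Definition pop_small : cmd :=
  While (BAnd (inz (IGet aT (IConst 1)))
              (BNot (BRLt (RVar rLAM) (RGet aK (IGet aT (IConst 1))))))
    (SetI vC (IGet aT (IConst 1)) ;; push vC ;; clear_leaf vC).

Definition scan : cmd :=
  While (BAnd (BILt (IConst 0) (IVar vA))
              (BRLt (RSub (emean aSZ (IGet aPV (IVar vA)) (IVar vA))
                          (RMul (RVar rLAM) (emean aSW (IGet aPV (IVar vA)) (IVar vA))))
                    RZero))
    (push vA ;; SetI vA (IGet aPV (IVar vA))).

Section Loops.
Variables (R : realType) (N : nat) (zf wf : nat -> R) (eps : R).
Implicit Types (s : state R) (C E : pred nat) (T : nat -> nat) (K : nat -> R).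
Local Notation za C := (blk_mean N C zf).
Local Notation wa C := (blk_mean N C wf).
Local Notation ratio C c := ((za C c.-1 - za C c) / (wa C c.-1 - wa C c)).
Local Notation inv := (inv N zf wf eps).
Local Notation base := (base N zf wf eps).
Local Notation leaf_ok := (leaf_ok N zf wf).
Local Notation linked := (linked N).
Local Notation subcuts := (subcuts N).
Variable m : nat.
Hypothesis hm : (N + N <= 2 ^ m)%N.

(** A ratio depends only on the two groups that meet at the cut. *)
Lemma leaf_ok_transfer C C' T K T' K' x c y : cutset N C -> cutset N C' ->
  consec N C x c -> consec N C c y -> consec N C' x c -> consec N C' c y ->
  T' (N + c)%N = T (N + c)%N -> K' c = K c -> leaf_ok C T K c -> leaf_ok C' T' K' c.
Proof.
move=> hC hC' h1 h2 h3 h4 eT eK; have := consec_le h1; have := consec_le h2 => l1 l2.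
rewrite /leaf_ok eT eK !(blk_mean_consec _ hC h1 (i := c.-1)) ?(blk_mean_consec _ hC h2 (i := c));
  try nlia.
by rewrite !(blk_mean_consec _ hC' h3 (i := c.-1)) ?(blk_mean_consec _ hC' h4 (i := c)); try nlia.
Qed.

Lemma leaf_ok_eq C T K T' K' c : T' (N + c)%N = T (N + c)%N -> K' c = K c ->
  leaf_ok C T K c -> leaf_ok C T' K' c.
Proof. by rewrite /leaf_ok => -> ->. Qed.

Lemma reval_contrib_zw s a b x y : base s -> ieval s a = x -> ieval s b = y ->
  (x <= N)%N -> (y <= N)%N ->
  reval s (econtrib aSZ aSW a b) = mean zf x y * mean wf x y * (y%:R - x%:R).
Proof.
move=> hb ea eb hx hy; rewrite -(reval_mean_z hb ea eb) // -(reval_mean_w hb ea eb) //.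
by rewrite -(reval_width hb ea eb).
Qed.

Lemma reval_contrib_ww s a b x y : base s -> ieval s a = x -> ieval s b = y ->
  (x <= N)%N -> (y <= N)%N ->
  reval s (econtrib aSW aSW a b) = mean wf x y * mean wf x y * (y%:R - x%:R).
Proof.
by move=> hb ea eb hx hy; rewrite -(reval_mean_w hb ea eb) // -(reval_width hb ea eb).
Qed.

Lemma cutset_remove C d : cutset N C -> (0 < d < N)%N -> cutset N (remove C d).
Proof. by move=> /andP[C0 CN] dN; rewrite /cutset /remove C0 CN /=; nlia. Qed.

(** The leaf of [d] is cleared here even though [pop_small] clears it on stacking: a [refresh] next
    to an earlier removal may have written it again while [d] was stacked, and [scan] and
    [push_ties] leave the leaves alone. *)
Lemma wp_unlink C S d s : inv C (rcons S d) s ->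
  wp unlink s (fun t s' => (t <= 120 * m + 800)%N /\ inv (remove C d) S s').
Proof.
move=> [[hC hb hl] [hs1 hs2] [hst1 hst2] [ht1 ht2 ht3] [hu hS]].
have [dN Cd] : (0 < d < N)%N /\ C d by apply: hS; rewrite mem_rcons mem_head.
have [a [b [had hdb _]]] := cut_neighbours R hC Cd dN.
have [_ ea] := hl _ _ had; have [eb _] := hl _ _ hdb.
have lad := consec_le had; have ldb := consec_le hdb.
have [Ca _ _ _ _] := had; have [_ Cb _ _ _] := hdb.
have hC' := cutset_remove hC dN.
have [hN _ _] := hb.
rewrite size_rcons in hst1; rewrite size_rcons in hst2.
have ed : iarr s aS (size S) = d by rewrite hst2 // nth_rcons ltnn eqxx.
rewrite /unlink; do 4 (apply: wp_Seq; apply: wp_SetI).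
set s4 := set_ivar _ vB _.
have q1 : ivar s4 vSP = size S by rewrite /= /upd /= hst1 subn1.
have q2 : ivar s4 vD = d by rewrite /= /upd /= hst1 subn1 ed.
have q3 : ivar s4 vA = a by rewrite /= /upd /= hst1 subn1 ed ea.
have q4 : ivar s4 vB = b by rewrite /= /upd /= hst1 subn1 ed eb.
have b4 : base s4 by apply: base_frame hb.
have hs1' : rvar s4 rDOT = rvar s rDOT by [].
have hs2' : rvar s4 rWW = rvar s rWW by [].
have i0 : iarr s4 = iarr s by [].
have r0 : rarr s4 = rarr s by [].
move: {+}s4 q1 q2 q3 q4 b4 hs1' hs2' i0 r0 => {}s4 q1 q2 q3 q4 b4 hs1' hs2' i0 r0.
apply: wp_Seq; apply: wp_SetR; set s5 := set_rvar _ _ _.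
have b5 : base s5 by apply: base_frame b4.
apply: wp_Seq; apply: wp_SetR; set s6 := set_rvar _ _ _.
have b6 : base s6 by apply: base_frame b5.
have d6 : sums N zf wf (remove C d) s6.
  split.
    have -> : rvar s6 rDOT = reval s4 (RAdd (RSub (RSub (RVar rDOT) (econtrib aSZ aSW (IVar vA) (IVar vD)))
                        (econtrib aSZ aSW (IVar vD) (IVar vB)))
                  (econtrib aSZ aSW (IVar vA) (IVar vB))) by [].
    rewrite (sum_blk_mean_remove _ _ hC had hdb) -hs1 -hs1'.
    rewrite -(@reval_contrib_zw s4 (IVar vA) (IVar vD) a d b4 q3 q2) -?(@reval_contrib_zw s4 (IVar vD) (IVar vB) d b b4 q2 q4)
      -?(@reval_contrib_zw s4 (IVar vA) (IVar vB) a b b4 q3 q4) //; nlia.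
  have -> : rvar s6 rWW = reval s5 (RAdd (RSub (RSub (RVar rWW) (econtrib aSW aSW (IVar vA) (IVar vD)))
                        (econtrib aSW aSW (IVar vD) (IVar vB)))
                  (econtrib aSW aSW (IVar vA) (IVar vB))) by [].
  rewrite (sum_blk_mean_remove _ _ hC had hdb) -hs2 -hs2'.
  rewrite -(@reval_contrib_ww s5 (IVar vA) (IVar vD) a d b5 q3 q2) -?(@reval_contrib_ww s5 (IVar vD) (IVar vB) d b b5 q2 q4)
    -?(@reval_contrib_ww s5 (IVar vA) (IVar vB) a b b5 q3 q4) //; nlia.
apply: wp_Seq; apply: wp_PutI; apply: wp_Seq; apply: wp_PutI; set s8 := set_iarr _ _ _ _.
have b8 : base s8 by apply: base_frame b6.
have l8 : linked (remove C d) s8.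
  move=> x y hxy; rewrite /= /upd2 /upd /= q3 q4 i0.
  case: (consec_remove had hdb hxy) => [[-> ->]|[hc xd yd]]; first by rewrite !eqxx.
  have := consec_le hc => lxy.
  have -> : (x == a) = false.
    apply/eqP => e; rewrite e in hc lxy.
    by have [_ e2] := consec_uniq (i := a) hc had ltac:(nlia) ltac:(nlia); rewrite e2 eqxx in yd.
  have -> : (y == b) = false.
    apply/eqP => e; rewrite e in hc lxy.
    by have [e2 _] := consec_uniq (i := b.-1) hc hdb ltac:(nlia) ltac:(nlia); rewrite e2 eqxx in xd.
  exact: hl.
have t8 : iarr s8 aT = iarr s aT by rewrite -i0.
have k8 : rarr s8 aK = rarr s aK by rewrite -r0.
have st8 : iarr s8 aS = iarr s aS by rewrite -i0.
have v8 : [/\ ivar s8 vSP = size S, ivar s8 vD = d, ivar s8 vA = a & ivar s8 vB = b] by [].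
have d8 : sums N zf wf (remove C d) s8 by [].
move: {+}s8 b8 l8 t8 k8 st8 v8 d8 => {}s8 b8 l8 t8 k8 st8 [v81 v82 v83 v84] d8.
apply: wp_Seq; apply: wp_frame.
have dN' : (d < N)%N by nlia.
apply: wp_conseq (wp_clear_leaf hm (s := s8) (c := d) _ v82 dN' _ _) _; rewrite ?t8 ?k8 //.
  by case: b8.
move=> t9 s9 [tm9 h9 z9 o9] [fi9 fa9 fv9 fr9 _].
have b9 : base s9 by apply: base_frame b8; rewrite ?fi9 ?fv9 ?fr9.
apply: wp_Seq; apply: wp_SetI; apply: wp_Seq; set s10 := set_ivar _ _ _.
have lv9 : leaves_ok N (iarr s9 aT).
  move=> c cN; case: (eqVneq c d) => [->|cd]; first by left.
  by rewrite o9 //; apply: ht1.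
have b10 : base s10 by apply: base_frame b9.
have Ca' : remove C d a by rewrite /remove Ca; nlia.
have Cb' : remove C d b by rewrite /remove Cb; nlia.
have l10 : linked (remove C d) s10.
  by move=> x y /l8; rewrite /s10 /= !fa9.
have k9 : rarr s9 aK = rarr s aK by rewrite fr9.
apply: wp_frame; apply: wp_conseq (wp_refresh hm b10 hC' l10 (c := a) _ Ca' _ lv9 _) _ => //.
- by rewrite /= /upd /= fi9.
- by nlia.
- by rewrite /s10 /= k9.
move=> t11 s11 [tm11 lv11 h11 ok11 o11] [fi11 fa11 fv11 fr11 _].
apply: wp_Seq; apply: wp_SetI; set s12 := set_ivar _ _ _.
have b12 : base s12 by apply: base_frame b10; rewrite /s12 /= ?fv11 ?fr11 // /upd /= fi11.
have l12 : linked (remove C d) s12 by move=> x y /l10; rewrite /s12 /= !fa11.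
apply: wp_frame; apply: wp_conseq (wp_refresh hm b12 hC' l12 (c := b) _ Cb' _ lv11 _) _ => //.
- by rewrite /= /upd /= fi11 // /s10 /= /upd /= fi9.
- by nlia.
move=> t13 s13 [tm13 lv13 h13 ok13 o13] [fi13 fa13 fv13 fr13 _].
split; first by move: tm9 tm11 tm13; rewrite /=; clear; nlia.
have b13 : base s13 by apply: base_frame b12; rewrite ?fi13 ?fv13 ?fr13.
have stk13 : iarr s13 aS = iarr s aS by rewrite fa13 // /s12 /= fa11 // /s10 /= fa9.
split=> //.
- by split=> // x y /l12; rewrite !fa13.
- by case: d8 => e1 e2; split; rewrite fv13 // /s12 /= fv11 // /s10 /= fv9.
- split; first by rewrite fi13 // /s12 /= /upd /= fi11 // /s10 /= /upd /= fi9.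
  by move=> k hk; rewrite stk13 hst2 ?nth_rcons ?hk //; nlia.
- split=> // c cN.
  have oT : c != a -> c != b -> c != d -> iarr s13 aT (N + c)%N = iarr s aT (N + c)%N.
    by move=> h1 h2 h3; rewrite (o13 _ h2).1 /s12 /= (o11 _ h1).1 /s10 /= o9 // t8.
  split=> [|/andP[Cc cd] cS].
    rewrite /remove negb_and negbK => /orP[nCc|/eqP ->].
      have [ca cb cd] : [/\ c != a, c != b & c != d].
        by split; apply: contraNneq nCc => ->.
      by rewrite oT //; case: (ht3 c cN) => /(_ nCc).
    by rewrite (o13 d _).1 ?/s12 /= ?(o11 d _).1 ?/s10 //=; nlia.
  (* Three kinds of remaining cuts: [b] has just been refreshed, [a] was refreshed before and not
     touched since, and any other cut keeps both adjacent groups and so its ratio. *)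
  case: (eqVneq c b) => [e|cb]; first by subst c; exact: ok13.
  case: (eqVneq c a) => [e|ca].
    subst c; apply: leaf_ok_eq (ok11 cN); first by rewrite (o13 _ cb).1.
    by rewrite (o13 _ cb).2.
  have [x [y [h1 h2 _]]] := cut_neighbours R hC' (c := c) ltac:(by rewrite /remove Cc cd) cN.
  have [[_ e]|[h1' _ _]] := consec_remove had hdb h1; first by rewrite e eqxx in cb.
  have [[e _]|[h2' _ _]] := consec_remove had hdb h2; first by rewrite e eqxx in ca.
  have [_ /(_ Cc)] := ht3 c cN; rewrite mem_rcons inE negb_or cd cS => /(_ isT).
  apply: leaf_ok_transfer h1' h2' h1 h2 _ _ => //; first exact: oT.
  by rewrite (o13 _ cb).2 /s12 /= (o11 _ ca).2 /s10 /= k9.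
- rewrite rcons_uniq in hu; have /andP[dS uS] := hu; split=> // c cS.
  have [h1 h2] := hS c ltac:(by rewrite mem_rcons inE cS orbT).
  by split=> //; rewrite /remove h2; apply: contraNneq dS => <-.
Qed.

Lemma wp_unlink_all S C s : inv C S s ->
  wp unlink_all s (fun t s' => exists C',
    [/\ forall x, C' x = C x && (x \notin S), inv C' [::] s'
      & (t <= size S * (120 * m + 805) + 5)%N]).
Proof.
elim/last_ind: S C s => [|S d IH] C s hi; apply: wp_While; have [_ _ [hst _] _ _] := hi.
  rewrite [beval _ _]/(0 < ivar s vSP)%N hst /=; exists C; split=> // x.
  by rewrite andbT.
rewrite [beval _ _]/(0 < ivar s vSP)%N hst size_rcons /=.
apply: wp_conseq (wp_unlink hi) _ => t1 s1 [ht1 hi1].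
apply: wp_conseq (IH _ _ hi1) _ => t2 s2 [C' [hC' hi2 ht2]].
exists C'; split=> //.
  by move=> x; rewrite hC' /remove mem_rcons inE negb_or andbA.
by move: ht1 ht2; clear; nlia.
Qed.

End Loops.

(** * Selection of the cuts to be removed *)

Section Selection.
Variables (R : realType) (N : nat) (zf wf : nat -> R) (eps : R).
Implicit Types (s : state R) (C E : pred nat) (T : nat -> nat) (K : nat -> R).
Local Notation za C := (blk_mean N C zf).
Local Notation wa C := (blk_mean N C wf).
Local Notation ratio C c := ((za C c.-1 - za C c) / (wa C c.-1 - wa C c)).
Local Notation inv := (inv N zf wf eps).
Local Notation base := (base N zf wf eps).
Local Notation linked := (linked N).
Lemma wp_push v S C s c (Q : nat -> state R -> Prop) :
  inv C S s -> ivar s v = c -> (0 < c < N)%N -> C c -> c \notin S ->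
  (forall s', [/\ inv C (rcons S c) s', iarr s' aT = iarr s aT, rarr s' = rarr s,
     rvar s' = rvar s & forall u, u != vSP -> ivar s' u = ivar s u] -> Q 7%N s') ->
  wp (push v) s Q.
Proof.
move=> [[hC hb hl] hs [hst1 hst2] [ht1 ht2 ht3] [hu hS]] hv cN Cc cS hQ.
apply: wp_Seq; apply: wp_PutI; apply: wp_SetI; apply: hQ; split=> //; last first.
  by move=> u uSP /=; rewrite /upd (negPf uSP).
split=> //.
- split; first by rewrite /= /upd /= hst1 size_rcons addn1.
  move=> k; rewrite size_rcons ltnS /= /upd2 /upd /= hst1 hv nth_rcons => hk.
  by case: (ltngtP k (size S)) => // h; [rewrite hst2|nlia].
- split=> // d dN; have [h1 h2] := ht3 d dN; split=> // h3.
  by rewrite mem_rcons inE negb_or => /andP[_ /(h2 h3)].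
- split; first by rewrite rcons_uniq cS.
  by move=> d; rewrite mem_rcons inE => /orP[/eqP ->|/hS].
Qed.

(** The boundary [a] is stacked when the group on its left is negative as well, so the scan ends at
    the first position of the leftmost group of the negative run. Whether the stack has grown tells
    whether [b] differs from [a], which is how (f) and (g) are told apart later. *)
Lemma wp_scan lam S C s a :
  inv C S s -> rvar s rLAM = lam -> ivar s vA = a -> C a -> (a < N)%N ->
  (forall c, (c \in S) = C c && (a < c < N)%N) ->
  za C a - lam * wa C a < 0 ->
  wp scan s (fun t s' => exists S' b,
    [/\ [/\ inv C S' s', ivar s' vA = b & C b],
        [/\ (b <= a)%N, (b < a)%N -> (0 < size S')%N & (b == a) -> size S' = size S],
        forall c, (c \in S') = C c && (b < c < N)%N,
        za C b - lam * wa C b < 0 /\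
          ((0 < b)%N -> 0 <= za C b.-1 - lam * wa C b.-1)
      & (t + size S * 100 <= size S' * 100 + 60)%N]).
Proof.
elim/ltn_ind: a S s => a IH S s hi hlam ha Ca aN hS hneg.
have [[hC hb hl] hs hst ht hsub] := hi.
apply: wp_While; case: (posnP a) => [a0|a0].
  rewrite [beval _ _]/((0 < ivar s vA)%N && _) ha a0 /=.
  exists S, 0%N; rewrite -a0; split=> //; try by split=> //; rewrite a0.
  by nlia.
have hprv := @consec_end N C a hC Ca ltac:(nlia).
set p := blk_start C a.-1 in hprv; have [_ ep] := hl _ _ hprv; have lp := consec_le hprv.
have em f : blk_mean N C f a.-1 = mean f p a :> R.
  by rewrite (blk_mean_consec _ hC hprv) //; nlia.
have em' f : blk_mean N C f p = mean f p a :> R.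
  by rewrite (blk_mean_consec _ hC hprv) //; nlia.
have ez : reval s (emean aSZ (IGet aPV (IVar vA)) (IVar vA)) = mean zf p a.
  by apply: (reval_mean_z hb) => //=; rewrite ?ha ?ep //; nlia.
have ew : reval s (emean aSW (IGet aPV (IVar vA)) (IVar vA)) = mean wf p a.
  by apply: (reval_mean_w hb) => //=; rewrite ?ha ?ep //; nlia.
rewrite (_ : beval s _ = (0 < a)%N && (mean zf p a - lam * mean wf p a < 0)); last first.
  by rewrite -ez -ew -hlam -ha.
rewrite a0 /=; case: ifPn => hlt; last first.
  exists S, a; split=> //; try by split=> // _; rewrite ?em leNgt.
    by split=> //; rewrite ltnn.
  by nlia.
have aS : a \notin S by rewrite hS ltnn /= andbF.
have aN' : (0 < a < N)%N by rewrite a0.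
apply: wp_Seq; apply: (wp_push hi ha aN' Ca aS) => s1 [hi1 _ r1 rv1 iv1].
apply: wp_SetI; set s2 := set_ivar _ _ _.
have [[_ hb1 hl1] hs1 hst1 ht1 hsub1] := hi1.
have hi2 : inv C (rcons S a) s2 by split=> //; split=> //; apply: base_frame hb1.
have e2 : ivar s2 vA = p by rewrite /= /upd /= iv1 // ha; have [_ ->] := hl1 _ _ hprv.
have hpa : (p < a)%N by nlia.
have hpN : (p < N)%N by nlia.
have [Cp _ _ _ nC] := hprv.
apply: wp_conseq (IH p hpa (rcons S a) s2 hi2 _ e2 Cp hpN _ _) _.
- by rewrite /= rv1.
- move=> c; rewrite mem_rcons inE hS; case: (eqVneq c a) => [->|ca] /=; first by rewrite Ca hpa.
  case: (boolP (C c)) => //= Cc; apply/idP/idP => h; first by nlia.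
  by case: (ltnP a c) => h2; [nlia|]; have := nC c ltac:(nlia); rewrite Cc.
- by rewrite !em'.
move=> t s' [S' [b [[h1 h2 h3] [h4 h5 h6] h7 h8 h9]]]; exists S', b; split=> //.
  split; first by nlia.
    move=> _; rewrite lt0n; apply/eqP => e; case: S' e {h1 h5 h6 h9} h7 => // _ h7.
    by have := h7 a; rewrite in_nil Ca aN (leq_ltn_trans h4 hpa).
  by move=> /eqP e; nlia.
by move: h9; rewrite size_rcons /=; clear; nlia.
Qed.

Hypothesis N_gt0 : (0 < N)%N.

(** Bounds the number of iterations of [pop_small], each of which stacks a new cut. *)
Lemma subcuts_size C S : subcuts N C S -> (size S < N)%N.
Proof.
move=> [uS hS]; rewrite -(prednK N_gt0) ltnS.
rewrite -[X in (_ <= X)%N](size_iota 1 N.-1); apply: uniq_leq_size uS _ => c /hS [cN _].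
by rewrite mem_iota; nlia.
Qed.

Variable m : nat.
Hypothesis hm : (N + N <= 2 ^ m)%N.

(** Nothing is unlinked here, so the keys remain the ratios of the current pass while the leaves of
    the stacked cuts are emptied one after the other. *)
Lemma wp_pop_small lam S C s :
  inv C S s -> rvar s rLAM = lam ->
  (forall c, c \in S -> [/\ iarr s aT (N + c)%N = 0%N, wa C c.-1 != wa C c & ratio C c <= lam]) ->
  wp pop_small s (fun t s' => exists S',
    [/\ inv C S' s',
        forall c, (0 < c < N)%N -> C c ->
          (c \in S') = (wa C c.-1 != wa C c) && (ratio C c <= lam)
      & (t + size S * (40 * m + 70) <= size S' * (40 * m + 70) + 30)%N]).
Proof.
move: {2}(N - size S)%N (leqnn (N - size S)) => k.
elim: k S s => [|k IH] S s hk hi hlam hS.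
  by case: hi => _ _ _ _ /subcuts_size; nlia.
have [[hC hb hl] hs hst [ht1 ht2 ht3] hsub] := hi.
apply: wp_While; rewrite [beval _ _]/(_ && ~~ (_ < rarr s aK (iarr s aT 1%N))) /= hlam.
case: ifPn => [/andP[T1]|]; last first.
  rewrite negb_and !negbK => hstop; exists S; split=> //; last by nlia.
  move=> c cN Cc; apply/idP/idP => [/hS [_ -> ->] //|/andP[hw hr]].
  (* A cut that is not stacked and has a finite ratio still has its leaf. At the end of the loop
     either the tree is empty, which is absurd, or the ratio is at least the key at the root and
     hence exceeds [lam]. *)
  apply/negPn/negP => cS; have [_ /(_ Cc cS) [Tc Kc]] := ht3 c cN.
  rewrite (negPf hw) in Tc; case/orP: hstop => [/eqP T1|hlt].
    by have := tree_empty ht1 ht2 N_gt0 T1 (c := c) ltac:(nlia); nlia.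
  have T1 : iarr s aT 1%N != 0%N.
    apply/eqP => T1; have := tree_empty ht1 ht2 N_gt0 T1 (c := c) ltac:(nlia); nlia.
  have [_ _ /(_ c cN Tc)] := tree_min ht1 ht2 N_gt0 T1.
  by rewrite Kc // => /(lt_le_trans hlt); rewrite ltNge hr.
rewrite -leNgt => hle; have [cN Tc _] := tree_min ht1 ht2 N_gt0 T1.
apply: wp_Seq; apply: wp_SetI; set s1 := set_ivar _ _ _.
set c := iarr s aT 1%N in T1 hle cN Tc.
have v1 : ivar s1 vC = c by [].
have [n1 n2] := ht3 c cN.
have Cc : C c by apply/negPn/negP => /n1 e; rewrite e in Tc; rewrite -Tc in T1.
have cS : c \notin S by apply/negP => /hS [e _ _]; rewrite e in Tc; rewrite -Tc in T1.
have [l1 l2] := n2 Cc cS.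
have hw : wa C c.-1 != wa C c.
  by apply/negP => e; rewrite e Tc in l1; rewrite l1 in T1.
have hi1 : inv C S s1 by split=> //; split=> //; apply: base_frame hb.
apply: wp_Seq; apply: (wp_push hi1 v1 cN Cc cS) => s2 [hi2 t2 r2 rv2 iv2].
have [[_ hb2 hl2] hs2 hst2 [ht21 ht22 ht23] hsub2] := hi2.
have [hN2 _ _] := hb2.
have cN' : (c < N)%N by nlia.
apply: wp_frame; apply: wp_conseq (wp_clear_leaf hm (v := vC) hN2 (c := c) _ cN' _ ht22) _ => //.
  by rewrite iv2.
move=> t3 s3 [tm3 h3 z3 o3] [fi fa fv fr _].
have hi3 : inv C (rcons S c) s3.
  split=> //.
  - split=> //; first by apply: base_frame hb2; rewrite ?fi ?fv ?fr.
    by move=> a b /hl2; rewrite !fa.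
  - by case: hs2 => e1 e2; split; rewrite fv.
  - by case: hst2 => e1 e2; split; [rewrite fi|rewrite fa].
  split; rewrite ?fr //.
    move=> d dN; case: (eqVneq d c) => [->|dc]; first by left.
    by rewrite o3 //; apply: ht21.
  move=> d dN; have [g1 g2] := ht23 d dN; split=> [nC|Cd dS].
    case: (eqVneq d c) => [->//|dc]; by rewrite o3 // g1.
  have dc : d != c by apply: contraNneq dS => ->; rewrite mem_rcons mem_head.
  by have := g2 Cd dS; apply: leaf_ok_eq => //; rewrite o3.
apply: wp_conseq (IH _ _ _ hi3 _ _) _.
- by rewrite size_rcons; nlia.
- by rewrite fv // rv2.
- move=> d; rewrite mem_rcons inE => /orP[/eqP->|dS]; first by rewrite z3 hw -l2.
  have [g1 g2 g3] := hS _ dS; split=> //.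
  by rewrite o3 ?t2 //; apply: contraNneq cS => <-.
move=> t4 s4 [S' [h4 e4 tm4]]; exists S'; split=> //.
by move: tm3 tm4; rewrite size_rcons /=; clear; nlia.
Qed.

End Selection.

(** * One pass: the exit tests and the threshold of the simplex projection *)

Definition etau : rexp := RDiv (RSub (RGet aSZ (IVar vB)) (RVar rZ)) (RGet aRN (IVar vB)).

(** The averaged z is already sorted, so the support of the projection is an initial segment. [vB]
    is its supposed end and [rLAM] the resulting candidate for tau; the last group is given up as
    long as its mean is below the candidate. *)
Definition threshold_loop : cmd :=
  While (BAnd (BILt (IConst 0) (IVar vA))
              (BRLt (emean aSZ (IVar vA) (IVar vB)) (RVar rLAM)))
    (SetI vB (IVar vA) ;; SetI vA (IGet aPV (IVar vA)) ;; SetR rLAM etau).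

Definition threshold : cmd :=
  SetI vB (IVar vN) ;;
  SetI vA (IGet aPV (IVar vN)) ;;
  SetR rW (emean aSW (IConst 0) (IGet aNX (IConst 0))) ;;
  SetR rZ (RDiv (RVar rEPS) (RVar rW)) ;;
  SetR rLAM etau ;;
  threshold_loop ;;
  SetR rLAM (RDiv (RVar rLAM) (RVar rW)).

Definition eslope : rexp := RSub (RVar rZ) (RMul (RVar rL1) (RVar rW)).
Definition el0 : rexp :=
  RDiv (RSub (RSub (RVar rDOT) (RMul (RMul (RVar rZ) (RVar rW)) (ewidth (IVar vA) (IVar vN))))
             (RVar rEPS))
       (RSub (RVar rWW) (RMul (RMul (RVar rW) (RVar rW)) (ewidth (IVar vA) (IVar vN)))).
Definition stop : cmd := SetI vRUN (IConst 0).

Definition test_last : cmd :=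
  SetI vA (IGet aPV (IVar vN)) ;;
  SetR rZ (emean aSZ (IVar vA) (IVar vN)) ;;
  SetR rW (emean aSW (IVar vA) (IVar vN)) ;;
  If (BNot (BRLt eslope RZero))
    (EmitI (IConst 3) ;; EmitR (RVar rR) ;; EmitR (RVar rL1) ;; SetR rLAM (RVar rL1) ;; stop)
    (SetR rL0 el0 ;; SetR rLAM (RVar rL0) ;;
     If (BRLt (RVar rR) (RVar rL0))
       (EmitI (IConst 4) ;; EmitR (RVar rR) ;; EmitR (RVar rL1) ;; EmitR (RVar rL0) ;; pop_small)
       (scan ;;
        If (BIEq (IVar vSP) (IConst 0))
          (EmitI (IConst 5) ;; EmitR (RVar rR) ;; EmitR (RVar rL1) ;; EmitR (RVar rL0) ;;
           EmitI (IVar vA) ;; stop)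
          (EmitI (IConst 6) ;; EmitR (RVar rR) ;; EmitR (RVar rL1) ;; EmitR (RVar rL0) ;;
           EmitI (IVar vA)))).

Definition tests : cmd :=
  If (BNot (BRLt (RVar rEPS) (RVar rDOT)))
    (EmitI (IConst 0) ;; SetR rLAM RZero ;; stop)
    (If (BIEq (IGet aT (IConst 1)) (IConst 0))
      (EmitI (IConst 1) ;; threshold ;; stop)
      (SetR rR (RGet aK (IGet aT (IConst 1))) ;;
       SetR rL1 (RDiv (RSub (RVar rDOT) (RVar rEPS)) (RVar rWW)) ;;
       If (BRLt (RVar rR) (RVar rL1))
         (EmitI (IConst 2) ;; EmitR (RVar rR) ;; EmitR (RVar rL1) ;;
          SetR rLAM (RVar rL1) ;; pop_small)
         test_last)).

Section Pass.
Variables (R : realType) (n : nat) (z w : 'rV[R]_n.+1) (eps : R).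
Hypotheses (hz : in_T z) (hw : in_T w) (eps_gt0 : 0 < eps).
Local Notation N := n.+1.
Implicit Types (s : state R) (C : pred nat).
Local Notation zf := (vec_arr z).
Local Notation wf := (vec_arr w).
Local Notation za C := (blk_mean N C zf).
Local Notation wa C := (blk_mean N C wf).
Local Notation ratio C c := ((za C c.-1 - za C c) / (wa C c.-1 - wa C c)).
Local Notation total f g := (\sum_(0 <= i < N) f i * g i).
Local Notation inv := (inv N zf wf eps).
Local Notation base := (base N zf wf eps).
Local Notation linked := (linked N).
Definition strict C : Prop := forall c, (0 < c < N)%N -> C c -> zf c < zf c.-1.

Definition ready C s : Prop := [/\ cutset N C, base s & linked C s].

(** The candidate only grows, so groups once given up stay below it. Each iteration moves [b]
    strictly to the left, which makes the search linear; it happens only in a pass that exits. *)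
Lemma wp_threshold_loop C (kappa : R) (tau := fun b : nat => (psum zf b - kappa) / b%:R)
    b a s : 0 < kappa -> ready C s -> consec N C a b ->
  ivar s vA = a -> ivar s vB = b -> rvar s rZ = kappa -> rvar s rLAM = tau b ->
  (forall i, (b <= i < N)%N -> za C i <= tau b) ->
  wp threshold_loop s (fun t s' => exists b',
    [/\ C b' /\ (0 < b' <= N)%N, rvar s' rLAM = tau b',
        forall i, (i < b')%N -> tau b' <= za C i,
        forall i, (b' <= i < N)%N -> za C i <= tau b'
      & (t <= b * 60 + 60)%N]).
Proof.
move=> k0; elim/ltn_ind: b a s => b IH a s [hC hb hl] hab hA hB hZ hL hhi.
have lab := consec_le hab; have [Ca Cb _ _ _] := hab.
have hzn : noninc N (za C) by apply: blk_mean_noninc => //; exact: noninc_vec_arr.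
have ez : reval s (emean aSZ (IVar vA) (IVar vB)) = mean zf a b.
  by apply: (reval_mean_z hb) => //; nlia.
apply: wp_While.
rewrite (_ : beval s _ = (0 < a)%N && (mean zf a b < tau b)); last first.
  by rewrite -ez -hL -hA.
have b0 : 0 < b%:R :> R by rewrite ltr0n; nlia.
case: ifPn => [/andP[a0 hlt]|hstop]; last first.
  exists b; split=> //; [by split=> //; nlia| |by rewrite /=; nlia].
  move=> i ib; apply: le_trans (hzn i b.-1 ltac:(nlia)).
  rewrite (blk_mean_consec _ hC hab); last by nlia.
  move: hstop; rewrite negb_and -leNgt => /orP[a0|//].
  (* If only the first group is left, its mean psum b / b is at least tau b because kappa is
     positive. *)
  have ea : a = 0%N by nlia.
  rewrite ea /mean /tau [psum _ 0]/psum big_geq // !subr0.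
  by rewrite ler_pM2r ?invr_gt0 // gerBl ltW.
have a0' : 0 < a%:R :> R by rewrite ltr0n.
(* b * tau b is the sum of a * tau a and (b - a) times the mean of the last group. As this mean lies
   below tau b, tau a lies above it. *)
have hta : tau b < tau a.
  have h1 : (b%:R - a%:R) * mean zf a b = psum zf b - psum zf a by apply: mean_mul; nlia.
  have h2 : 0 < b%:R - a%:R :> R by apply: natrB_gt0; nlia.
  have h3 : tau b * b%:R = psum zf b - kappa by rewrite divfK // gt_eqF.
  rewrite [X in _ < X]/tau ltr_pdivlMr //.
  have : (b%:R - a%:R) * mean zf a b < (b%:R - a%:R) * tau b by rewrite ltr_pM2l.
  by move: h1 h3; move: (tau b) (mean zf a b) (psum zf a) (psum zf b) => t1 t2 t3 t4; lra.
have hprv := @consec_end N C a hC Ca ltac:(nlia).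
have [_ ep] := hl _ _ hprv.
apply: wp_Seq; apply: wp_SetI; apply: wp_Seq; apply: wp_SetI; apply: wp_SetR.
set s3 := set_rvar _ _ _.
have e3 : rvar s3 rLAM = tau a.
  have [_ _ /(_ a ltac:(nlia)) [g1 _ g2]] := hb.
  by rewrite /s3 /= /upd /= hA hZ g1 g2.
have r3 : ready C s3 by split=> //; apply: base_frame hb.
apply: wp_conseq (IH a _ _ s3 r3 hprv _ _ hZ e3 _) _ => //; first by nlia.
- by rewrite /s3 /= /upd /= hA.
- move=> i hi; case: (leqP b i) => bi.
    by apply: le_trans (ltW hta); apply: hhi; nlia.
  by rewrite (blk_mean_consec _ hC hab) ?(ltW (lt_trans hlt hta)) //; nlia.
move=> t s' [b' [h1 h2 h3 h4 h5]]; exists b'; split=> //.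
by move: h5 lab; rewrite /=; clear; nlia.
Qed.

Lemma wp_threshold C s : ready C s -> 0 < wa C 0 ->
  wp threshold s (fun t s' => exists b tau,
    [/\ C b /\ (0 < b <= N)%N, tau = (psum zf b - eps / wa C 0) / b%:R /\
        rvar s' rLAM = tau / wa C 0,
        forall i, (i < b)%N -> tau <= za C i,
        forall i, (b <= i < N)%N -> za C i <= tau
      & (t <= N * 60 + 120)%N]).
Proof.
move=> [hC hb hl] w0; have [hN he hsum] := hb; have /andP[C0 CN] := hC.
have h0 := consec_start hC C0 (ltn0Sn n); have [e0 _] := hl _ _ h0.
have hlast := @consec_end N C N hC CN ltac:(nlia); have [_ e1] := hl _ _ hlast.
have l0 := consec_le h0.
rewrite /threshold; do 2 (apply: wp_Seq; apply: wp_SetI).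
do 3 (apply: wp_Seq; apply: wp_SetR).
set s5 := set_rvar _ rLAM _.
have ew : rvar s5 rW = wa C 0.
  rewrite (blk_mean_consec _ hC h0) //.
  have <- : reval s (emean aSW (IConst 0) (IGet aNX (IConst 0))) = mean wf 0 (blk_end N C 0).
    by apply: (reval_mean_w hb) => //; nlia.
  by [].
have ez : rvar s5 rZ = eps / wa C 0.
  by rewrite -ew -he.
have el : rvar s5 rLAM = (psum zf N - eps / wa C 0) / N%:R.
  have [g1 _ g2] := hsum N (leqnn N); rewrite -g1 -g2 -ez /=.
  by rewrite /upd /= hN.
have k0 : 0 < eps / wa C 0 by rewrite divr_gt0.
have r5 : ready C s5 by split=> //; apply: base_frame hb.
apply: wp_Seq; apply: wp_frame; apply: wp_conseq (wp_threshold_loop k0 r5 hlast _ _ ez el _) _ => //.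
- by rewrite /s5 /= /upd /= hN e1.
- by move=> i hi; nlia.
move=> t s' [b [h1 h2 h3 h4 h5]] [_ _ fv _ _]; apply: wp_SetR.
exists b; eexists; split; [exact: h1| |exact: h3|exact: h4|].
  by split=> //; rewrite /= /upd /= h2 fv // ew.
by move: h5; rewrite /=; clear; nlia.
Qed.

Lemma root_best C s : inv C [::] s -> iarr s aT 1%N != 0%N ->
  best z w C (iarr s aT 1%N) /\
  rarr s aK (iarr s aT 1%N) = ratio C (iarr s aT 1%N).
Proof.
move=> [_ _ _ [ht1 ht2 ht3] _] T1; have [cN Tc hmin] := tree_min ht1 ht2 (ltn0Sn n) T1.
set c := iarr s aT 1%N in T1 cN Tc hmin *.
have [n1 n2] := ht3 c cN.
have Cc : C c by apply/negPn/negP => /n1 e; rewrite e in Tc; rewrite -Tc in T1.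
have [g1 g2] := n2 Cc isT.
have hwc : wa C c.-1 != wa C c.
  by apply/negP => e; rewrite e Tc in g1; rewrite g1 in T1.
split; last exact: g2.
split=> // d dN Cd hwd; have [_ /(_ Cd isT) [k1 k2]] := ht3 d dN.
by rewrite -(g2 hwc) -(k2 hwd); apply: hmin => //; rewrite k1 (negPf hwd).
Qed.

Lemma root_empty C s : inv C [::] s -> iarr s aT 1%N = 0%N ->
  forall c, (0 < c < N)%N -> C c -> wa C c.-1 = wa C c.
Proof.
move=> [_ _ _ [ht1 ht2 ht3] _] T1 c cN Cc; apply/eqP/negPn/negP => hwc.
have [_ /(_ Cc isT) [k1 _]] := ht3 c cN.
have := tree_empty ht1 ht2 (ltn0Sn n) T1 (c := c) ltac:(nlia).
by rewrite k1 (negPf hwc); nlia.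
Qed.

Definition without C (S : seq nat) : pred nat := fun x => C x && (x \notin S).

Lemma cutset_without C S : cutset N C -> subcuts N C S -> cutset N (without C S).
Proof.
move=> /andP[C0 CN] [_ hS]; rewrite /cutset /without C0 CN /=.
by apply/andP; split; apply/negP => /hS []; nlia.
Qed.

(* First case: the pass exits.  Second case: it stacks the cuts [S], whose removal by the next
   pass is charged, together with this pass, to the [size S > 0] cuts that disappear. *)
Definition pass_post C s (F P : nat) (t : nat) (s' : state R) : Prop :=
  (exists h lam, [/\ ivar s' vRUN = 0%N, output s' = output s ++ h, rvar s' rLAM = lam,
      ready C s' /\ (t <= F)%N & runA eps (avgrow C z) (avgrow C w) h (final z w C lam)]) \/
  (exists S h, [/\ ivar s' vRUN = ivar s vRUN /\ inv C S s', output s' = output s ++ h,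
      (0 < size S)%N, (t <= size S * P)%N
    & forall h' x, runA eps (avgrow (without C S) z) (avgrow (without C S) w) h' x ->
        runA eps (avgrow C z) (avgrow C w) (h ++ h') x]).

Lemma inv_ready C S s : inv C S s -> ready C s.
Proof. by case. Qed.

Lemma without_popped C S lam : subcuts N C S ->
  (forall c, (0 < c < N)%N -> C c ->
     (c \in S) = (wa C c.-1 != wa C c) && (ratio C c <= lam)) ->
  forall c, (0 < c < N)%N ->
    without C S c = C c && ~~ ((wa C c.-1 != wa C c) && (ratio C c <= lam)).
Proof. by move=> hS h c cN; rewrite /without; case: (boolP (C c)) => //= Cc; rewrite h. Qed.

Variable m : nat.
Hypothesis hm : (N + N <= 2 ^ m)%N.

(** Shared by (c) and (e), which differ in lambda and in the emitted tokens; the rule of Algorithm A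
    enters as the last hypothesis. [sb] is the state with respect to which the pass is described,
    and [k] allows for operations spent before the popping. *)
Lemma wp_pop_pass C s c0 lam h0 sb k : inv C [::] s -> best z w C c0 ->
  rvar s rLAM = lam -> ratio C c0 < lam ->
  ivar s vRUN = ivar sb vRUN -> output s = output sb ++ h0 -> (k <= 200)%N ->
  (forall D h' x, cutset N D ->
     (forall c, (0 < c < N)%N ->
        D c = C c && ~~ ((wa C c.-1 != wa C c) && (ratio C c <= lam))) ->
     runA eps (avgrow D z) (avgrow D w) h' x ->
     runA eps (avgrow C z) (avgrow C w) (h0 ++ h') x) ->
  wp pop_small s (fun t s' =>
    pass_post C sb (N * 60 + 400) (40 * m + 400) (k + t) s').
Proof.
move=> hi hbest hlam hr hrun hout hk hA.
apply: wp_frame; apply: wp_conseq (wp_pop_small (ltn0Sn n) hm hi hlam _) _ => //.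
move=> t s' [S [hi' hS ht]] [fi _ _ _ fo]; right; exists S, h0.
have [c0N Cc0 hw0 _] := hbest.
(* The cut that attains r is among the stacked ones, because r < lam. *)
have Spos : (0 < size S)%N.
  by have := hS c0 c0N Cc0; rewrite hw0 (ltW hr) => /=; case: (S).
have hsub : subcuts N C S by case: hi'.
have hC : cutset N C by case: (inv_ready hi).
split=> //.
- by rewrite fi.
- by rewrite fo.
- have hmul : (40 * m + 400 + (size S).-1 * (40 * m + 400) = size S * (40 * m + 400))%N.
    by rewrite -{2}(prednK Spos) mulSn.
  have hmul2 : (40 * m + 70 + (size S).-1 * (40 * m + 70) = size S * (40 * m + 70))%N.
    by rewrite -{2}(prednK Spos) mulSn.
  have : ((size S).-1 * (40 * m + 70) <= (size S).-1 * (40 * m + 400))%N by rewrite leq_mul2l; nlia.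
  by move: ht hk hmul hmul2; rewrite /= mul0n; clear; nlia.
- move=> h' x; apply: hA; first exact: cutset_without.
  exact: without_popped.
Qed.

Lemma wp_test_last C s c0 sb k : strict C -> inv C [::] s -> best z w C c0 ->
  eps < total (za C) (wa C) -> rvar s rR = ratio C c0 -> rvar s rL1 = l1 z w eps C ->
  l1 z w eps C <= ratio C c0 ->
  ivar s vRUN = ivar sb vRUN -> output s = output sb -> (k <= 60)%N ->
  wp test_last s (fun t s' => pass_post C sb (N * 60 + 400) (40 * m + 400) (k + t) s').
Proof.
move=> hst hi hbest he hR hL1 hl1 hrun hout hk.
have [[hC hb hl] [hD hW] hstk htree hsub] := hi; have [hN heps _] := hb.
have /andP[_ CN] := hC.
have hlast := @consec_end N C N hC CN ltac:(nlia).
set a := blk_start C N.-1 in hlast; have [_ ea] := hl _ _ hlast; have la := consec_le hlast.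
have [Ca _ _ _ nCa] := hlast.
apply: wp_Seq; apply: wp_SetI; set s1 := set_ivar _ _ _.
have v1 : ivar s1 vA = a by rewrite /s1 /= /upd /= hN ea.
have b1 : base s1 by apply: base_frame hb.
apply: wp_Seq; apply: wp_SetR; apply: wp_Seq; apply: wp_SetR.
set s3 := set_rvar _ _ _.
have ez : rvar s3 rZ = za C n.
  rewrite (blk_mean_consec _ hC hlast); last by nlia.
  rewrite -(@reval_mean_z _ _ _ _ _ s1 (IVar vA) (IVar vN) a N b1 v1 hN) //; nlia.
have ew : rvar s3 rW = wa C n.
  rewrite (blk_mean_consec _ hC hlast); last by nlia.
  by rewrite -(@reval_mean_w _ _ _ _ _ s1 (IVar vA) (IVar vN) a N b1 v1 hN) //; nlia.
have i3 : inv C [::] s3 by [].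
have b3 : base s3 by [].
have [o3 ru3 v3] : [/\ output s3 = output s, ivar s3 vRUN = ivar s vRUN & ivar s3 vA = a] by [].
have [R3 L3 N3] : [/\ rvar s3 rR = ratio C c0, rvar s3 rL1 = l1 z w eps C & ivar s3 vN = N] by [].
have [D3 W3 E3] : [/\ rvar s3 rDOT = rvar s rDOT, rvar s3 rWW = rvar s rWW & rvar s3 rEPS = rvar s rEPS] by [].
move: {+}s3 ez ew i3 b3 o3 ru3 v3 R3 L3 N3 D3 W3 E3 => {s1 v1 b1}s3 ez ew i3 b3 o3 ru3 v3 R3 L3 N3 D3 W3 E3.
apply: wp_If.
rewrite (_ : beval s3 _ = ~~ (za C n - l1 z w eps C * wa C n < 0)); last first.
  by rewrite -ez -ew -L3.
case: ifPn => hneg.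
  do 3 (apply: wp_Seq; (apply: wp_EmitI || apply: wp_EmitR)).
  apply: wp_Seq; apply: wp_SetR; apply: wp_SetI; left.
  exists [:: inl 3%N; inr (ratio C c0); inr (l1 z w eps C)], (l1 z w eps C); split=> //.
  - by rewrite /= R3 L3 o3 hout -!cats1 -!catA.
  - by split; [exact: (inv_ready i3)|move: hk; rewrite /=; clear; nlia].
  - by apply: run_d => //; rewrite leNgt.
rewrite negbK in hneg.
apply: wp_Seq; apply: wp_SetR; set s4 := set_rvar _ _ _.
have el0 : rvar s4 rL0 = l0 z w eps C a.
  have ewd : reval s3 (ewidth (IVar vA) (IVar vN)) = N%:R - a%:R.
    by apply: (reval_width (a := IVar vA) (b := IVar vN) b3 v3 N3); nlia.
  rewrite /l0 -ez -ew -ewd -hD -hW -D3 -W3 -heps -E3.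
  by [].
apply: wp_Seq; apply: wp_SetR; set s5 := set_rvar _ _ _.
have lam5 : rvar s5 rLAM = l0 z w eps C a by [].
have [R5 L5 L05] : [/\ rvar s5 rR = ratio C c0, rvar s5 rL1 = l1 z w eps C & rvar s5 rL0 = l0 z w eps C a] by [].
have i5 : inv C [::] s5 by exact: i3.
have [o5 ru5 v5] : [/\ output s5 = output s, ivar s5 vRUN = ivar s vRUN & ivar s5 vA = a] by [].
move: {+}s5 lam5 R5 L5 L05 i5 o5 ru5 v5 => {s4 el0}s5 lam5 R5 L5 L05 i5 o5 ru5 v5.
apply: wp_If.
rewrite (_ : beval s5 _ = (ratio C c0 < l0 z w eps C a)); last by rewrite -R5 -L05.
case: ifPn => hr0.
  do 4 (apply: wp_Seq; (apply: wp_EmitI || apply: wp_EmitR)).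
  set s9 := emit _ _.
  have i9 : inv C [::] s9 by exact: i5.
  have e9 : output s9 = output sb ++ [:: inl 4%N; inr (ratio C c0); inr (l1 z w eps C); inr (l0 z w eps C a)].
    by rewrite /s9 /= R5 L5 L05 o5 hout -!cats1 -!catA.
  apply: wp_conseq (wp_pop_pass (lam := l0 z w eps C a) (k := 180) i9 hbest _ hr0 _ e9 _ _) _ => //.
  - by rewrite /s9 /= ru5.
  - by move=> D h' x hD' hDC hrun'; exact: (run_e hz hw hC hst hlast he hbest hl1 hneg hr0 hD' hDC hrun').
  move=> t s' [[h [lam [g1 g2 g3 [g4 g4'] g5]]]|[S [h [g1 g2 g3 g4 g5]]]].
    left; exists h, lam; split=> //; split=> //.
    by move: g4' hk; rewrite /=; clear; nlia.
  right; exists S, h; split=> //.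
  by move: g4 hk; rewrite /=; clear; nlia.
rewrite -leNgt in hr0.
have hslope : noninc N (fun i => za C i - l0 z w eps C a * wa C i).
  by apply: slope_noninc => //; apply: le_all_ratios hr0.
have hn := neg_last hw hC hlast hbest hneg.
have aN : (a < N)%N by nlia.
have hna : za C a - l0 z w eps C a * wa C a < 0.
  by move: hn; rewrite !(blk_mean_consec _ hC hlast (i := n)) ?(blk_mean_consec _ hC hlast (i := a)) //; nlia.
apply: wp_Seq; apply: wp_frame.
apply: wp_conseq (wp_scan i5 lam5 v5 Ca aN _ hna) _.
  move=> c; rewrite in_nil; case: (boolP (C c)) => //= Cc; apply/esym/negP => hc.
  by have := nCa c hc; rewrite Cc.
move=> t6 s6 [S [b [[i6 v6 Cb] [ba hpos hsz] hS [hb1 hb2] tm6]]] [fi6 _ fv6 _ fo6].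
(* z - lambda_0 w is nonincreasing, negative at [b] and nonnegative just before it, so its sign
   changes exactly at [b], which is therefore n'. *)
have hnegk k' : (k' < N)%N -> (za C k' - l0 z w eps C a * wa C k' < 0) = (b <= k')%N.
  move=> kN; apply/idP/idP => hk'.
    rewrite leqNgt; apply/negP => kb; move: hk'; rewrite ltNge => /negP; apply.
    by apply: le_trans (hb2 _) (hslope k' b.-1 _); nlia.
  by apply: le_lt_trans (hslope b k' _) hb1; rewrite hk'.
have [stS _] : stack S s6 by case: i6.
have R6 : rvar s6 rR = ratio C c0 by rewrite fv6.
have L6 : rvar s6 rL1 = l1 z w eps C by rewrite fv6.
have L06 : rvar s6 rL0 = l0 z w eps C a by rewrite fv6.
have o6 : output s6 = output sb by rewrite fo6 // o5.
apply: wp_If; rewrite (_ : beval s6 _ = (size S == 0%N)); last by rewrite -stS.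
case: ifPn => hS0.
  (* An empty stack means that only the last group is negative, so that z_{n'} = z_n. *)
  have eb : b = a.
    by apply/eqP; rewrite eqn_leq ba leqNgt; apply/negP => /hpos; rewrite (eqP hS0).
  rewrite eb in v6 hnegk.
  do 5 (apply: wp_Seq; (apply: wp_EmitI || apply: wp_EmitR)).
  apply: wp_SetI; left.
  exists [:: inl 5%N; inr (ratio C c0); inr (l1 z w eps C); inr (l0 z w eps C a); inl a], (l0 z w eps C a).
  split=> //.
  - by rewrite /= R6 L6 L06 v6 o6 -!cats1 -!catA.
  - by rewrite /= fv6.
  - split; first exact: (inv_ready i6).
    by move: tm6 hk; rewrite (eqP hS0) /=; clear; nlia.
  - exact: run_f.
have ba' : (b < a)%N.
  by rewrite ltn_neqAle ba andbT; apply: contra hS0 => /hsz ->.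
have Spos : (0 < size S)%N by rewrite lt0n.
do 4 (apply: wp_Seq; (apply: wp_EmitI || apply: wp_EmitR)); apply: wp_EmitI; right.
exists S, [:: inl 6%N; inr (ratio C c0); inr (l1 z w eps C); inr (l0 z w eps C a); inl b].
have hsubS : subcuts N C S by case: i6.
split=> //.
- by split; [rewrite /= fi6 // ru5|exact: i6].
- by rewrite /= R6 L6 L06 v6 o6 -!cats1 -!catA.
- have hmul : (40 * m + 400 + (size S).-1 * (40 * m + 400) = size S * (40 * m + 400))%N.
    by rewrite -{2}(prednK Spos) mulSn.
  have : ((size S).-1 * 100 <= (size S).-1 * (40 * m + 400))%N by rewrite leq_mul2l; nlia.
  by move: tm6 hk hmul Spos; rewrite /=; clear; nlia.
- move=> h' x; apply: (run_g hz hC hst hlast he hbest hl1 hneg hr0 Cb ba' hnegk).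
    exact: cutset_without.
  move=> c cN; rewrite /without hS; case: (boolP (C c)) => //= Cc; nlia.
Qed.

End Pass.

(** * Output of the result, and the amortized cost of the main loop *)

Definition main_loop : cmd := While (BILt (IConst 0) (IVar vRUN)) (unlink_all ;; tests).

Definition emit_coordinate : cmd :=
  If (BIEq (IVar vI) (IVar vB))
    (SetI vA (IVar vB) ;; SetI vB (IGet aNX (IVar vA)) ;;
     SetR rZ (RSub (emean aSZ (IVar vA) (IVar vB))
                   (RMul (RVar rLAM) (emean aSW (IVar vA) (IVar vB)))))
    Skip ;;
  If (BRLt (RVar rZ) RZero) (EmitR RZero) (EmitR (RVar rZ)) ;;
  SetI vI (IAdd (IVar vI) (IConst 1)).

Definition emit_final : cmd :=
  SetI vI (IConst 0) ;; SetI vB (IConst 0) ;;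
  While (BILt (IVar vI) (IVar vN)) emit_coordinate.

Section Main.
Variables (R : realType) (n : nat) (z w : 'rV[R]_n.+1) (eps : R).
Local Notation N := n.+1.
Implicit Types (s : state R) (C : pred nat).
Local Notation zf := (vec_arr z).
Local Notation wf := (vec_arr w).
Local Notation za C := (blk_mean N C zf).
Local Notation wa C := (blk_mean N C wf).
Local Notation ratio C c := ((za C c.-1 - za C c) / (wa C c.-1 - wa C c)).
Local Notation total f g := (\sum_(0 <= i < N) f i * g i).
Local Notation inv := (inv N zf wf eps).
Local Notation base := (base N zf wf eps).
Local Notation linked := (linked N).
Local Notation strict := (strict z).
Local Notation ready := (ready z w eps).
Local Notation pass_post := (pass_post z w eps).
Definition coordinates (x : 'rV[R]_N) : seq (token R) := [seq inr (x 0 i) | i <- enum 'I_N].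

(** Strictly inside a group, [rZ] holds the common value of that group before truncation. When [i]
    equals [vB] nothing is known of [rZ], and the next iteration loads it for the group that begins
    at [i]; starting with [vB] at 0 puts the first coordinate in this situation. *)
Lemma wp_emit_loop C lam s a k i : ready C s -> rvar s rLAM = lam ->
  ivar s vI = i -> (i <= N)%N -> (N - i <= k)%N ->
  (i <= ivar s vB)%N -> C (ivar s vB) ->
  ((i < ivar s vB)%N -> consec N C a (ivar s vB) /\ (a <= i)%N /\
     rvar s rZ = mean zf a (ivar s vB) - lam * mean wf a (ivar s vB)) ->
  wp (While (BILt (IVar vI) (IVar vN)) emit_coordinate) s (fun t s' =>
    output s' = output s ++
      [seq inr (Num.max (za C j - lam * wa C j) 0) | j <- iota i (N - i)] /\
    (t <= (N - i) * 100 + 10)%N).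
Proof.
elim: k a i s => [|k IH] a i s hrd hlam hI iN hk iB CB hab;
  have [hC hb hl] := hrd; have [hN _ hsum] := hb; apply: wp_While;
  (rewrite (_ : beval s _ = (i < N)%N); last by rewrite -hI -[N in RHS]hN).
  have -> : (N - i = 0)%N by nlia.
  by case: ifPn => [|_]; [nlia|rewrite /= cats0].
case: ifPn => [iltN|]; last first.
  rewrite -leqNgt => Ni; have -> : (N - i = 0)%N by nlia.
  by rewrite /= cats0.
apply: wp_Seq; apply: wp_If.
rewrite (_ : beval s _ = (i == ivar s vB)); last by rewrite -hI.
pose Q1 (t : nat) s' := exists a', [/\ (t <= 60)%N /\ ready C s', rvar s' rLAM = lam, ivar s' vI = i,
  [/\ consec N C a' (ivar s' vB), (a' <= i < ivar s' vB)%N &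
     rvar s' rZ = mean zf a' (ivar s' vB) - lam * mean wf a' (ivar s' vB)] & output s' = output s].
suff tail t1 s1 : Q1 t1 s1 -> wp (If (BRLt (RVar rZ) RZero) (EmitR RZero) (EmitR (RVar rZ)) ;;
    SetI vI (IAdd (IVar vI) (IConst 1))) s1 (fun t2 s2 =>
      wp (While (BILt (IVar vI) (IVar vN)) emit_coordinate) s2 (fun t3 s3 =>
       output s3 = output s ++ [seq inr (Num.max (za C j - lam * wa C j) 0) | j <- iota i (N - i)] /\
       (3 + (t1 + t2) + t3 < (N - i) * 100 + 10)%N)).
  case: ifPn => [/eqP eB|neB].
    have CI : C i by rewrite eB.
    have hc := consec_start hC CI iltN; have [e1 e2] := hl _ _ hc; have lc := consec_le hc.
    do 2 (apply: wp_Seq; apply: wp_SetI); apply: wp_SetR.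
    set s3 := set_rvar _ _ _; apply: (tail _ s3).
    have vb : ivar s3 vB = blk_end N C i by rewrite /s3 /= /upd /= -eB e1.
    pose s2 := set_ivar (set_ivar s vA (ivar s vB)) vB (iarr s aNX (ivar s vB)).
    have b2 : base s2 by apply: base_frame hb.
    have va2 : ieval s2 (IVar vA) = i by rewrite /= /upd /= -eB.
    have vb2 : ieval s2 (IVar vB) = blk_end N C i by rewrite /= /upd /= -eB e1.
    exists i; rewrite vb; split=> //; split=> //; first by nlia.
    rewrite -(reval_mean_z b2 va2 vb2) -?(reval_mean_w b2 va2 vb2) -?hlam //; nlia.
  have lt : (i < ivar s vB)%N by rewrite ltn_neqAle neB iB.
  have [h1 [h2 h3]] := hab lt.
  apply: wp_Skip; apply: tail; exists a; split=> //.
  by split=> //; rewrite h2.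
move=> [a' [[ht1 rd1] lam1 i1 [c1 ab1 z1] o1]].
have [_ b1 _] := rd1; have [N1 _ _] := b1.
have eZ : za C i - lam * wa C i = rvar s1 rZ by rewrite z1 !(blk_mean_consec _ hC c1).
have step s2 t2 : ivar s2 = upd (ivar s1) vI i.+1 -> iarr s2 = iarr s1 -> rvar s2 = rvar s1 ->
    rarr s2 = rarr s1 -> output s2 = output s ++ [:: inr (Num.max (za C i - lam * wa C i) 0)] ->
    (t2 <= 20)%N ->
    wp (While (BILt (IVar vI) (IVar vN)) emit_coordinate) s2 (fun t3 s3 =>
       output s3 = output s ++ [seq inr (Num.max (za C j - lam * wa C j) 0) | j <- iota i (N - i)] /\
       (3 + (t1 + t2) + t3 < (N - i) * 100 + 10)%N).
  move=> ei ea er era eo ht2.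
  have eB : ivar s2 vB = ivar s1 vB by rewrite ei.
  have rd2 : ready C s2.
    split=> //; first by apply: base_frame b1; rewrite ?ei ?er ?era.
    by case: rd1 => _ _ hl1 x y /hl1; rewrite ea.
  apply: wp_conseq (IH a' i.+1 s2 rd2 _ _ iltN _ _ _ _) _; rewrite ?eB ?er ?ei //.
  - by nlia.
  - by case/andP: ab1.
  - by case: c1.
  - by move=> h; split=> //; split=> //; nlia.
  move=> t3 s3 [o3 ht3]; split; last first.
    by move: ht1 ht2 ht3 iltN; clear; nlia.
  rewrite o3 eo -catA; congr (_ ++ _).
  by have -> : (N - i = (N - i.+1).+1)%N by nlia.
apply: wp_Seq; apply: wp_If; rewrite [beval _ _]/(rvar s1 rZ < 0).
case: ifPn => hneg; apply: wp_EmitR; apply: wp_SetI; apply: step => //=.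
- by rewrite i1 addn1.
- by rewrite o1 -cats1 eZ max_r // ltW.
- by rewrite i1 addn1.
- by rewrite o1 -cats1 eZ max_l // leNgt.
Qed.

Lemma wp_emit_final C lam s : ready C s -> rvar s rLAM = lam ->
  wp emit_final s (fun t s' => output s' = output s ++ coordinates (final z w C lam) /\
    (t <= N * 100 + 20)%N).
Proof.
move=> [hC hb hl] hlam; do 2 (apply: wp_Seq; apply: wp_SetI); set s2 := set_ivar _ _ _.
have rd2 : ready C s2 by split=> //; apply: base_frame hb.
have /andP[C0 _] := hC.
apply: wp_conseq (wp_emit_loop (a := 0) (k := N) (i := 0) rd2 hlam _ _ _ _ _ _) _ => //.
move=> t s' [ho ht]; split; last by move: ht; rewrite subn0 /=; clear; nlia.
rewrite ho subn0 /coordinates; congr (_ ++ _).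
rewrite -val_enum_ord -map_comp; apply: eq_map => i /=.
by rewrite mxE.
Qed.

Hypotheses (hz : in_T z) (hw : in_T w) (eps_gt0 : 0 < eps).
Variable m : nat.
Hypothesis hm : (N + N <= 2 ^ m)%N.

Lemma wp_tests C s : strict C -> inv C [::] s ->
  wp tests s (fun t s' => pass_post C s (N * 60 + 500) (40 * m + 500) t s').
Proof.
move=> hst hi.
have [[hC hb hl] [hD hW] hstk htree hsub] := hi; have [hN heps _] := hb.
apply: wp_If; rewrite (_ : beval s _ = ~~ (eps < total (za C) (wa C))); last first.
  by rewrite -heps -hD.
case: ifPn => [he|].
  apply: wp_Seq; apply: wp_EmitI; apply: wp_Seq; apply: wp_SetR; apply: wp_SetI; left.
  exists [:: inl 0%N], 0; split=> //.
  - by rewrite /= -cats1.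
  - by apply: run_a => //; rewrite leNgt.
rewrite negbK => he.
apply: wp_If; rewrite (_ : beval s _ = (iarr s aT 1%N == 0%N)) //.
case: ifPn => [/eqP T1|T1].
  have hcut := root_empty hi T1.
  apply: wp_Seq; apply: wp_EmitI; set s1 := emit _ _.
  have i1 : inv C [::] s1 by exact: hi.
  (* The search for the threshold needs a simplex of positive size eps / w_1. *)
  have w0 : 0 < wa C 0.
    have step c : (0 < c < N)%N -> wa C c.-1 = wa C c.
      move=> cN; case: (boolP (C c)) => [/(hcut c cN)//|nC].
      by rewrite -(blk_mean_notcut hC _ cN).
    have wE i : (i < N)%N -> wa C i = wa C 0%N.
      by elim: i => // i IH iN; rewrite -(step i.+1) //=; apply: IH; nlia.
    rewrite lt_neqAle (wa_ge0 hw hC) // andbT eq_sym; apply/eqP => w0.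
    move: he; rewrite big1_seq ?ltNge ?(ltW eps_gt0) // => i; rewrite mem_index_iota => /andP[_ iN].
    by rewrite wE ?w0 ?mulr0 //; nlia.
  apply: wp_Seq; apply: wp_frame; apply: wp_conseq (wp_threshold hz eps_gt0 (inv_ready i1) w0) _.
  move=> t2 s2 [b [tau [[Cb bN] [htau hlam] h1 h2 ht2]]] [fi fa fv fr fo].
  apply: wp_SetI; left; exists [:: inl 1%N], (tau / wa C 0); split=> //.
  - by rewrite /= fo // /s1 /= -cats1.
  - split; last by move: ht2; rewrite /=; clear; nlia.
    split=> //; first by apply: base_frame hb; rewrite /= /upd ?fi ?fv ?fr.
    by move=> a' b' /hl; rewrite /= !fa.
  - exact: run_b htau h1 h2.
have [hbest hK] := root_best hi T1.
apply: wp_Seq; apply: wp_SetR; apply: wp_Seq; apply: wp_SetR; set s2 := set_rvar _ _ _.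
have i2 : inv C [::] s2 by exact: hi.
have R2 : rvar s2 rR = ratio C (iarr s aT 1%N) by rewrite -hK.
have L2 : rvar s2 rL1 = l1 z w eps C.
  by rewrite /l1 -hD -hW -heps.
have [o2 ru2] : output s2 = output s /\ ivar s2 vRUN = ivar s vRUN by [].
move: (iarr s aT 1%N) hbest R2 {hK T1} => c0 hbest R2.
move: {+}s2 i2 R2 L2 o2 ru2 => {}s2 i2 R2 L2 o2 ru2.
apply: wp_If; rewrite (_ : beval s2 _ = (ratio C c0 < l1 z w eps C)); last by rewrite -R2 -L2.
have weaken h0 t s' : pass_post C s (N * 60 + 400) (40 * m + 400) t s' -> (h0 <= 60)%N ->
    forall t', (t' <= h0 + t)%N -> pass_post C s (N * 60 + 500) (40 * m + 500) t' s'.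
  move=> hp hh t' tt'; case: hp => [[h [lam [g1 g2 g3 [g4 g4'] g5]]]|[S [h [g1 g2 g3 g4 g5]]]].
    left; exists h, lam; split=> //; split=> //.
    by move: g4' hh tt'; clear; nlia.
  right; exists S, h; split=> //.
  have hmul x : (x + (size S).-1 * x = size S * x)%N by rewrite -{2}(prednK g3) mulSn.
  have : ((size S).-1 * (40 * m + 400) <= (size S).-1 * (40 * m + 500))%N by rewrite leq_mul2l; nlia.
  by move: g4 hh tt' (hmul (40 * m + 400)%N) (hmul (40 * m + 500)%N); clear; nlia.
case: ifPn => hr.
  do 3 (apply: wp_Seq; (apply: wp_EmitI || apply: wp_EmitR)).
  apply: wp_Seq; apply: wp_SetR; set s6 := set_rvar _ _ _.
  have i6 : inv C [::] s6 by exact: i2.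
  have e6 : output s6 = output s ++ [:: inl 2%N; inr (ratio C c0); inr (l1 z w eps C)].
    by rewrite /s6 /= R2 L2 o2 -!cats1 -!catA.
  have l6 : rvar s6 rLAM = l1 z w eps C by rewrite /s6 /= /upd /= L2.
  apply: wp_conseq (wp_pop_pass hm (lam := l1 z w eps C) (k := 0) (sb := s) i6 hbest l6 hr _ e6 _ _) _ => //.
    by move=> D h' x hD' hDC hrun'; apply: (run_c hz hw hC hst he hbest hr hD' hDC).
  move=> t s' hp; apply: (weaken 60%N _ s' hp) => //=; nlia.
rewrite -leNgt in hr.
apply: wp_conseq (wp_test_last hz hw hm (k := 0) (sb := s) hst i2 hbest he R2 L2 hr ru2 o2 _) _ => //.
by move=> t s' hp; apply: (weaken 60%N _ s' hp) => //=; nlia.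
Qed.

Definition ncuts C : nat := count C (iota 1 n).

Lemma ncuts_without C S : subcuts N C S -> (ncuts (without C S) + size S = ncuts C)%N.
Proof.
move=> [uS hS]; rewrite /ncuts.
have -> : size S = count (fun x => C x && (x \in S)) (iota 1 n).
  rewrite -size_filter; apply/perm_size/uniq_perm => //; first by rewrite filter_uniq ?iota_uniq.
  move=> x; rewrite mem_filter mem_iota; apply/idP/idP => [xS|/andP[/andP[]]//].
  by have [xN Cx] := hS x xS; rewrite Cx xS; nlia.
elim: (iota 1 n) => //= x r <-; rewrite /without; case: (C x); case: (x \in S) => /=; nlia.
Qed.

(** A potential. Each of the [p] cuts present, stacked or not, can still be unlinked once, and each
    of the [q] cuts not yet stacked can still be stacked once; the remaining terms pay for the pass
    that exits. *)
Definition loop_time (p q : nat) : nat :=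
  (p * (120 * m + 805) + q * (40 * m + 600) + N * 60 + 40 * m + 700)%N.

(** Induction on the number of cuts that are not stacked: unlinking leaves exactly these, and a pass
    that does not exit stacks at least one of them. *)
Lemma wp_main_loop k C S s : (ncuts (without C S) <= k)%N -> strict (without C S) ->
  inv C S s -> ivar s vRUN = 1%N ->
  wp main_loop s (fun t s' => exists h lam C',
    [/\ output s' = output s ++ h, rvar s' rLAM = lam, ready C' s',
        runA eps (avgrow (without C S) z) (avgrow (without C S) w) h (final z w C' lam)
      & (t <= loop_time (ncuts C) (ncuts (without C S)))%N]).
Proof.
elim: k C S s => [|k IH] C S s hk hst hi hrun; apply: wp_While;
  rewrite [beval _ _]/(0 < ivar s vRUN)%N hrun /=; apply: wp_Seq; apply: wp_frame;
  apply: wp_conseq (wp_unlink_all hm hi) _ => t1 s1 [C1 [hC1 hi1 ht1]] [fi1 _ _ _ fo1];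
  (have e1 : C1 =1 without C S by []);
  (have hst1 : strict C1 by move=> c cN; rewrite e1; exact: hst);
  (have ez (v : 'rV[R]_N) : avgrow (without C S) v = avgrow C1 v by exact/esym/avgrow_ext);
  rewrite !ez; apply: wp_frame; apply: wp_conseq (wp_tests hst1 hi1) _;
  (have hsz := ncuts_without (let: And5 _ _ _ _ hs := hi in hs));
  (have hn1 : ncuts C1 = ncuts (without C S) by exact: eq_count);
  move=> t2 s2 [[h [lam [r2 o2 l2 [rd2 ht2] run2]]]|[S2 [h [[r2 i2] o2 S2pos ht2 run2]]]] _.
- apply: wp_While; rewrite [beval _ _]/(0 < ivar s2 vRUN)%N r2 /=.
  exists h, lam, C1; split=> //; first by rewrite o2 fo1.
  move: ht1 ht2; rewrite /loop_time -hsz mulnDl; clear; nlia.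
(* No cut was left, so the pass cannot have stacked one. *)
- have := ncuts_without (let: And5 _ _ _ _ hs := i2 in hs); nlia.
- apply: wp_While; rewrite [beval _ _]/(0 < ivar s2 vRUN)%N r2 /=.
  exists h, lam, C1; split=> //; first by rewrite o2 fo1.
  move: ht1 ht2; rewrite /loop_time -hsz mulnDl; clear; nlia.
have hsz2 := ncuts_without (let: And5 _ _ _ _ hs := i2 in hs).
apply: wp_conseq (IH C1 S2 s2 _ _ i2 _) _.
- by nlia.
- by move=> c cN /andP[Cc _]; apply: hst1.
- by rewrite r2 fi1.
move=> t3 s3 [h' [lam [C' [g1 g2 g3 g4 g5]]]]; exists (h ++ h'), lam, C'; split=> //.
- by rewrite g1 o2 fo1 // catA.
- exact: run2.
move: g5; rewrite /loop_time -hsz -hn1 -hsz2 !mulnDl => g5.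
have hmul : ((size S2).-1 * (40 * m + 500) + (40 * m + 500) = size S2 * (40 * m + 500))%N.
  by rewrite -[in RHS](prednK S2pos) mulSn addnC.
have hmul2 : ((size S2).-1 * (40 * m + 600) + (40 * m + 600) = size S2 * (40 * m + 600))%N.
  by rewrite -[in RHS](prednK S2pos) mulSn addnC.
have : ((size S2).-1 * (40 * m + 500) <= (size S2).-1 * (40 * m + 600))%N.
  by rewrite leq_mul2l; nlia.
move: ht1 ht2 g5 hmul hmul2; clear.
move: (size S2 * (120 * m + 805))%N (ncuts (without C1 S2) * (120 * m + 805))%N
  (size S * (120 * m + 805))%N (size S2 * (40 * m + 500))%N (size S2 * (40 * m + 600))%N
  ((size S2).-1 * (40 * m + 500))%N ((size S2).-1 * (40 * m + 600))%N
  (ncuts (without C1 S2) * (40 * m + 600))%N => x1 x2 x3 x4 x5 x6 x7 x8.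
nlia.
Qed.

End Main.

(** * Initialization from the partition into singletons *)

Definition init_lists : cmd :=
  While (BILt (IVar vI) (IVar vN))
    (PutR aSZ (IAdd (IVar vI) (IConst 1)) (RAdd (RGet aSZ (IVar vI)) (RGet 0 (IVar vI))) ;;
     PutR aSW (IAdd (IVar vI) (IConst 1)) (RAdd (RGet aSW (IVar vI)) (RGet 1 (IVar vI))) ;;
     PutR aRN (IAdd (IVar vI) (IConst 1)) (RAdd (RGet aRN (IVar vI)) ROne) ;;
     PutI aNX (IVar vI) (IAdd (IVar vI) (IConst 1)) ;;
     PutI aPV (IAdd (IVar vI) (IConst 1)) (IVar vI) ;;
     SetR rDOT (RAdd (RVar rDOT) (RMul (RGet 0 (IVar vI)) (RGet 1 (IVar vI)))) ;;
     SetR rWW (RAdd (RVar rWW) (RMul (RGet 1 (IVar vI)) (RGet 1 (IVar vI)))) ;;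
     SetI vI (IAdd (IVar vI) (IConst 1))).

Definition next_cut : cmd := SetI vC (IAdd (IVar vC) (IConst 1)).

Definition init_keys : cmd := While (BILt (IVar vC) (IVar vN)) (refresh ;; next_cut).

(** As z is nonincreasing, the boundaries missing from G(z) are those with z_{c-1} = z_c. Once they
    are stacked, the first [unlink_all] of the main loop performs the initial averaging of w. *)
Definition push_ties : cmd :=
  While (BILt (IVar vC) (IVar vN))
    (If (BREq (RGet 0 (ISub (IVar vC) (IConst 1))) (RGet 0 (IVar vC))) (push vC) Skip ;;
     next_cut).

Definition algorithmA_cmd : cmd :=
  init_lists ;;
  SetI vC (IConst 1) ;; init_keys ;;
  SetI vC (IConst 1) ;; push_ties ;;
  SetI vRUN (IConst 1) ;; main_loop ;;
  emit_final.

Section Initialization.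
Variables (R : realType) (n : nat) (z w : 'rV[R]_n.+1) (eps : R).
Local Notation N := n.+1.
Implicit Types (s : state R).
Local Notation zf := (vec_arr z).
Local Notation wf := (vec_arr w).
Local Notation inv := (inv N zf wf eps).
Local Notation base := (base N zf wf eps).
Local Notation linked := (linked N).
Local Notation total f g := (\sum_(0 <= i < N) f i * g i).

Lemma consec_all a b : consec N predT a b -> b = a.+1.
Proof.
move=> [_ _ ab _ h]; apply/eqP; rewrite eqn_leq ab andbT leqNgt; apply/negP => hlt.
by have := h a.+1; rewrite ltnSn hlt => /(_ isT).
Qed.

(** With every position a cut, averaging changes nothing, so the sums over the input are the right
    initial sums. *)
Lemma blk_mean_all (f : nat -> R) i : (i < N)%N -> blk_mean N predT f i = f i.
Proof.
move=> iN; have hC : cutset N predT by [].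
have h : consec N predT i i.+1 by split=> // j; nlia.
rewrite (blk_mean_consec _ hC h) ?ltnSn ?leqnn //; apply: mean_const => // j hj.
by congr f; nlia.
Qed.

Definition lists_upto i s : Prop :=
  [/\ ivar s vI = i /\ ivar s vN = N, rvar s rEPS = eps /\ rarr s 0 = zf /\ rarr s 1 = wf,
      forall k, (k <= i)%N ->
        [/\ rarr s aSZ k = psum zf k, rarr s aSW k = psum wf k & rarr s aRN k = k%:R],
      forall k, (k < i)%N -> iarr s aNX k = k.+1 /\ iarr s aPV k.+1 = k
    & rvar s rDOT = \sum_(0 <= k < i) zf k * wf k /\
      rvar s rWW = \sum_(0 <= k < i) wf k * wf k].

Lemma wp_init_lists k i s : (N - i <= k)%N -> (i <= N)%N -> lists_upto i s ->
  wp init_lists s (fun t s' => lists_upto N s' /\ (t <= (N - i) * 100 + 10)%N).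
Proof.
elim: k i s => [|k IH] i s hk iN [[hI hN] [he [h0 h1]] hsum hlink [hd hww]]; apply: wp_While;
  (rewrite (_ : beval s _ = (i < N)%N); last by rewrite -hI -[N in RHS]hN).
  have e : i = N by nlia.
  by rewrite e in hI hsum hlink hd hww; rewrite e ltnn subnn.
case: ifPn => [ilt|]; last first.
  rewrite -leqNgt => Ni; have e : i = N by nlia.
  by rewrite e in hI hsum hlink hd hww; rewrite e subnn.
have [g1 g2 g3] := hsum i (leqnn i).
do 3 (apply: wp_Seq; apply: wp_PutR); do 2 (apply: wp_Seq; apply: wp_PutI).
do 2 (apply: wp_Seq; apply: wp_SetR); apply: wp_SetI; set s8 := set_ivar _ _ _.
have l8 : lists_upto i.+1 s8.
  split.
  - by rewrite /s8 /= /upd /= hI addn1.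
  - by [].
  - move=> j; rewrite leq_eqVlt => /orP[/eqP->|ji].
      by rewrite /s8 /= /upd2 /upd /= !hI addn1 !eqxx h0 h1 g1 g2 g3 !psumS -natr1.
    have [k1 k2 k3] := hsum j ji.
    rewrite /s8 /= /upd2 /upd /= !hI addn1.
    by have -> : (j == i.+1) = false by nlia.
  - move=> j; rewrite ltnS leq_eqVlt => /orP[/eqP->|ji].
      by rewrite /s8 /= /upd2 /upd /= !hI addn1 !eqxx.
    have [k1 k2] := hlink j ji.
    rewrite /s8 /= /upd2 /upd /= !hI addn1.
    by have [-> ->] : (j == i) = false /\ (j.+1 == i.+1) = false by nlia.
  - rewrite !big_nat_recr //= -hd -hww -h0 -h1 -hI.
    by split.
apply: wp_conseq (IH _ _ _ ilt l8) _; first by nlia.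
move=> t s' [h2 h3]; split=> //; move: h3 ilt; rewrite /=; clear; nlia.
Qed.

Lemma lists_complete s : lists_upto N s ->
  [/\ base s, linked predT s & sums N zf wf predT s].
Proof.
move=> [[hI hN] [he [h0 h1]] hsum hlink [hd hww]]; split=> //.
  move=> a b hab; rewrite (consec_all hab); apply: hlink.
  by case: hab => *; nlia.
split; [rewrite hd|rewrite hww]; apply: eq_big_nat => i /andP[_ iN];
  by rewrite !blk_mean_all.
Qed.

Lemma wp_push_ties k c S s : (N - c <= k)%N -> (0 < c <= N)%N -> ivar s vC = c ->
  inv predT S s -> rarr s 0 = zf ->
  (forall x, (x \in S) = (0 < x < c)%N && (zf x.-1 == zf x)) ->
  wp push_ties s (fun t s' => exists S', [/\ inv predT S' s',
    forall x, (x \in S') = (0 < x < N)%N && (zf x.-1 == zf x)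
    & (t <= (N - c) * 40 + 10)%N]).
Proof.
elim: k c S s => [|k IH] c S s hk cN hc hi h0 hS; have [[_ [hN _ _] _] _ _ _ _] := hi;
  apply: wp_While;
  (rewrite (_ : beval s _ = (c < N)%N); last by rewrite -hc -[N in RHS]hN).
  have e : c = N by nlia.
  by rewrite e in hS; rewrite e ltnn subnn /=; exists S.
case: ifPn => [clt|]; last first.
  rewrite -leqNgt => Nc; have e : c = N by nlia.
  by rewrite e in hS; rewrite e subnn /=; exists S.
have tail S1 s1 t1 : inv predT S1 s1 -> ivar s1 vC = c -> rarr s1 0 = zf -> (t1 <= 20)%N ->
    (forall x, (x \in S1) = (0 < x < c.+1)%N && (zf x.-1 == zf x)) ->
    wp next_cut s1 (fun t2 s2 => wp push_ties s2 (fun t3 s3 => exists S', [/\ inv predT S' s3,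
      forall x, (x \in S') = (0 < x < N)%N && (zf x.-1 == zf x)
      & (3 + (t1 + t2) + t3 < (N - c) * 40 + 10)%N])).
  move=> i1 c1 z1 ht1 hS1; apply: wp_SetI; set s2 := set_ivar _ _ _.
  have e2 : ivar s2 vC = c.+1 by rewrite /s2 /= /upd /= c1 addn1.
  have i2 : inv predT S1 s2.
    by case: i1 => [[q1 q2 q3] q4 q5 q6 q7]; split=> //; split=> //; apply: base_frame q2.
  apply: wp_conseq (IH _ _ _ _ _ e2 i2 z1 hS1) _; try by nlia.
  move=> t s' [S' [g1 g2 g3]]; exists S'; split=> //.
  by move: g3 ht1 clt; rewrite /=; clear; nlia.
apply: wp_Seq; apply: wp_If.
rewrite (_ : beval s _ = (zf c.-1 == zf c)); last by rewrite /= h0 hc subn1.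
case: ifPn => heq.
  have cN1 : (0 < c < N)%N by nlia.
  have cS : c \notin S by rewrite hS; nlia.
  apply: (wp_push hi hc cN1 isT cS) => s1 [i1 _ r1 _ iv1].
  apply: (tail _ _ _ i1); rewrite ?iv1 ?r1 // => x; rewrite mem_rcons inE hS.
  case: (eqVneq x c) => [->|xc] /=; first by rewrite heq ltnSn; nlia.
  by congr (_ && _); nlia.
apply: wp_Skip; apply: (tail _ _ _ hi) => // x; rewrite hS.
case: (eqVneq x c) => [->|xc]; first by rewrite (negPf heq) !andbF.
by congr (_ && _); nlia.
Qed.

Variable m : nat.
Hypothesis hm : (N + N <= 2 ^ m)%N.

Lemma wp_init_keys k c s : (N - c <= k)%N -> (0 < c <= N)%N -> ivar s vC = c ->
  base s -> linked predT s -> tree N zf wf predT (fun x => (c <= x)%N) (iarr s aT) (rarr s aK) ->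
  wp init_keys s (fun t s' =>
    tree N zf wf predT (fun x => (N <= x)%N) (iarr s' aT) (rarr s' aK) /\
    (t <= (N - c) * (40 * m + 150) + 10)%N).
Proof.
elim: k c s => [|k IH] c s hk cN hc hb hl [t1 t2 t3]; have [hN _ _] := hb; apply: wp_While;
  (rewrite (_ : beval s _ = (c < N)%N); last by rewrite -hc -[N in RHS]hN).
  have e : c = N by nlia.
  by rewrite e in t3; rewrite e ltnn subnn.
case: ifPn => [clt|]; last first.
  rewrite -leqNgt => Nc; have e : c = N by nlia.
  by rewrite e in t3; rewrite e subnn.
have hC : cutset N predT by [].
have cN' : (c <= N)%N by exact: ltnW.
apply: wp_Seq; apply: wp_frame; apply: wp_conseq (wp_refresh hm hb hC hl hc isT cN' t1 t2) _.
move=> t4 s4 [tm4 lv4 h4 ok4 o4] [fi fa fv fr _]; apply: wp_SetI.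
set s5 := set_ivar _ _ _.
have e5 : ivar s5 vC = c.+1 by rewrite /s5 /= /upd /= fi // hc addn1.
have b5 : base s5 by apply: base_frame hb; rewrite /s5 /= /upd /= ?fi ?fv ?fr.
have l5 : linked predT s5 by move=> a b /hl; rewrite /s5 /= !fa.
have tr5 : tree N zf wf predT (fun x => (c < x)%N) (iarr s5 aT) (rarr s5 aK).
  split=> // x xN; split=> // _ xc; case: (eqVneq x c) => [e|xneq].
    by rewrite e; apply: ok4; rewrite -e.
  have [o1 o2] := o4 x xneq; have [_ /(_ isT)] := t3 x xN.
  have -> : ~~ (c <= x)%N by nlia.
  by move=> /(_ isT); apply: leaf_ok_eq.
apply: wp_conseq (IH _ _ _ _ e5 b5 l5 tr5) _; try by nlia.
move=> t s' [h2 h3]; split=> //.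
have -> : (N - c = (N - c.+1).+1)%N by nlia.
by move: h3 tm4; rewrite mulSn /=; clear; nlia.
Qed.

End Initialization.

(** * The whole program and its operation count *)

Section Total.
Variables (R : realType) (n : nat) (z w : 'rV[R]_n.+1) (eps : R).
Hypotheses (hz : in_T z) (hw : in_T w) (eps_gt0 : 0 < eps).
Local Notation N := n.+1.
Variable m : nat.
Hypothesis hm : (N + N <= 2 ^ m)%N.

(** Per position, the multiples of [m] are 40 for entering its key, 120 for removing it (one cleared
    leaf and two refreshed neighbours) and 40 for stacking it; the rest of 240 leaves room for the
    pass that exits. *)
Lemma algorithmA_cmd_correct :
  exists t, implementsA algorithmA_cmd z w eps t /\ (t <= N * (240 * m + 3000))%N.
Proof.
suff : wp algorithmA_cmd (init z w eps) (fun t s => exists h x,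
    [/\ algorithmA eps z w h x, output s = h ++ coordinates x
      & (t <= N * (240 * m + 3000))%N]).
  by move=> [t [s [e [h [x [h1 h2 h3]]]]]]; exists t; split=> //; exists h, x, s.
have l0 : lists_upto z w eps 0 (init z w eps).
  split=> //; last by rewrite !big_geq.
  by move=> k; rewrite leqn0 => /eqP ->; rewrite /psum !big_geq.
apply: wp_Seq; apply: wp_frame; apply: wp_conseq (wp_init_lists (leqnn _) _ l0) _ => //.
move=> t1 s1 [l1 tm1] [fi1 fa1 _ fr1 fo1]; have [b1 k1 d1] := lists_complete l1.
have [_ [_ [z1 _]] _ _ _] := l1.
apply: wp_Seq; apply: wp_SetI; set s2 := set_ivar _ _ _.
have b2 : base N (vec_arr z) (vec_arr w) eps s2 by apply: base_frame b1.
have T2 : iarr s2 aT = fun=> 0%N by rewrite /s2 /= fa1.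
have tr2 : tree N (vec_arr z) (vec_arr w) predT (fun x => (1 <= x)%N) (iarr s2 aT) (rarr s2 aK).
  rewrite T2; split; [by left|by []|].
  by move=> c cN; split=> // _; rewrite (_ : (0 < c)%N = true) //; nlia.
apply: wp_Seq; apply: wp_frame.
apply: wp_conseq (wp_init_keys hm (c := 1) (leqnn _) _ _ b2 k1 tr2) _ => //.
move=> t3 s3 [tr3 tm3] [fi3 fa3 fv3 fr3 fo3].
have hi3 : inv N (vec_arr z) (vec_arr w) eps predT [::] s3.
  split=> //.
  - split=> //; first by apply: base_frame b2; rewrite ?fi3 ?fv3 ?fr3.
    by move=> a b /k1; rewrite !fa3.
  - by case: d1 => e1 e2; split; rewrite fv3.
  - by split=> //; rewrite fi3 // /s2 /= /upd /= fi1.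
  - case: tr3 => q1 q2 q3; split=> // c cN; have [q4 q5] := q3 c cN; split=> // _ _.
    by apply: q5 => //; rewrite -ltnNge; case/andP: cN.
apply: wp_Seq; apply: wp_SetI; set s4 := set_ivar _ _ _.
have hi4 : inv N (vec_arr z) (vec_arr w) eps predT [::] s4.
  by case: hi3 => [[q1 q2 q3] q4 q5 q6 q7]; split=> //; split=> //; apply: base_frame q2.
have z4 : rarr s4 0 = vec_arr z by rewrite /s4 /= fr3 // /s2 /= z1.
apply: wp_Seq; apply: wp_frame; apply: wp_conseq (wp_push_ties (c := 1) (leqnn _) _ _ hi4 z4 _) _ => //.
  by move=> x; rewrite in_nil; case: x => [|[|x]].
move=> t5 s5 [S [hi5 hS tm5]] [_ _ _ _ fo5].
apply: wp_Seq; apply: wp_SetI; set s6 := set_ivar _ _ _.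
have hi6 : inv N (vec_arr z) (vec_arr w) eps predT S s6.
  by case: hi5 => [[q1 q2 q3] q4 q5 q6 q7]; split=> //; split=> //; apply: base_frame q2.
have hsub : subcuts N predT S by case: hi6.
pose D := without predT S.
have hD : cutset N D by apply: cutset_without.
have hcut c : (0 < c < N)%N -> D c = (vec_arr z c < vec_arr z c.-1).
  move=> cN; rewrite /D /without /= hS cN /= lt_neqAle eq_sym.
  by rewrite (noninc_vec_arr hz) ?andbT //; nlia.
have hst : strict z D by move=> c cN; rewrite hcut.
have o6 : output s6 = [::] by rewrite /s6 /= fo5 // /s4 /= fo3 // /s2 /= fo1.
have [ez ew] := initial_cutset hz hD hcut.
have r6 : ivar s6 vRUN = 1%N by [].
apply: wp_Seq; apply: wp_conseq (wp_main_loop hz hw eps_gt0 hm (leqnn _) hst hi6 r6) _.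
move=> t7 s7 [h [lam [C' [o7 lam7 rd7 run7 tm7]]]].
apply: wp_conseq (wp_emit_final rd7 lam7) _ => t8 s8 [o8 tm8].
exists h, (final z w C' lam); split.
- by rewrite /algorithmA ew -{1}ez.
- by rewrite o8 o7 o6.
have hp : ncuts n predT = n by rewrite /ncuts count_predT size_iota.
have hq : (ncuts n (without predT S) <= n)%N.
  by rewrite -[X in (_ <= X)%N](size_iota 1 n); apply: count_size.
move: tm7; rewrite /loop_time hp => tm7.
have hq2 : (ncuts n (without predT S) * (40 * m + 600) <= n * (40 * m + 600))%N.
  by rewrite leq_mul2r hq orbT.
move: tm1 tm3 tm5 tm7 tm8 hq2; rewrite subn0 subn1 /=; clear.
move: (ncuts n (without predT S) * (40 * m + 600))%N => q.
have e k l : (n * (k * m + l) = k * (n * m) + l * n)%N by rewrite mulnDr mulnCA [(n * l)%N]mulnC.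
by rewrite (mulSn n (240 * m + 3000)) !e; move: (n * m)%N => p; lia.
Qed.

End Total.

Lemma trunc_log_ln (R : realType) (N : nat) : (0 < N)%N ->
  N%:R * (trunc_log 2 N).+1%:R <= (2 / ln 2 + 1) * (N%:R * ln N%:R + 1) :> R.
Proof.
move=> N0; have ln2 : 0 < ln 2 :> R by rewrite ln_gt0 // ltr1n.
have lnN : 0 <= ln N%:R :> R by rewrite ln_ge0 // ler1n.
have NR : 0 < N%:R :> R by rewrite ltr0n.
have i2 : 0 <= 2 / ln 2 :> R by rewrite divr_ge0 // ltW.
(* For N = 1 the logarithm vanishes, and the summand 1 in the bound takes over. *)
have [->|N1] := eqVneq N 1%N.
  by rewrite trunc_log1 ln1 mulr0 add0r !mulr1; lra.
set l := trunc_log 2 N.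
have l1 : (0 < l)%N by rewrite trunc_log_gt0; nlia.
have hl : l%:R * ln 2 <= ln N%:R :> R.
  rewrite mulr_natl -lnXn // -natrX ler_ln ?posrE ?ltr0n ?expn_gt0 //.
  by rewrite ler_nat trunc_logP.
(* Here l is at least 1, so l + 1 is at most 2 l; this is the origin of the factor 2. *)
have h1 : l.+1%:R <= 2 / ln 2 * ln N%:R :> R.
  rewrite mulrAC ler_pdivlMr //; apply: le_trans (_ : 2 * (l%:R * ln 2) <= _); last first.
    by rewrite ler_pM2l.
  rewrite mulrA ler_pM2r // -natrM ler_nat; nlia.
have h2 : N%:R * l.+1%:R <= N%:R * (2 / ln 2 * ln N%:R) :> R by rewrite ler_pM2l.
apply: le_trans h2 _.
have h3 : 0 <= N%:R * ln N%:R :> R by rewrite mulr_ge0 // ltW.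
move: (2 / ln 2) (ln N%:R) i2 h3 => a b i2 h3.
by rewrite mulrDl mul1r mulrDr mulr1 mulrCA; lra.
Qed.

Theorem theorem2 (R : realType) :
  exists (c : cmd) (K : R),
    forall (n : nat) (z w : 'rV[R]_n.+1) (eps : R),
      in_T z -> in_T w -> w <> 0 -> 0 < eps ->
      exists t : nat,
        implementsA c z w eps t /\
        t%:R <= K * (n.+1%:R * ln n.+1%:R + 1).
Proof.
exists algorithmA_cmd, (3480%:R * (2 / ln 2 + 1)) => n z w eps hz hw _ eps_gt0.
set l := trunc_log 2 n.+1.
(* The tree has node numbers below 2N, and N < 2 ^ (l + 1), so l + 2 levels suffice. *)
have hm : (n.+1 + n.+1 <= 2 ^ l.+2)%N.
  by rewrite addnn -mul2n expnS leq_mul2l /=; apply/ltnW/trunc_log_ltn.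
have [t [h1 h2]] := algorithmA_cmd_correct hz hw eps_gt0 hm.
exists t; split=> //; rewrite -mulrA.
(* 3480 = 240 * 2 + 3000: with m = l + 2 the factor 240 m + 3000 equals 240 l + 3480, which is at
   most 3480 (l + 1). *)
apply: le_trans (_ : 3480%:R * (n.+1%:R * l.+1%:R) <= _); last first.
  by rewrite ler_pM2l ?ltr0n //; apply: trunc_log_ln.
rewrite -!natrM ler_nat; apply: leq_trans h2 _.
by rewrite mulnCA leq_mul2l /=; nlia.
Qed.
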